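(* Let $K$ be an infinite field of characteristic $p>0$, let $n\ge r$ be positive integers, and let $\lambda=(a,b,1^d)\in\Lambda^+(n,r)$ and $\mu=(a+d,b)\in\Lambda^+(2,r)$, where $b,d\ge 2$. Then the following hold. 1) If $p=2$, then: (i) $\dim_K\mathrm{Hom}_S(\Delta(\lambda),\Delta(\mu))\le 1$. (ii) $\mathrm{Hom}_S(\Delta(\lambda),\Delta(\mu))\ne 0$ if and only if $a$ is an even integer. (iii) (a) If $a$ and $b$ are even, then the element $\sum_{r_h\in H_1(\lambda,\mu)}F_{r_h}$ induces a generator of the space $\mathrm{Hom}_S(\Delta(\lambda),\Delta(\mu))$. (b) If $a$ is even and $b$ is odd, then the element $\sum_{h\in H_2(\lambda,\mu)}F_{h}$ induces a generator of the space $\mathrm{Hom}_S(\Delta(\lambda),\Delta(\mu))$. 2) If $p>2$, then $\mathrm{Hom}_S(\Delta(\lambda),\Delta(\mu))=0$.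
   Context: Representations. $V=K^n$ is the natural module of $G=GL_n(K)$ with natural basis $e_1,\dots,e_n$; $e_i$ is denoted simply by $i$. $S=S_K(n,r)$ is the Schur algebra; $S$-modules are the homogeneous polynomial representations of $G$ of degree $r$ and $\mathrm{Hom}_S=\mathrm{Hom}_G$. $\Lambda(n,r)$ is the set of sequences of $n$ nonnegative integers with sum $r$; $\Lambda^+(n,r)$ is the subset of partitions (weakly decreasing sequences). Partitions are padded by zeros when needed, and $1^d$ means $d$ parts equal to $1$. $DV=\sum_{i\ge0}D_iV$ is the divided power (Hopf) algebra of $V$, with divided powers $i^{(m)}\in D_mV$. For $\alpha\in\Lambda(n,r)$, $D(\alpha)=D_{\alpha_1}V\otimes\cdots\otimes D_{\alpha_n}V$. For a partition $\mu$ with conjugate $\mu'$, the Weyl module $\Delta(\mu)$ is the image of $d'_\mu:D(\mu)\to\Lambda^{\mu'_1}V\otimes\Lambda^{\mu'_2}V\otimes\cdots$, which comultiplies each $D_{\mu_i}V$ into $V^{\otimes\mu_i}$ (one factor per box of row $i$), rearranges the factors according to the columns of the diagram of $\mu$, and multiplies each column into the exterior power. Write $\pi_{\Delta(\lambda)}:D(\lambda)\to\Delta(\lambda)$ for the surjection given by $d'_\lambda$. An element $F\in\mathrm{Hom}_S(D(\lambda),\Delta(\mu))$ induces $f\in\mathrm{Hom}_S(\Delta(\lambda),\Delta(\mu))$ if $F=f\circ\pi_{\Delta(\lambda)}$. Tableaux. A row semistandard tableau of shape $\mu$ is a filling of the diagram of $\mu$ by entries in $\{1,\dots,n\}$ weakly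 increasing along rows; its weight is $(\alpha_1,\dots,\alpha_n)$ where $\alpha_i$ is the number of entries equal to $i$. $\mathrm{RSST}_\lambda(\mu)$ is the set of row semistandard tableaux of shape $\mu$ and weight $\lambda$. Such two-row tableaux are written by listing the rows in exponential notation, e.g. $1^{(a)}2^{(h)}\cdots$. For $T\in \mathrm{RSST}_\lambda(\mu)$ let $a_i$ (resp. $b_i$) be the number of $i$'s in the first (resp. second) row, so $\lambda_i=a_i+b_i$. The $S$-map $\phi_T:D(\lambda)\to\Delta(\mu)$ is the composition of: comultiplications $D_{\lambda_i}V\to D_{a_i}V\otimes D_{b_i}V$ for all $i$; the rearrangement to $(D_{a_1}V\otimes\cdots\otimes D_{a_n}V)\otimes(D_{b_1}V\otimes\cdots\otimes D_{b_n}V)$; the multiplications to $D_{\mu_1}V\otimes D_{\mu_2}V=D(\mu)$; and $d'_\mu:D(\mu)\to\Delta(\mu)$. The elements $F_h$. Let $G_d$ be the symmetric group on $d$ symbols and, for $0\le s\le d$, $\mathrm{Sh}(s,d-s)=\{\sigma\in G_d:\sigma(1)<\cdots<\sigma(s),\ \sigma(s+1)<\cdots<\sigma(d)\}$ (just the identity when $s=0$ or $s=d$). Put $(x_1,\dots,x_d)=(3,\dots,d+2)$. For $0\le h\le\min\{b,d\}$ and $\sigma\in\mathrm{Sh}(d-h,h)$, let $T_{h,\sigma}\in\mathrm{RSST}_\lambda(\mu)$ be the tableau with first row $1^{(a)}2^{(h)}x_{\sigma(1)}\cdots x_{\sigma(d-h)}$ and second row $2^{(b-h)}x_{\sigma(d-h+1)}\cdots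 x_{\sigma(d)}$. Set $F_h=\sum_{\sigma\in\mathrm{Sh}(d-h,h)}\phi_{T_{h,\sigma}}\in\mathrm{Hom}_S(D(\lambda),\Delta(\mu))$. 2-complements. Let $i,k$ be nonnegative integers. If $i$ has base 2 representation $i=\sum_{j=0}^m i_j2^j$ with $i_m=1$, then $k$ is a 2-complement of $i$ if $i+k$ has base 2 representation of the form $\sum_{j\ge m+1}t_j2^j+\sum_{j=0}^m2^j$ with $t_j\in\{0,1\}$. For $i=0$ the convention is that $k$ is a 2-complement of $0$ when $k$ is odd (and only then). An integer $x=\sum x_j2^j$ contains the base 2 representation of $y=\sum y_j2^j$ (base 2 representations) if $y_j=1$ implies $x_j=1$ for all $j$. The sets $H_1,H_2$. (i) Assume $a,b$ even and put $a-b=2k$. Let $r_0,\dots,r_l$ ($r_i=2i+1$) be all the odd integers in $[1,\min\{b,d\}]$. Let $i_0$ be the maximum integer in $[0,l]$ such that $k$ is a 2-complement of $i_0$. Then $H_1(\lambda,\mu)=\{r_h: h\le l$ and $h$ contains the base 2 representation of $i_0\}$. (ii) Assume $a$ even, $b$ odd and put $\gamma=a-b$. Let $j_0$ be the maximum integer in $[0,\min\{b,d\}]$ such that $\gamma$ is a 2-complement of $j_0$. Then $H_2(\lambda,\mu)=\{h: h\le\min\{b,d\}$ and $h$ contains the base 2 representation of $j_0\}$. (Here $h$ ranges over nonnegative integers.)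
   Formalization: When min{b,d}=2 and k=(a-b)/2 is even, no integer i_0 as in the definition of H_1 exists (e.g. a=b=d=2); there the maximum is read as 0, so H_1={1}, and the claim is proved with this reading. *)

(* Defs.v *)
From HB Require Import structures.
From mathcomp Require Import all_boot all_order all_algebra all_fingroup.
From mathcomp Require Import boolp.

Set Implicit Arguments.
Unset Strict Implicit.
Unset Printing Implicit Defensive.

Import GRing.Theory.
Local Open Scope ring_scope.

(* Conventions.  V = K^n has the natural basis e_1, ..., e_n; e_k is indexed by
   the ordinal k-1 : 'I_n.  All the spaces below are finite dimensional with a
   distinguished basis B, and are represented as {ffun B -> K^o}. *)

Definition free_on (K : fieldType) (B : finType) : vectType K :=
  {ffun B -> K^o}.

Definition lin_ext_fun (K : fieldType) (B C : finType) (k : B -> C -> K)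
    (x : free_on K B) : free_on K C :=
  [ffun c => \sum_b (x b : K) * k b c].

(* The linear map sending each basis element b to \sum_c k b c *: c. *)
Definition lin_ext (K : fieldType) (B C : finType) (k : B -> C -> K) :
    'Hom(free_on K B, free_on K C) :=
  linfun (lin_ext_fun k).

Lemma lin_ext_fun_linear (K : fieldType) (B C : finType) (k : B -> C -> K) :
  linear (lin_ext_fun k).
Proof.
move=> c x y; apply/ffunP=> t; rewrite !ffunE scaler_sumr -big_split /=.
by apply: eq_bigr => b _; rewrite !ffunE mulrDl; congr (_ + _); exact/esym/mulrA.
Qed.

HB.instance Definition _ (K : fieldType) (B C : finType) (k : B -> C -> K) :=
  GRing.isLinear.Build K (free_on K B) (free_on K C) *:%R (lin_ext_fun k)
    (lin_ext_fun_linear k).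

Lemma lin_extE (K : fieldType) (B C : finType) (k : B -> C -> K)
    (x : free_on K B) (c : C) :
  lin_ext k x c = \sum_b (x b : K) * k b c.
Proof. by rewrite lfunE ffunE. Qed.

(* s, padded with zeros to length q, lies in Lambda^+(q, r). *)
Definition is_part (q r : nat) (s : seq nat) : bool :=
  [&& sorted geq s, sumn s == r & (size s <= q)%N].

Definition pad (q : nat) (s : seq nat) : 'I_q -> nat := fun i => nth 0%N s i.
Arguments pad q s _ : clear implicits.

(* The basis of D_m V: the divided power monomials 1^(A_1) ... n^(A_n) with
   A_1 + ... + A_n = m. *)
Definition dpmon (n m : nat) : finType :=
  {A : {ffun 'I_n -> 'I_m.+1} | (\sum_k (A k : nat) == m)%N}.

Section DividedPowers.
Variables (K : fieldType) (n : nat).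

(* The basis of the tensor product of the D_{al i} V, i in I. *)
Definition dpbasis (I : finType) (al : I -> nat) : finType :=
  {dffun forall i : I, dpmon n (al i)}.

Definition dpow (I : finType) (al : I -> nat) : vectType K :=
  free_on K (dpbasis al).

Definition expo (I : finType) (al : I -> nat) (A : dpbasis al) (i : I)
    (k : 'I_n) : nat := val (A i) k.

Definition merges (I J : finType) (p : J -> I) (al : I -> nat) (ga : J -> nat)
    (A : dpbasis al) (C : dpbasis ga) : bool :=
  [forall i, forall k, (\sum_(j | p j == i) expo C j k == expo A i k)%N].

(* For p : J -> I, comultiply each factor D_{al i} V into the tensor product of
   the D_{ga j} V with p j = i; it comes from
   k^(m) |-> \sum_(s + t = m) k^(s) (x) k^(t). *)
Definition dcomul (I J : finType) (p : J -> I) (al : I -> nat)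
    (ga : J -> nat) : 'Hom(dpow al, dpow ga) :=
  lin_ext (fun A C => (merges p A C)%:R).

(* For p : J -> I, multiply together, for each i, the factors D_{ga j} V with
   p j = i; it comes from k^(s) k^(t) = 'C(s + t, s) k^(s + t). *)
Definition dmul (I J : finType) (p : J -> I) (ga : J -> nat)
    (al : I -> nat) : 'Hom(dpow ga, dpow al) :=
  lin_ext (fun C A =>
    if merges p A C then
      \prod_i \prod_k
        ((expo A i k)`! %/ \prod_(j | p j == i) (expo C j k)`!)%:R
    else 0).

End DividedPowers.

(* Basis of Lambda^m V: the subset S stands for the wedge product of its
   elements taken in increasing order. *)
Definition extmon (n m : nat) : finType := {S : {set 'I_n} | #|S| == m}.

Fixpoint ninv (n : nat) (u : seq 'I_n) : nat :=
  if u is x :: u' then (count (fun y : 'I_n => (y < x)%N) u' + ninv u')%N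
  else 0%N.

Section Weyl.
Variables (K : fieldType) (n : nat).

(* The coefficient of S in e_{u_1} /\ ... /\ e_{u_m}. *)
Definition wedge_coef (u : seq 'I_n) (S : {set 'I_n}) : K :=
  if uniq u && ([set x in u] == S) then (-1) ^+ ninv u else 0.

(* The coefficient of T in (g e_{s_1}) /\ ... /\ (g e_{s_m}), where S is
   s_1 < ... < s_m and g e_k = \sum_l g l k *: e_l. *)
Definition ext_act_coef (g : 'M[K]_n) (S T : {set 'I_n}) : K :=
  \sum_(u : #|S|.-tuple 'I_n)
    (\prod_(k < #|S|) g (tnth u k) (enum_val k)) * wedge_coef u T.

Variable q : nat.
Implicit Types al : 'I_q -> nat.

Definition ncols al : nat := \max_i al i.

Definition conjp al (j : nat) : nat := #|[set i | (j < al i)%N]|.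

(* The boxes (i, j) of the diagram, i being the row and j the column. *)
Definition box al : finType :=
  {x : 'I_q * 'I_(ncols al) | (x.2 < al x.1)%N}.

Definition col_boxes al (j : 'I_(ncols al)) : seq (box al) :=
  pmap (fun i => insub (i, j)) (enum 'I_q).

(* The tensor power of V with one factor per box; a basis element assigns
   to each box a basis vector of V. *)
Definition tens al : vectType K := free_on K {ffun box al -> 'I_n}.

Definition extbasis al : finType :=
  {dffun forall j : 'I_(ncols al), extmon n (conjp al j)}.

(* Lambda^{al'_1} V (x) Lambda^{al'_2} V (x) ... *)
Definition ext al : vectType K := free_on K (extbasis al).

(* Comultiply each D_{al i} V into V (x) ... (x) V, one factor per box of
   row i: a monomial goes to the sum of its distinct rearrangements. *)
Definition row_comul al : 'Hom(dpow K n al, tens al) :=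
  lin_ext (fun (A : dpbasis n al) (w : {ffun box al -> 'I_n}) =>
    [forall i, forall k,
       #|[set x : box al | ((val x).1 == i) && (w x == k)]| == expo A i k]%:R).

(* Multiply the factors of each column, from top to bottom. *)
Definition col_wedge al : 'Hom(tens al, ext al) :=
  lin_ext (fun (w : {ffun box al -> 'I_n}) (S : extbasis al) =>
    \prod_(j < ncols al)
      wedge_coef [seq w x | x <- col_boxes j] (val (S j))).

Definition dprime al : 'Hom(dpow K n al, ext al) :=
  (col_wedge al \o row_comul al)%VF.

Definition Weyl al : {vspace ext al} := limg (dprime al).

Definition Weyl_proj al : 'Hom(dpow K n al, subvs_of (Weyl al)) :=
  (linfun (vsproj (Weyl al)) \o dprime al)%VF.

Definition ext_act al (g : 'M[K]_n) : 'End(ext al) :=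
  lin_ext (fun S T : extbasis al =>
    \prod_(j < ncols al) ext_act_coef g (val (S j)) (val (T j))).

End Weyl.

Section HomG.
Variables (K : fieldType) (n q1 q2 : nat).
Variables (la : 'I_q1 -> nat) (mu : 'I_q2 -> nat).

(* f commutes with the action of GL_n(K); w below is the element g v of
   Weyl la. *)
Definition is_Ghom (f : 'Hom(subvs_of (Weyl K n la), subvs_of (Weyl K n mu))) :
    Prop :=
  forall g : 'M[K]_n, g \in unitmx ->
  forall v w : subvs_of (Weyl K n la),
    vsval w = ext_act la g (vsval v) ->
    vsval (f w) = ext_act mu g (vsval (f v)).

Lemma submodP (V : vectType K) (P : V -> Prop) :
  P 0 -> (forall c u v, P u -> P v -> P (c *: u + v)) ->
  exists U : {vspace V}, forall v, v \in U <-> P v.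
Proof.
move=> P0 PD.
suff H m (U : {vspace V}) : (forall v, v \in U -> P v) ->
    (\dim {:V} - \dim U <= m)%N ->
    exists U' : {vspace V}, forall v, v \in U' <-> P v.
  by apply: (H (\dim {:V}) 0%VS) (leq_subr _ _) => v; rewrite memv0 => /eqP->.
elim: m U => [|m IHm] U UP dU; have [PU|] := EM (forall v, P v -> v \in U);
  try by exists U => v; split; [exact: UP | exact: PU].
  case=> v _; suff /eqP-> : U == fullv by exact: memvf.
  by rewrite eqEdim subvf -subn_eq0 -leqn0.
move=> /existsNP[v /not_implyP[Pv /negP vU]].
apply: (IHm (U + <[v]>)%VS) => [w|].
  case/memv_addP=> x /UP Px [y /vlineP[c ->] ->].
  by rewrite addrC; apply: PD.
have ltd : (\dim U < \dim (U + <[v]>))%N.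
  rewrite ltn_neqAle dimvS ?addvSl // andbT; apply/eqP => eqd; case: vU.
  have /eqP-> : U == (U + <[v]>)%VS by rewrite eqEdim addvSl eqd leqnn.
  by rewrite (subvP (addvSr U <[v]>)) ?memv_line.
rewrite -ltnS (leq_trans _ dU) // ltn_sub2l //.
by rewrite (leq_trans ltd) // dimvS ?subvf.
Qed.

Lemma is_Ghom_submod :
  exists U : {vspace 'Hom(subvs_of (Weyl K n la), subvs_of (Weyl K n mu))},
  forall f, f \in U <-> is_Ghom f.
Proof.
apply: submodP => [g _ v w _|c f1 f2 H1 H2 g gu v w vw].
  by rewrite !zero_lfunE !linear0.
by rewrite !add_lfunE !scale_lfunE !linearP /= (H1 g gu v w) // (H2 g gu v w).
Qed.

(* For K infinite, Hom_S(Delta(la), Delta(mu)) = Hom_G(Delta(la), Delta(mu)). *)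
Definition HomG :
    {vspace 'Hom(subvs_of (Weyl K n la), subvs_of (Weyl K n mu))} :=
  sval (cid is_Ghom_submod).

Lemma HomGP f : f \in HomG <-> is_Ghom f.
Proof. exact: (svalP (cid is_Ghom_submod)). Qed.

Definition induces_generator
    (F : 'Hom(dpow K n la, subvs_of (Weyl K n mu))) : Prop :=
  exists f : 'Hom(subvs_of (Weyl K n la), subvs_of (Weyl K n mu)),
    [/\ f \in HomG, F = (f \o Weyl_proj K n la)%VF & HomG = <[f]>%VS].

End HomG.

(* A tableau is the list of its rows; entries lie in {1, ..., n}. *)
Definition tableau := seq (seq nat).

(* The pair (i, k) is sent to the number of entries i+1 in row k. *)
Definition tcount (n q : nat) (T : tableau) : 'I_n * 'I_q -> nat :=
  fun x => count_mem x.1.+1 (nth [::] T x.2).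

(* The tensor factors of the intermediate space are indexed by the pairs
   (entry, row), so that the rearrangement of factors is implicit. *)
Definition phi (K : fieldType) (n q : nat) (la : 'I_n -> nat) (mu : 'I_q -> nat)
    (T : tableau) : 'Hom(dpow K n la, subvs_of (Weyl K n mu)) :=
  (Weyl_proj K n mu \o dmul K n snd (tcount T) mu
     \o dcomul K n fst la (tcount T))%VF.

(* sigma \in Sh(s, d - s) *)
Definition is_shuffle (d s : nat) (sg : 'S_d) : bool :=
  [forall i : 'I_d, forall j : 'I_d,
     ((i < j) && ((j < s) || (s <= i)) ==> (sg i < sg j))%N].

(* T_{h,sigma}; with 0-based indices x_{sigma(i)} is sigma(i) + 3. *)
Definition Ttab (a b d h : nat) (sg : 'S_d) : tableau :=
  [:: nseq a 1 ++ nseq h 2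
        ++ [seq (sg i : nat).+3 | i : 'I_d <- enum 'I_d & (i < d - h)%N];
      nseq (b - h) 2
        ++ [seq (sg i : nat).+3 | i : 'I_d <- enum 'I_d & (d - h <= i)%N]]%N.

Definition lam (a b d : nat) : seq nat := a :: b :: nseq d 1%N.
Definition mu2 (a b d : nat) : seq nat := [:: a + d; b]%N.

Definition Fh (K : fieldType) (n a b d h : nat) :
    'Hom(dpow K n (pad n (lam a b d)),
         subvs_of (Weyl K n (pad 2 (mu2 a b d)))) :=
  \sum_(sg : 'S_d | is_shuffle (d - h) sg)
    phi K (pad n (lam a b d)) (pad 2 (mu2 a b d)) (Ttab a b h sg).

Definition bit (x j : nat) : bool := odd (x %/ 2 ^ j).

(* For i > 0 the leading binary digit of i is in position trunc_log 2 i. *)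
Definition two_compl (i k : nat) : bool :=
  if i == 0%N then odd k
  else all (bit (i + k)) (iota 0 (trunc_log 2 i).+1).

Definition contains2 (x y : nat) : bool := `[< forall j, bit y j -> bit x j >].

(* The odd integers in [1, min(b, d)] are 2 * i + 1 for i in [0, H1_l b d]. *)
Definition H1_l (b d : nat) : nat := (minn b d).-1./2.

(* When min(b, d) = 2 and k is even no i0 as in the definition of H_1 exists
   and the maximum of the empty set is read as 0, so that H_1 = {1}. *)
Definition H1_i0 (a b d : nat) : nat :=
  \max_(i < (H1_l b d).+1 | two_compl i (a - b)./2) i.

Definition H1 (a b d : nat) : seq nat :=
  [seq h.*2.+1 | h <- iota 0 (H1_l b d).+1 & contains2 h (H1_i0 a b d)].

Definition H2_j0 (a b d : nat) : nat :=
  \max_(j < (minn b d).+1 | two_compl j (a - b)) j.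

Definition H2 (a b d : nat) : seq nat :=
  [seq h <- iota 0 (minn b d).+1 | contains2 h (H2_j0 a b d)].

(* Main.v *)
From HB Require Import structures.
Require Import Defs.
From mathcomp Require Import all_boot all_order all_algebra all_fingroup.
From mathcomp Require Import boolp zify ring.

(* A homomorphism f is determined by x = f(w), w the image of the pure tensor
   with unit rows.  This x has weight lambda and is fixed by the unipotent
   matrices, and conversely each such x comes from a homomorphism: an element of
   D(lambda)^* invariant under adding a multiple of a row to the next one is a
   combination of products of column minors, by straightening.

   An element of Delta(mu) is a sum of tensors of columns p /\ q and p, hence is
   known from the sums of the products of minors (p, q)_{ij} and coordinates
   p_k.  By the Pluecker relation only the products whose minors all involve the
   letter 1 matter; indexing them by the set T of the letters i > 2 occurring in
   a minor, call c_T the corresponding value at x.  Invariance under the letters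
   i > 2 makes c_T change sign when an element of T is replaced by its
   successor, and gives 2 c_T = 0; so x = 0 if p > 2, while if p = 2, c_T depends
   only on t = #T.  With g = a - b and M = min(b, d), invariance under the first
   two letters then means
     C(B, q) c_(B - q) = C(B + g + 1, q) c_B   for q <= B <= M.
   If a is odd the case q = 1 forces c = 0.  In general c is determined by its
   value at the largest j <= M such that 2^e divides j + g + 1 for some
   2^e > j, that is, such that g is a 2-complement of j (or j = 0).  Finally F_h
   has c_t = 1 if t = h and 0 otherwise, and the indicators of H_1 and H_2
   satisfy the recurrence by Lucas' theorem. *)

Set Implicit Arguments.
Unset Strict Implicit.
Unset Printing Implicit Defensive.

Import Order.TTheory GRing.Theory Num.Theory.
Local Open Scope ring_scope.

(** * Sums over lists of letters *)

Section SumList.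
Variables (K : comNzRingType) (N : finType).

Fixpoint sum_list (m : nat) (H : seq N -> K) : K :=
  if m is m'.+1 then \sum_y sum_list m' (fun t => H (y :: t)) else H [::].

Lemma eq_sum_list m (H1 H2 : seq N -> K) :
  (forall t, size t = m -> H1 t = H2 t) -> sum_list m H1 = sum_list m H2.
Proof.
elim: m H1 H2 => [|m IHm] H1 H2 eqH /=; first exact: eqH.
by apply: eq_bigr => y _; apply: IHm => t st; apply: eqH; rewrite /= st.
Qed.

Lemma sum_listD m (H1 H2 : seq N -> K) :
  sum_list m (fun t => H1 t + H2 t) = sum_list m H1 + sum_list m H2.
Proof.
elim: m H1 H2 => [|m IHm] H1 H2 //=.
by rewrite -big_split /=; apply: eq_bigr => y _; rewrite IHm.
Qed.

Lemma sum_listZ m c (H : seq N -> K) :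
  sum_list m (fun t => c * H t) = c * sum_list m H.
Proof.
elim: m H => [|m IHm] H //=.
by rewrite big_distrr /=; apply: eq_bigr => y _; rewrite IHm.
Qed.

Lemma sum_list0 m (H : seq N -> K) :
  (forall t, size t = m -> H t = 0) -> sum_list m H = 0.
Proof.
move=> H0; rewrite (@eq_sum_list _ _ (fun t => 0 * H t)); last first.
  by move=> t /H0->; rewrite mul0r.
by rewrite sum_listZ mul0r.
Qed.

Lemma exchange_sum_list m (I : finType) (P : pred I) (H : I -> seq N -> K) :
  \sum_(i | P i) sum_list m (H i) = sum_list m (fun t => \sum_(i | P i) H i t).
Proof.
elim: m H => [|m IHm] H //=.
by rewrite exchange_big /=; apply: eq_bigr => y _; rewrite IHm.
Qed.

Lemma sum_list_tuple m (H : seq N -> K) :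
  \sum_(t : m.-tuple N) H t = sum_list m H.
Proof.
elim: m H => [|m IHm] H /=.
  by rewrite (big_pred1 [tuple]) // => t; apply/esym/eqP; rewrite tuple0.
under [RHS]eq_bigr => y _ do rewrite -IHm.
rewrite pair_big /=.
rewrite (reindex (fun p : N * m.-tuple N => [tuple of p.1 :: p.2])) //=.
exists (fun t : m.+1.-tuple N => (thead t, [tuple of behead t])) => [[x t]|t] _ /=.
  by rewrite theadE; congr (_, _); apply: val_inj.
by rewrite /= -tuple_eta.
Qed.

Lemma sum_list_cat m1 m2 (H1 H2 : seq N -> K) :
  sum_list (m1 + m2) (fun t => H1 (take m1 t) * H2 (drop m1 t)) =
  sum_list m1 H1 * sum_list m2 H2.
Proof.
elim: m1 H1 => [|m IHm] H1 /=.
  by rewrite -sum_listZ; apply: eq_sum_list => t _; rewrite take0 drop0.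
rewrite big_distrl /=; apply: eq_bigr => y _.
by rewrite -(IHm (fun t => H1 (y :: t))).
Qed.

Lemma sum_list_ffun (X : finType) (xs : seq X) (H : seq N -> K) :
  perm_eq xs (enum X) ->
  \sum_(u : {ffun X -> N}) H [seq u x | x <- xs] = sum_list (size xs) H.
Proof.
move=> xsX; rewrite -sum_list_tuple.
have xsU : uniq xs by rewrite (perm_uniq xsX) enum_uniq.
have xsI x : (index x xs < size xs)%N.
  by rewrite index_mem (perm_mem xsX) mem_enum.
rewrite (reindex (fun t : (size xs).-tuple N =>
    [ffun x => tnth t (Ordinal (xsI x))])) /=; last first.
  exists (fun u : {ffun X -> N} => [tuple of map u (in_tuple xs)]) => [t|u] _.
    apply: eq_from_tnth => i; rewrite tnth_map ffunE; congr tnth.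
    by apply: val_inj; rewrite /= (tnth_nth (tnth (in_tuple xs) i)) index_uniq.
  apply/ffunP => x; rewrite ffunE tnth_map; congr (u _).
  by rewrite (tnth_nth x) /= nth_index // (perm_mem xsX) mem_enum.
apply: eq_bigr => t _; congr H.
have st := size_tuple t; case: (posnP (size xs)) => [sx0|sx].
  by rewrite [tval t]size0nil ?st //; apply: size0nil; rewrite size_map.
pose y0 := tnth t (Ordinal sx); have [x0 _] : exists x0, x0 \in xs.
  by exists (tnth (in_tuple xs) (Ordinal sx)); exact: mem_tnth.
apply: (@eq_from_nth _ y0); first by rewrite size_map st.
move=> i; rewrite size_map => lti; rewrite (nth_map x0) // ffunE (tnth_nth y0) /=.
by rewrite index_uniq.
Qed.

Fixpoint prod_pieces (X J : Type) (f : J -> seq X) (H : J -> seq N -> K)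
    (r : seq J) (t : seq N) : K :=
  if r is j :: r' then
    H j (take (size (f j)) t) * prod_pieces f H r' (drop (size (f j)) t)
  else 1.

Lemma prod_pieces_map (X J : Type) (f : J -> seq X) H r (u : X -> N) :
  prod_pieces f H r [seq u x | x <- flatten [seq f j | j <- r]] =
  \prod_(j <- r) H j [seq u x | x <- f j].
Proof.
elim: r => [|j r IHr] /=; first by rewrite big_nil.
rewrite big_cons map_cat take_size_cat ?size_map // drop_size_cat ?size_map //.
by rewrite IHr.
Qed.

Lemma sum_list_pieces (X J : Type) (f : J -> seq X) H r :
  sum_list (size (flatten [seq f j | j <- r])) (prod_pieces f H r) =
  \prod_(j <- r) sum_list (size (f j)) (H j).
Proof.
elim: r => [|j r IHr] /=; first by rewrite big_nil.
by rewrite big_cons size_cat -IHr sum_list_cat.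
Qed.

Lemma sum_ffun_pieces (X J : finType) (f : J -> seq X) (H : J -> seq N -> K) :
  perm_eq (flatten [seq f j | j <- enum J]) (enum X) ->
  \sum_(u : {ffun X -> N}) \prod_j H j [seq u x | x <- f j] =
  \prod_j sum_list (size (f j)) (H j).
Proof.
move=> fX; rewrite -[RHS]big_enum -sum_list_pieces -(sum_list_ffun _ fX).
by apply: eq_bigr => u _; rewrite prod_pieces_map big_enum.
Qed.

End SumList.

Section SwapAt.
Variables (K : comNzRingType) (n : nat).
Local Notation N := 'I_n.

Fixpoint swap_at (T : Type) (i : nat) (t : seq T) : seq T :=
  match i, t with
  | 0, x :: y :: t' => y :: x :: t'
  | i'.+1, x :: t' => x :: swap_at i' t'
  | _, _ => t
  end.

Lemma swap_at_cat (T : Type) (s1 s2 : seq T) x y :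
  swap_at (size s1) (s1 ++ x :: y :: s2) = s1 ++ y :: x :: s2.
Proof. by elim: s1 => //= z s1 ->. Qed.

Lemma sum_list_swap m1 m2 (H : seq N -> K) :
  sum_list (m1 + m2.+2) (fun t => H (swap_at m1 t)) = sum_list (m1 + m2.+2) H.
Proof.
elim: m1 H => [|m IHm] H /=; first by rewrite exchange_big.
by apply: eq_bigr => y _; apply: (IHm (fun t => H (y :: t))).
Qed.

Lemma alternating_sum0 (F : N -> N -> K) :
  (forall x y, F x y = - F y x) -> (forall x, F x x = 0) ->
  \sum_x \sum_y F x y = 0.
Proof.
move=> FN F0; rewrite pair_big /=.
rewrite (bigID (fun p : N * N => p.1 < p.2)%N) /=.
rewrite [X in _ + X](bigID (fun p : N * N => p.1 == p.2)) /=.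
rewrite [X in _ + (X + _)]big1 ?add0r; last first.
  by case=> x y /= /andP[_ /eqP->].
rewrite [X in _ + X](reindex (fun p : N * N => (p.2, p.1))) /=; last first.
  by exists (fun p : N * N => (p.2, p.1)) => [[]|[]].
under [X in _ + X]eq_bigr => p _ do rewrite FN.
rewrite sumrN; apply/eqP; rewrite subr_eq0; apply/eqP; apply: eq_bigl => -[x y].
by rewrite -leqNgt /= ltn_neqAle andbC eq_sym.
Qed.

Lemma sum_list_alt0 m1 m2 (H : seq N -> K) :
  (forall s1 x y s2, size s1 = m1 ->
    H (s1 ++ x :: y :: s2) = - H (s1 ++ y :: x :: s2)) ->
  (forall s1 x s2, size s1 = m1 -> H (s1 ++ x :: x :: s2) = 0) ->
  sum_list (m1 + m2.+2) H = 0.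
Proof.
elim: m1 H => [|m IHm] H HN H0 /=; last first.
  apply: big1 => y _; apply: IHm => [s1 x z s2 ss|s1 x s2 ss].
    by apply: (HN (y :: s1)); rewrite /= ss.
  by apply: (H0 (y :: s1)); rewrite /= ss.
apply: (@alternating_sum0 (fun x y => sum_list m2 (fun t => H (x :: y :: t)))).
  move=> x y; rewrite -[RHS]mulN1r -sum_listZ; apply: eq_sum_list => t _.
  by rewrite mulN1r (HN [::]).
by move=> x; apply: sum_list0 => t _; apply: (H0 [::]).
Qed.

End SwapAt.

(** * Column words in exterior powers *)

Section Wedge.
Variables (K : fieldType) (n : nat).
Local Notation N := 'I_n.
Local Notation wc := (@wedge_coef K n).

Lemma ninv_swap (s1 s2 : seq N) x y :
  (ninv (s1 ++ x :: y :: s2) + (x < y) = ninv (s1 ++ y :: x :: s2) + (y < x))%N.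
Proof.
elim: s1 => [|z s1 IHs] /=; first by lia.
by rewrite !count_cat /=; lia.
Qed.

Lemma sign_ninv_swap (s1 s2 : seq N) x y : x != y ->
  (-1) ^+ ninv (s1 ++ x :: y :: s2) = - (-1) ^+ ninv (s1 ++ y :: x :: s2) :> K.
Proof.
rewrite -val_eqE neq_ltn; have := ninv_swap s1 s2 x y.
case: ltngtP => // _; rewrite addn0 addn1.
  by move=> <- _; rewrite exprS mulN1r opprK.
by move=> -> _; rewrite exprS mulN1r.
Qed.

Lemma wedge_coef_swap (s1 s2 : seq N) x y (S : {set N}) :
  wc (s1 ++ x :: y :: s2) S = - wc (s1 ++ y :: x :: s2) S.
Proof.
have pxy : perm_eq (s1 ++ x :: y :: s2) (s1 ++ y :: x :: s2).
  by rewrite perm_cat2l; apply/seq.permP => a /=; rewrite addnCA.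
rewrite /wedge_coef (perm_uniq pxy).
have -> : [set z in s1 ++ x :: y :: s2] = [set z in s1 ++ y :: x :: s2].
  by apply/setP => z; rewrite !inE (perm_mem pxy).
case: ifP => [/andP[U _]|_]; last by rewrite oppr0.
apply: sign_ninv_swap; move: U; rewrite cat_uniq => /and3P[_ _ /= /andP[]].
by rewrite inE negb_or eq_sym => /andP[].
Qed.

Lemma wedge_coef_rep (s1 s2 : seq N) x (S : {set N}) : wc (s1 ++ x :: x :: s2) S = 0.
Proof. by rewrite /wedge_coef cat_uniq /= inE eqxx /= !andbF. Qed.

Lemma sorted_enum_set (S : {set N}) : sorted ltn [seq val x | x <- enum S].
Proof.
rewrite {1}/enum_mem; apply: (subseq_sorted ltn_trans (map_subseq _ (filter_subseq _ _))).
by rewrite -enumT val_enum_ord iota_ltn_sorted.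
Qed.

Lemma enum_set_sorted (t : seq N) :
  sorted ltn [seq val x | x <- t] -> enum [set x in t] = t.
Proof.
move=> st; apply: (@inj_map _ _ (val : N -> nat) val_inj).
have e1 := sorted_enum_set [set x in t].
apply: (irr_sorted_eq ltn_trans ltnn e1 st) => k.
apply/mapP/mapP => -[x xt ->]; exists x => //.
  by move: xt; rewrite mem_enum inE.
by rewrite mem_enum inE.
Qed.

(* Insertion sort, keeping track of the sign. *)
Lemma alternating_sort (G : seq N -> K) :
  (forall s1 x y s2, G (s1 ++ x :: y :: s2) = - G (s1 ++ y :: x :: s2)) ->
  (forall s1 x s2, G (s1 ++ x :: x :: s2) = 0) ->
  forall t, G t = if uniq t then (-1) ^+ ninv t * G (enum [set x in t]) else 0.
Proof.
move=> GN G0 t; elim: t G GN G0 => [|x t IHt] G GN G0 /=.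
  by rewrite mul1r (_ : [set x in [::]] = set0) ?enum_set0 //; apply/setP => z; rewrite !inE.
have := IHt (fun u => G (x :: u)) (fun s1 => GN (x :: s1)) (fun s1 => G0 (x :: s1)).
move=> /= ->; case: ifP => Ut; last by rewrite andbF.
pose e : seq N := enum [set z in t]; rewrite -/e andbT.
have move_x s1 s2 : G (x :: s1 ++ s2) = (-1) ^+ size s1 * G (s1 ++ x :: s2).
  elim/last_ind: s1 s2 => [|s1 y IHs] s2 /=; first by rewrite mul1r.
  by rewrite cat_rcons IHs GN size_rcons exprS cat_rcons; ring.
have pe : perm_eq e t.
  apply: uniq_perm => //; first exact: enum_uniq.
  by move=> z; rewrite mem_enum inE.
have [xt|xt] := boolP (x \in t).
  have [s1 [s2 ee]] : exists s1 s2, e = s1 ++ x :: s2.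
    by move: xt; rewrite -(perm_mem pe) => /splitPr[s1 s2]; exists s1, s2.
  by rewrite ee move_x G0 !mulr0.
set s1 := [seq y : N <- e | (y < x)%N]; set s2 := [seq y : N <- e | ~~ (y < x)%N].
have se : sorted ltn [seq val y | y <- e] by apply: sorted_enum_set.
have ee : e = s1 ++ s2.
  rewrite /s1 /s2; elim: (e) se => //= y r IHr sr.
  have {}IHr := IHr (path_sorted sr).
  have [lt_yx|le_xy] := ltnP y x; first by rewrite /= -IHr.
  have r0 : [seq z : N <- r | (z < x)%N] = [::].
    apply/eqP; rewrite -(negbK (_ == _)) -has_filter -all_predC.
    have := order_path_min ltn_trans sr; rewrite all_map; apply: sub_all => z /=.
    by lia.
  by rewrite r0 /= {1}IHr r0.
have cs1 : size s1 = count (fun y : N => (y < x)%N) t.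
  by rewrite size_filter (seq.permP pe).
rewrite {1}ee move_x cs1 mulrA -exprD addnC; congr (_ * G _).
have -> : [set z in x :: t] = [set z in s1 ++ x :: s2].
  by apply/setP => z; rewrite !inE mem_cat inE orbCA -mem_cat -ee (perm_mem pe).
rewrite enum_set_sorted //.
rewrite map_cat /= sorted_pairwise; last exact: ltn_trans.
rewrite pairwise_cat /=; move: se; rewrite sorted_pairwise; last exact: ltn_trans.
rewrite ee map_cat pairwise_cat => /and3P[a12 -> ->]; rewrite andbT /=.
apply/andP; split.
  apply/allrelP => k l /mapP[y ys ->]; rewrite inE => /orP[/eqP->|zs].
    by move: ys; rewrite mem_filter => /andP[].
  by apply: (allrelP a12) => //; apply: map_f.
apply/allP => _ /mapP[y ys ->]; move: ys; rewrite mem_filter => /andP[le_xy ye].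
rewrite /= ltn_neqAle leqNgt le_xy andbT; apply: contraNneq xt => exy.
by rewrite -(perm_mem pe) (val_inj exy).
Qed.

Lemma alternating_expand m (G : seq N -> K) :
  (forall s1 x y s2, G (s1 ++ x :: y :: s2) = - G (s1 ++ y :: x :: s2)) ->
  (forall s1 x s2, G (s1 ++ x :: x :: s2) = 0) ->
  forall t, size t = m ->
  G t = \sum_(S : extmon n m) wc t (val S) * G (enum (val S)).
Proof.
move=> GN G0 t st; rewrite (alternating_sort GN G0).
case: ifP => Ut; last by rewrite big1 // => S _; rewrite /wedge_coef Ut mul0r.
have ct : #|[set x in t]| == m by rewrite cardsE (card_uniqP Ut) st.
rewrite (bigD1 (Sub [set x in t] ct : extmon n m)) //= /wedge_coef Ut eqxx.
rewrite big1 ?addr0 // => S; rewrite -val_eqE /= eq_sym => /negbTE->.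
by rewrite mul0r.
Qed.

End Wedge.
Section ColumnWedge.
Variables (K : fieldType) (n : nat).
Local Notation N := 'I_n.
Local Notation wc := (@wedge_coef K n).
Implicit Types (f h : N -> K) (vs : seq (N -> K)) (S T : {set N}).

Fixpoint wt vs (t : seq N) : K :=
  match vs, t with f :: vs', y :: t' => f y * wt vs' t' | _, _ => 1 end.

Definition col_coef vs S : K :=
  sum_list (size vs) (fun t => wt vs t * wc t S).

Lemma wt_cat vs1 vs2 t1 t2 : size t1 = size vs1 ->
  wt (vs1 ++ vs2) (t1 ++ t2) = wt vs1 t1 * wt vs2 t2.
Proof.
elim: vs1 t1 => [|f vs1 IHv] [|y t1] //=; first by rewrite mul1r.
by case=> /IHv->; rewrite mulrA.
Qed.

Lemma wt_take_drop vs1 vs2 t : (size vs1 <= size t)%N ->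
  wt (vs1 ++ vs2) t = wt vs1 (take (size vs1) t) * wt vs2 (drop (size vs1) t).
Proof. by move=> le; rewrite -wt_cat ?cat_take_drop ?size_takel. Qed.

Lemma wt_map (X : Type) (v : X -> N -> K) (w : X -> N) (s : seq X) :
  wt [seq v x | x <- s] [seq w x | x <- s] = \prod_(x <- s) v x (w x).
Proof.
elim: s => [|x s IHs] /=; first by rewrite big_nil.
by rewrite big_cons IHs.
Qed.

Lemma col_coef_linear vs1 f h z vs2 S :
  col_coef (vs1 ++ (fun l => h l + z * f l) :: vs2) S =
  col_coef (vs1 ++ h :: vs2) S + z * col_coef (vs1 ++ f :: vs2) S.
Proof.
rewrite /col_coef !size_cat /= -sum_listZ -sum_listD; apply: eq_sum_list => t st.
rewrite !wt_take_drop ?st ?leq_addr //.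
case: (drop _ t) (size_drop (size vs1) t) => [|y t'] /=; rewrite st addKn //.
by move=> _; ring.
Qed.

Lemma wt_swap vs1 f h vs2 t : (size vs1 + 2 <= size t)%N ->
  wt (vs1 ++ f :: h :: vs2) (swap_at (size vs1) t) =
  wt (vs1 ++ h :: f :: vs2) t.
Proof.
move=> le_t; rewrite -[t](cat_take_drop (size vs1)).
have st1 : size (take (size vs1) t) = size vs1 by rewrite size_takel //; lia.
case: (drop _ t) (size_drop (size vs1) t) => [|x [|y t']] /=; try by move=> *; lia.
move=> _; rewrite -[X in swap_at X]st1 swap_at_cat !wt_cat //=; ring.
Qed.

Lemma wedge_coef_swap_at i (t : seq N) S : (i + 2 <= size t)%N ->
  wc (swap_at i t) S = - wc t S.
Proof.
move=> le_t; rewrite -[t](cat_take_drop i).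
have st1 : size (take i t) = i by rewrite size_takel //; lia.
case: (drop _ t) (size_drop i t) => [|x [|y t']] /=; try by move=> *; lia.
by move=> _; rewrite -[X in swap_at X]st1 swap_at_cat wedge_coef_swap.
Qed.

Lemma col_coef_swap vs1 f h vs2 S :
  col_coef (vs1 ++ f :: h :: vs2) S = - col_coef (vs1 ++ h :: f :: vs2) S.
Proof.
rewrite /col_coef !size_cat /= -[LHS]sum_list_swap -mulN1r -sum_listZ.
apply: eq_sum_list => t st; rewrite wt_swap ?wedge_coef_swap_at ?st; last 2 first.
- by rewrite leq_add2l.
- by rewrite leq_add2l.
by rewrite mulN1r mulrN.
Qed.

Lemma col_coef_rep vs1 f vs2 S : col_coef (vs1 ++ f :: f :: vs2) S = 0.
Proof.
rewrite /col_coef size_cat /=; apply: sum_list_alt0 => [s1 x y s2 ss|s1 x s2 ss].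
  by rewrite !wt_cat // wedge_coef_swap mulrN /=; congr (- (_ * _)); ring.
by rewrite wedge_coef_rep mulr0.
Qed.

Lemma col_coef_add_row vs1 f h z vs2 S :
  col_coef (vs1 ++ f :: (fun l => h l + z * f l) :: vs2) S =
  col_coef (vs1 ++ f :: h :: vs2) S.
Proof.
rewrite -cat_rcons col_coef_linear !cat_rcons.
by rewrite col_coef_rep mulr0 addr0.
Qed.

Definition mx_act (g : 'M[K]_n) f : N -> K := fun l => \sum_k g l k * f k.

Definition mx_col (g : 'M[K]_n) (k : N) : N -> K := fun l => g l k.

Lemma sum_list_mx_act g vs (H : seq N -> K) :
  sum_list (size vs) (fun u => wt [seq mx_act g f | f <- vs] u * H u) =
  sum_list (size vs) (fun t => wt vs t *
    sum_list (size vs) (fun u => wt [seq mx_col g k | k <- t] u * H u)).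
Proof.
elim: vs H => [|f vs IHv] H /=; first by rewrite !mul1r.
transitivity (\sum_y \sum_k g y k * f k *
  sum_list (size vs) (fun u => wt [seq mx_act g f | f <- vs] u * H (y :: u))).
  apply: eq_bigr => y _; rewrite -big_distrl /= -sum_listZ.
  by apply: eq_sum_list => u _; rewrite mulrA.
rewrite exchange_big /=; apply: eq_bigr => k _.
under eq_bigr => y _ do rewrite IHv -sum_listZ.
rewrite exchange_sum_list; apply: eq_sum_list => t _.
rewrite big_distrr /=; apply: eq_bigr => y _; rewrite -!sum_listZ.
by apply: eq_sum_list => u _; rewrite /mx_col; ring.
Qed.

Lemma enum_set_val S : enum S = [seq enum_val k | k <- enum 'I_#|S|].
Proof.
have [c0|c_gt0] := posnP #|S|.
  by rewrite [LHS]size0nil -?cardE // [RHS]size0nil // size_map size_enum_ord.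
pose x0 := enum_val (Ordinal c_gt0); pose k0 := Ordinal c_gt0.
apply: (@eq_from_nth _ x0); first by rewrite size_map size_enum_ord cardE.
move=> i; rewrite -cardE => lti; rewrite (nth_map k0) ?size_enum_ord //.
rewrite (enum_val_nth x0); congr nth.
by rewrite nth_enum_ord.
Qed.

Lemma ext_act_coefE g S T : ext_act_coef g S T = col_coef [seq mx_col g k | k <- enum S] T.
Proof.
rewrite /ext_act_coef /col_coef size_map -cardE -sum_list_tuple.
apply: eq_bigr => u _; congr (_ * _).
have -> : tval u = [seq tnth u k | k <- enum 'I_#|S|].
  by rewrite map_tnth_enum.
have -> : [seq mx_col g k | k <- enum S] =
    [seq mx_col g (enum_val k) | k <- enum 'I_#|S|].
  by rewrite {1}(enum_set_val S) -map_comp.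
by rewrite wt_map big_enum.
Qed.

Lemma col_coef_act m g vs T : size vs = m ->
  \sum_(S : extmon n m) col_coef vs (val S) * ext_act_coef g (val S) T =
  col_coef [seq mx_act g f | f <- vs] T.
Proof.
move=> svs; rewrite {2}/col_coef size_map sum_list_mx_act svs.
under eq_bigr => S _ do rewrite /col_coef mulrC -sum_listZ svs.
rewrite exchange_sum_list; apply: eq_sum_list => t st.
under eq_bigr => S _ do rewrite mulrC -mulrA ext_act_coefE.
rewrite -big_distrr /=; congr (_ * _).
have -> : sum_list m (fun u => wt [seq mx_col g k | k <- t] u * wc u T) =
    col_coef [seq mx_col g k | k <- t] T by rewrite /col_coef size_map st.
apply/esym.
apply: (@alternating_expand K n m (fun t => col_coef [seq mx_col g k | k <- t] T)) => //.
  by move=> s1 x y s2; rewrite !map_cat /= col_coef_swap.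
by move=> s1 x s2; rewrite !map_cat /= col_coef_rep.
Qed.

Lemma wedge_coef_delta (t u : seq N) : size t = 2 -> size u = 2 ->
  \sum_(S : extmon n 2) wc t (val S) * wc u (val S) =
  (t == u)%:R - (t == rev u)%:R.
Proof.
move=> st su; apply/esym.
pose G (t : seq N) : K := if size t == 2 then (t == u)%:R - (t == rev u)%:R else 0.
have -> : (t == u)%:R - (t == rev u)%:R = G t by rewrite /G st.
case: u su @G => [|x [|y []]] // _ G.
have rE : rev [:: x; y] = [:: y; x] by [].
rewrite (@alternating_expand K n 2 G) //; first last.
- move=> [|z1 [|z2 s1]] z [|z3 s2]; rewrite /G ?size_cat ?addnS //= rE.
  apply/eqP; rewrite subr_eq0; apply/eqP; congr (_%:R); congr nat_of_bool.
  by rewrite !eqseq_cons andbCA.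
- move=> [|z1 [|z2 s1]] z w [|z3 s2]; rewrite /G ?size_cat ?addnS ?oppr0 //= rE.
  rewrite opprB !eqseq_cons; congr (_%:R - _%:R); congr nat_of_bool.
    by rewrite andbCA.
  by rewrite andbCA.
apply: eq_bigr => S _; congr (_ * _); case: S => S /= /eqP cS.
rewrite /G -cardE cS eqxx rE.
have enE (z w : N) : (z < w)%N -> (enum S == [:: z; w]) = ([set i in [:: z; w]] == S).
  move=> lt_zw; apply/eqP/eqP => [<-|<-]; first by apply/setP => i; rewrite inE mem_enum.
  by rewrite enum_set_sorted //= lt_zw.
have enF (z w : N) : (z <= w)%N -> (enum S == [:: w; z]) = false.
  move=> le_zw; apply/eqP => e; have := sorted_enum_set S; rewrite e /= andbT; lia.
have exC : ([set i in [:: y; x]] == S) = ([set i in [:: x; y]] == S).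
  by congr (_ == _); apply/setP => i; rewrite !inE orbC.
rewrite /wedge_coef /= inE andbT !addn0; have [lt_xy|lt_yx|] := ltngtP x y.
- rewrite enE // enF ?(ltnW lt_xy) // (_ : x != y) ?subr0.
    by rewrite /= expr0; case: (_ == _).
  by rewrite -val_eqE neq_ltn lt_xy.
- rewrite (enF y x) ?(ltnW lt_yx) // enE // (_ : x != y) ?sub0r.
    set c1 := (X in 1 *- X); set c2 := (X in if true && X then _ else _).
    have -> : c1 = c2 := congr1 nat_of_bool exC.
    by rewrite /= expr1; case: c2; rewrite ?oppr0.
  by rewrite -val_eqE neq_ltn lt_yx orbT.
by move/val_inj => ->; rewrite eqxx subrr.
Qed.

Lemma col_coef_pair2 (x y : N) f h :
  \sum_(S : extmon n 2) wc [:: x; y] (val S) * col_coef [:: f; h] (val S) =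
  f x * h y - f y * h x.
Proof.
rewrite /col_coef /=.
under eq_bigr => S _ do rewrite big_distrr.
rewrite exchange_big /=.
under eq_bigr => i _.
  under eq_bigr => S _ do rewrite big_distrr.
  rewrite exchange_big /=.
  under eq_bigr => j _.
    under eq_bigr => S _ do rewrite mulrCA mulr1.
    rewrite -big_distrr /= wedge_coef_delta // mulrBr.
  over.
over.
rewrite /= (eq_bigr (fun i => \sum_j f i * h j * ((x == i) && (y == j))%:R -
   \sum_j f i * h j * ((x == j) && (y == i))%:R)); last first.
  move=> i _; rewrite -sumrB; apply: eq_bigr => j _.
  by rewrite !eqseq_cons !andbT.
rewrite sumrB; congr (_ - _).
  rewrite (bigD1 x) //= [X in _ + X]big1 ?addr0; last first.
    move=> i ix; apply: big1 => j _; rewrite eq_sym (negbTE ix) /= mulr0 //.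
  rewrite (bigD1 y) //= !eqxx mulr1 big1 ?addr0 // => j jy.
  by rewrite (eq_sym y) (negbTE jy) /= mulr0.
rewrite (bigD1 y) //= [X in _ + X]big1 ?addr0; last first.
  by move=> i iy; apply: big1 => j _; rewrite (eq_sym y) (negbTE iy) andbF mulr0.
rewrite (bigD1 x) //= !eqxx mulr1 big1 ?addr0 // => j jx.
by rewrite (eq_sym x) (negbTE jx) /= mulr0.
Qed.

Lemma col_coef_pair1 (x : N) f :
  \sum_(S : extmon n 1) wc [:: x] (val S) * col_coef [:: f] (val S) = f x.
Proof.
have c1 : #|[set x]| == 1%N by rewrite cards1.
have eS (y : N) (S : extmon n 1) : [set i in [:: y]] = val S -> val S = [set y].
  by move=> <-; apply/setP => i; rewrite !inE.
rewrite (bigD1 (Sub [set x] c1 : extmon n 1)) //= big1 ?addr0; last first.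
  move=> S neqS; rewrite {1}/wedge_coef /=; case: eqP; last by rewrite mul0r.
  move/eS => e; move: neqS; rewrite -val_eqE /= e eqxx //.
rewrite /col_coef /= (bigD1 x) //= big1 ?addr0; last first.
  move=> y yx; rewrite /wedge_coef /=; case: eqP; last by rewrite mulr0.
  move/setP/(_ y); rewrite !inE eqxx /= (negbTE yx) //.
rewrite /wedge_coef /= (_ : [set i in [:: x]] == [set x]).
  by rewrite !addn0 !mulr1 mul1r.
by apply/eqP/setP => i; rewrite !inE.
Qed.

End ColumnWedge.

(** * Pure tensors of divided powers *)

Section BaseExpansion.
Variable M : nat.
Implicit Types d : nat -> nat.

Lemma base_low_lt d k : (forall i, d i < M)%N ->
  (\sum_(0 <= i < k) d i * M ^ i < M ^ k)%N.
Proof.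
move=> dM; elim: k => [|k IHk]; first by rewrite big_nil expn0.
rewrite big_nat_recr //= expnS; apply: (@leq_trans ((d k).+1 * M ^ k)).
  by rewrite mulSn ltn_add2r.
by rewrite leq_mul2r dM orbT.
Qed.

Lemma base_high_dvd d k m : (M ^ k %| \sum_(k <= i < m) d i * M ^ i)%N.
Proof.
rewrite big_nat_cond; apply: dvdn_sum => i /andP[/andP[le_ki _] _].
by rewrite dvdn_mull // dvdn_exp2l.
Qed.

Lemma base_high_le d d' k m : (forall i, d i < M)%N -> (forall i, d' i < M)%N ->
  (k <= m)%N ->
  (\sum_(0 <= i < m) d i * M ^ i <= \sum_(0 <= i < m) d' i * M ^ i)%N ->
  (\sum_(k <= i < m) d i * M ^ i <= \sum_(k <= i < m) d' i * M ^ i)%N.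
Proof.
move=> dM dM' le_km; rewrite !(@big_cat_nat _ _ _ k 0 m) //=.
have /dvdnP[x ->] := base_high_dvd d k m.
have /dvdnP[y ->] := base_high_dvd d' k m.
have ld := base_low_lt k dM; have ld' := base_low_lt k dM' => le_xy.
have : (x * M ^ k < y.+1 * M ^ k)%N by rewrite mulSn; lia.
by rewrite ltn_mul2r ltnS => /andP[_ le]; rewrite leq_mul2r le orbT.
Qed.

Lemma base_inj d d' m : (forall i, d i < M)%N -> (forall i, d' i < M)%N ->
  (\sum_(0 <= i < m) d i * M ^ i = \sum_(0 <= i < m) d' i * M ^ i)%N ->
  forall i, (i < m)%N -> d i = d' i.
Proof.
move=> dM dM'; elim: m => [|m IHm] // e i.
have M0 : (0 < M)%N by case: (M) (dM 0%N).
have hi : d m = d' m.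
  move: e; rewrite !big_nat_recr //=.
  have := base_low_lt m dM; have := base_low_lt m dM'.
  move: (\sum_(0 <= i < m) d i * M ^ i)%N (\sum_(0 <= i < m) d' i * M ^ i)%N => u w lw lu e'.
  have lt1 : (d m * M ^ m < (d' m).+1 * M ^ m)%N by rewrite mulSn; lia.
  have lt2 : (d' m * M ^ m < (d m).+1 * M ^ m)%N by rewrite mulSn; lia.
  move: lt1 lt2; rewrite !ltn_mul2r !ltnS => /andP[_ le1] /andP[_ le2].
  by apply/eqP; rewrite eqn_leq le1.
move: e; rewrite !big_nat_recr //= hi => /addIn e.
rewrite ltnS leq_eqVlt => /orP[/eqP->//|]; exact: IHm.
Qed.

End BaseExpansion.

Section PolynomialIdentity.
Variable K : fieldType.
Hypothesis K_inf : forall s : seq K, exists x, x \notin s.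

Lemma poly_eq0_cofinite (p : {poly K}) (s : seq K) :
  (forall x, x \notin s -> p.[x] = 0) -> p = 0.
Proof.
move=> p0; apply/eqP; apply/negPn/negP => nz_p.
have [t [Ut st rt]] : exists t : seq K, [/\ uniq t, size t = size p & all (root p) t].
  elim: (size p) => [|m [t [Ut st rt]]]; first by exists [::].
  have [x] := K_inf (s ++ t); rewrite mem_cat negb_or => /andP[xs xt].
  exists (x :: t); split; rewrite /= ?xt ?st // rt andbT.
  by apply/rootP/p0.
by have := max_poly_roots nz_p rt Ut; rewrite st ltnn.
Qed.

Lemma monomial_indep (S P : finType) (e : S -> P -> nat) (f : S -> K) :
  (forall s s', e s =1 e s' -> s = s') ->
  (forall v : P -> K, (forall x, v x != 0) ->
     \sum_s f s * \prod_x v x ^+ e s x = 0) ->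
  forall s, f s = 0.
Proof.
move=> e_inj f0.
pose M := (\max_s \max_x e s x).+1.
have eM s x : (e s x < M)%N.
  rewrite ltnS; apply: (leq_trans (leq_bigmax (F := e s) x)).
  exact: (leq_bigmax (F := fun s => \max_x e s x) s).
pose d s i := if insub i is Some j then e s (enum_val (j : 'I_#|P|)) else 0%N.
have dM s i : (d s i < M)%N by rewrite /d; case: insubP.
pose code s := (\sum_(0 <= i < #|P|) d s i * M ^ i)%N.
have codeE s : code s = (\sum_x e s x * M ^ enum_rank x)%N.
  rewrite /code big_mkord (reindex (@enum_rank P)) /=; last first.
    by exists enum_val => x _; rewrite ?enum_rankK ?enum_valK.
  by apply: eq_bigr => x _; rewrite /d valK enum_rankK.
have code_inj : injective code.
  move=> s s' /(base_inj (dM s) (dM s')) ed; apply: e_inj => x.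
  by have := ed (enum_rank x) (ltn_ord _); rewrite /d !valK enum_rankK.
pose p : {poly K} := \sum_s f s *: 'X^(code s).
have p0 : p = 0.
  apply: (@poly_eq0_cofinite _ [:: 0]) => x; rewrite inE => nz_x.
  rewrite -[RHS](f0 (fun y => x ^+ (M ^ enum_rank y))) => [|y]; last first.
    by rewrite expf_neq0.
  rewrite horner_sum; apply: eq_bigr => s _; rewrite hornerZ hornerXn codeE.
  rewrite -prodrXr; congr (_ * _); apply: eq_bigr => y _.
  by rewrite -exprM mulnC.
move=> s; have := congr1 (fun q : {poly K} => q`_(code s)) p0.
rewrite coef0 coef_sum (bigD1 s) //= coefZ coefXn eqxx mulr1 big1 ?addr0 // => s' ns.
rewrite coefZ coefXn; case: eqP => [/code_inj e0|]; last by rewrite mulr0.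
by rewrite e0 eqxx in ns.
Qed.

End PolynomialIdentity.

Lemma sum_dffun_prod (R : comNzRingType) (I : finType) (T_ : I -> finType)
    (P : forall i, T_ i -> R) :
  \sum_(x : {dffun forall i : I, T_ i}) \prod_i P i (x i) =
  \prod_i \sum_(t : T_ i) P i t.
Proof.
rewrite (reindex (@dffun_of_fprod I T_)); last exact/onW_bij/dffun_of_fprod_bij.
transitivity (\sum_(t : fprod T_) \prod_(i in I) finfun (P i) (t i)).
  by apply: eq_bigr => t _; apply: eq_bigr => i _; rewrite !ffunE.
rewrite big_fprod -(@bigA_distr_big_dep _ _ _ _ _ _ _ (tagged_with T_)
  (fun i j => untag 0 (finfun (P i)) j)).
apply: eq_bigr => i _; transitivity (\sum_(t : T_ i) finfun (P i) t).
  by rewrite [RHS](big_tag (fun i t => finfun (P i) t)).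
by apply: eq_bigr => t _; rewrite ffunE.
Qed.
Lemma scale_regular (K : fieldType) (x : K) (y : K^o) : x *: y = x * y :> K.
Proof. by []. Qed.

Section DividedPowerBasis.
Variables (K : fieldType) (n : nat) (I : finType) (al : I -> nat).
Hypothesis K_inf : forall s : seq K, exists x, x \notin s.

Lemma expo_inj (A B : dpbasis n al) : expo A =2 expo B -> A = B.
Proof.
move=> eAB; apply/ffunP => i; apply/val_inj/ffunP => k; apply: val_inj.
exact: eAB.
Qed.

Lemma sum_expo (A : dpbasis n al) i : (\sum_k expo A i k)%N = al i.
Proof. exact/eqP/(valP (A i)). Qed.

Lemma dpbasis_of (e : I -> 'I_n -> nat) : (forall i, \sum_k e i k = al i)%N ->
  exists A : dpbasis n al, expo A =2 e.
Proof.
move=> se; have lt i k : (e i k < (al i).+1)%N.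
  by rewrite ltnS -se (bigD1 k) //= leq_addr.
have He i : (\sum_k ([ffun k => Ordinal (lt i k)] k : nat) == al i)%N.
  by rewrite -[X in _ == X]se; apply/eqP/eq_bigr => k _; rewrite ffunE.
exists [ffun i => (Sub [ffun k => Ordinal (lt i k)] (He i) : dpmon n (al i))].
by move=> i k; rewrite /expo ffunE /= ffunE.
Qed.

Definition pure (v : I -> 'I_n -> K) : dpow K n al :=
  [ffun A => \prod_i \prod_k v i k ^+ expo A i k].

Lemma pureE v A : pure v A = \prod_i \prod_k v i k ^+ expo A i k.
Proof. by rewrite ffunE. Qed.

Lemma eq_pure v1 v2 : v1 =2 v2 -> pure v1 = pure v2.
Proof.
move=> e; apply/ffunP => A; rewrite !ffunE.
by do 2![apply: eq_bigr => ? _]; rewrite e.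
Qed.

Definition dvec (A : dpbasis n al) : dpow K n al := [ffun B => (B == A)%:R].

Lemma dvec_sum (x : dpow K n al) : x = \sum_A x A *: dvec A.
Proof.
apply/ffunP => B; rewrite sum_ffunE (bigD1 B) //= !ffunE eqxx scale_regular mulr1.
by rewrite big1 ?addr0 // => A nA; rewrite !ffunE eq_sym (negbTE nA) scaler0.
Qed.

Lemma pure_monomials_indep (f : dpbasis n al -> K) :
  (forall v : I -> 'I_n -> K, (forall i k, v i k != 0) ->
    \sum_A f A * pure v A = 0) -> forall A, f A = 0.
Proof.
move=> f0; apply: (monomial_indep K_inf (P := (I * 'I_n)%type)
   (e := fun A x => expo A x.1 x.2)) => [A B eAB|v nz_v].
  by apply: expo_inj => i k; apply: (eAB (i, k)).
rewrite -[RHS](f0 (fun i k => v (i, k))) => [|i k]; last exact: nz_v.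
apply: eq_bigr => A _; rewrite ffunE; congr (_ * _).
by rewrite pair_big; apply: eq_bigr => -[].
Qed.

Lemma dpow_hom_eq0 (U : vectType K) (L : 'Hom(dpow K n al, U))
    (D : (I -> 'I_n -> K) -> Prop) :
  (forall f : dpbasis n al -> K, (forall v, D v -> \sum_A f A * pure v A = 0) ->
     forall A, f A = 0) ->
  (forall v, D v -> L (pure v) = 0) -> L = 0.
Proof.
move=> indep L0.
have LA A : L (dvec A) = 0.
  rewrite (coord_vbasis (memvf (L (dvec A)))); apply: big1 => i _.
  rewrite (indep (fun A => coord (vbasis fullv) i (L (dvec A)))) ?scale0r // => v Dv.
  transitivity (coord (vbasis fullv) i (L (pure v))); last by rewrite L0 // linear0.
  rewrite [in RHS](dvec_sum (pure v)) !linear_sum; apply: eq_bigr => B _.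
  by rewrite !linearZ /= mulrC.
apply/lfunP => x; rewrite (dvec_sum x) linear_sum /= zero_lfunE big1 // => A _.
by rewrite linearZ /= LA scaler0.
Qed.

Lemma pure_hom_eq (U : vectType K) (L1 L2 : 'Hom(dpow K n al, U)) :
  (forall v, L1 (pure v) = L2 (pure v)) -> L1 = L2.
Proof.
move=> e; apply/eqP; rewrite -subr_eq0; apply/eqP.
apply: (@dpow_hom_eq0 _ _ (fun=> True)) => [f f0|v _].
  by apply: pure_monomials_indep => v _; apply: f0.
by rewrite add_lfunE opp_lfunE e subrr.
Qed.

Lemma pure_span (x : dpow K n al) :
  exists s : seq (K * (I -> 'I_n -> K)), x = \sum_(t <- s) t.1 *: pure t.2.
Proof.
pose P (x : dpow K n al) := exists s : seq (K * (I -> 'I_n -> K)),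
  x = \sum_(t <- s) t.1 *: pure t.2.
have [U UP] : exists U : {vspace dpow K n al}, forall x, x \in U <-> P x.
  apply: submodP => [|c u v [s ->] [t ->]]; first by exists [::]; rewrite big_nil.
  exists ([seq (c * y.1, y.2) | y <- s] ++ t); rewrite big_cat big_map scaler_sumr.
  by congr (_ + _); apply: eq_bigr => y _; rewrite scalerA.
apply/UP.
have e : \1%VF = projv U.
  apply: pure_hom_eq => v; rewrite id_lfunE projv_id //; apply/UP.
  by exists [:: (1, v)]; rewrite big_seq1 scale1r.
by rewrite -[x]id_lfunE e memv_proj.
Qed.

End DividedPowerBasis.

Lemma unit_monomials_indep (K : fieldType) (n : nat) (al : 'I_n -> nat)
    (K_inf : forall s : seq K, exists x, x \notin s) (f : dpbasis n al -> K) :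
  (forall g : 'M[K]_n, g \in unitmx -> \sum_A f A * pure al (fun i k => g k i) A = 0) ->
  forall A, f A = 0.
Proof.
move=> f0; apply: (pure_monomials_indep K_inf) => v _.
pose m : 'M[K]_n := \matrix_(k, i) v i k.
pose p : {poly K} := \sum_A f A *:
  \prod_i \prod_k ((v i k)%:P + (k == i)%:R%:P * 'X) ^+ expo A i k.
have pE t : p.[t] = \sum_A f A * pure al (fun i k => v i k + (k == i)%:R * t) A.
  rewrite horner_sum; apply: eq_bigr => A _; rewrite hornerZ ffunE horner_prod.
  congr (_ * _); apply: eq_bigr => i _; rewrite horner_prod; apply: eq_bigr => k _.
  by rewrite horner_exp !hornerE.
have pc0 : p * char_poly (- m) = 0.
  apply: (poly_eq0_cofinite K_inf (s := [::])) => t _; rewrite hornerM.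
  have [|nr] := boolP (root (char_poly (- m)) t).
    by move/eqP->; rewrite mulr0.
  have gu : m + t%:M \in unitmx.
    move: nr; rewrite -eigenvalue_root_char /eigenvalue /eigenspace negbK.
    rewrite kermx_eq0 row_free_unit (_ : - m - t%:M = (-1) *: (m + t%:M)).
      by rewrite unitmxZ // unitrN1.
    by rewrite scaleN1r opprD.
  rewrite (_ : p.[t] = 0) ?mul0r // -(f0 _ gu) pE.
  apply: eq_bigr => A _; congr (_ * _); rewrite !pureE.
  apply: eq_bigr => i _; apply: eq_bigr => k _; congr (_ ^+ _).
  by rewrite !mxE mulr_natl.
have p0 : p = 0.
  apply/eqP; move/eqP: pc0; rewrite mulf_eq0 => /orP[//|/eqP c0].
  by have := char_poly_monic (- m); rewrite c0 monicE lead_coef0 eq_sym oner_eq0.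
rewrite -[RHS](horner0 0) -p0 pE; apply: eq_bigr => A _; congr (_ * _).
rewrite !pureE; apply: eq_bigr => i _; apply: eq_bigr => k _; congr (_ ^+ _).
by rewrite mulr0 addr0.
Qed.
Section WeylPure.
Variables (K : fieldType) (n q : nat) (al : 'I_q -> nat).
Local Notation N := 'I_n.

Lemma mem_col_boxes (j : 'I_(ncols al)) (x : box al) :
  (x \in col_boxes j) = ((val x).2 == j).
Proof.
rewrite /col_boxes mem_pmap; apply/mapP/eqP => [[i _ /esym e]|e].
  by move: e; case: insubP => // y _ vy [<-]; rewrite vy.
exists (val x).1; rewrite ?mem_enum // -e -surjective_pairing.
by rewrite valK.
Qed.

Lemma uniq_col_boxes (j : 'I_(ncols al)) : uniq (col_boxes (al := al) j).
Proof.
rewrite /col_boxes; apply: (@pmap_uniq _ _ _ (fun x : box al => (val x).1)).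
  by move=> i; case: insubP => //= x _ ->.
exact: enum_uniq.
Qed.

Lemma size_col_boxes (j : 'I_(ncols al)) : size (col_boxes (al := al) j) = conjp al j.
Proof.
rewrite /col_boxes size_pmap /conjp -sum1dep_card -sum1_count big_enum_cond /=.
by apply: eq_bigl => i; rewrite /= isSome_insub.
Qed.

Lemma flatten_col_boxes :
  perm_eq (flatten [seq col_boxes (al := al) j | j <- enum 'I_(ncols al)]) (enum (box al)).
Proof.
apply/allP => x _; apply/eqP; rewrite [RHS]count_uniq_mem ?enum_uniq // mem_enum.
rewrite count_flatten -map_comp sumnE big_map big_enum /= (bigD1 (val x).2) //=.
rewrite count_uniq_mem ?uniq_col_boxes // mem_col_boxes eqxx.
rewrite big1 // => j nj; rewrite count_uniq_mem ?uniq_col_boxes //.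
by rewrite mem_col_boxes eq_sym (negbTE nj).
Qed.

Lemma prod_boxes (F : box al -> K) :
  \prod_x F x = \prod_j \prod_(x <- col_boxes (al := al) j) F x.
Proof.
rewrite -[LHS]big_enum -(perm_big _ flatten_col_boxes) /= big_flatten big_map.
by rewrite big_enum.
Qed.

Definition pure_tens (v : box al -> N -> K) : tens K n al :=
  [ffun w : {ffun box al -> N} => \prod_x v x (w x)].

Definition wedges (v : box al -> N -> K) : ext K n al :=
  [ffun S : extbasis n al =>
    \prod_j col_coef [seq v x | x <- col_boxes (al := al) j] (val (S j))].

Lemma col_wedge_pure v : col_wedge K n al (pure_tens v) = wedges v.
Proof.
apply/ffunP => S; rewrite lin_extE ffunE.
transitivity (\sum_(w : {ffun box al -> N}) \prod_j
  (wt [seq v x | x <- col_boxes (al := al) j] [seq w x | x <- col_boxes (al := al) j] *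
   wedge_coef K [seq w x | x <- col_boxes (al := al) j] (val (S j)))).
  apply: eq_bigr => w _; rewrite big_split ffunE prod_boxes /=; congr (_ * _).
  by apply: eq_bigr => j _; rewrite wt_map.
rewrite (sum_ffun_pieces (fun j t => wt [seq v x | x <- col_boxes (al := al) j] t *
   wedge_coef K t (val (S j))) flatten_col_boxes).
by apply: eq_bigr => j _; rewrite /col_coef size_map.
Qed.

Lemma card_row (i : 'I_q) : #|[set x : box al | (val x).1 == i]| = al i.
Proof.
have le_al : (al i <= ncols al)%N := leq_bigmax i.
have lt (k : 'I_(al i)) : (k < ncols al)%N := leq_trans (ltn_ord k) le_al.
have lt2 (k : 'I_(al i)) : ((i, Ordinal (lt k)).2 < al (i, Ordinal (lt k)).1)%N := ltn_ord k.
pose f (k : 'I_(al i)) : box al := Sub (i, Ordinal (lt k)) (lt2 k).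
have f_inj : injective f.
  by move=> k k' /(congr1 val) /= [] /= e; apply: val_inj.
rewrite -[RHS]card_ord -(card_codom f_inj); apply: eq_card => x.
rewrite inE; apply/eqP/codomP => [e|[k ->]] //.
have xlt : ((val x).2 < al i)%N by rewrite -e (valP x).
exists (Ordinal xlt); apply: val_inj; rewrite [LHS]surjective_pairing e.
by congr (_, _); apply: val_inj.
Qed.

Definition row_count (w : box al -> N) (i : 'I_q) (k : N) :=
  #|[set x : box al | ((val x).1 == i) && (w x == k)]|.

Lemma sum_row_count w i : (\sum_k row_count w i k = al i)%N.
Proof.
rewrite -(card_row i) -sum1dep_card (partition_big w predT) //=.
by apply: eq_bigr => k _; rewrite /row_count -sum1dep_card.
Qed.

Lemma prod_row_count w (F : 'I_q -> N -> K) :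
  \prod_(x : box al) F (val x).1 (w x) = \prod_i \prod_k F i k ^+ row_count w i k.
Proof.
rewrite (partition_big (fun x : box al => (val x).1) predT) //=.
apply: eq_bigr => i _; rewrite (partition_big w predT) //=.
apply: eq_bigr => k _; rewrite /row_count -prodr_const.
apply: eq_big => x; first by rewrite inE.
by move=> /andP[/eqP-> /eqP->].
Qed.

Lemma row_comul_pure (v : 'I_q -> N -> K) :
  row_comul K n al (pure al v) = pure_tens (fun x => v (val x).1).
Proof.
apply/ffunP => w; rewrite lin_extE ffunE.
have [A eA] := dpbasis_of (sum_row_count w).
rewrite (bigD1 A) //= big1 ?addr0 => [|B nB].
  rewrite (_ : [forall i, _]) ?mulr1; last first.
    by apply/forallP => i; apply/forallP => k; rewrite eA.
  rewrite pureE prod_row_count; apply: eq_bigr => i _; apply: eq_bigr => k _.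
  by rewrite eA.
case: (boolP [forall i, _]) => [/forallP e|]; last by rewrite mulr0.
case/eqP: nB; apply: expo_inj => i k; rewrite eA.
by have /forallP/(_ k)/eqP <- := e i.
Qed.

Lemma dprime_pure v : dprime K n al (pure al v) = wedges (fun x => v (val x).1).
Proof. by rewrite comp_lfunE row_comul_pure col_wedge_pure. Qed.

Lemma ext_act_wedges g v :
  ext_act al g (wedges v) = wedges (fun x => mx_act g (v x)).
Proof.
apply/ffunP => T; rewrite lin_extE ffunE.
transitivity (\sum_(S : extbasis n al) \prod_j
  (col_coef [seq v x | x <- col_boxes (al := al) j] (val (S j)) *
   ext_act_coef g (val (S j)) (val (T j)))).
  by apply: eq_bigr => S _; rewrite ffunE big_split.
rewrite (sum_dffun_prod (fun (j : 'I_(ncols al)) (S : extmon n (conjp al j)) =>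
  col_coef [seq v x | x <- col_boxes (al := al) j] (val S) *
  ext_act_coef g (val S) (val (T j)))).
apply: eq_bigr => j _; rewrite col_coef_act ?size_map ?size_col_boxes //.
by rewrite -map_comp.
Qed.

Lemma eq_wedges v1 v2 : v1 =2 v2 -> wedges v1 = wedges v2.
Proof.
move=> e; apply/ffunP => S; rewrite !ffunE; apply: eq_bigr => j _.
by congr col_coef; apply: eq_map => x; apply/funext.
Qed.

End WeylPure.

(** * Tableau maps on pure tensors *)

Section MultinomialCount.
Variables (J Y : finType).
Implicit Types (D : J * Y -> nat) (gs : seq Y).

Lemma multinomial_count_seq gs D :
  (forall y, \sum_j D (j, y) = count_mem y gs)%N ->
  sum_list (size gs) (fun ls : seq J =>
    [forall z, count_mem z (zip ls gs) == D z]%:R) * (\prod_z (D z)`!)%:R =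
  (\prod_y (count_mem y gs)`!)%:R :> int.
Proof.
elim: gs D => [|y0 gs IHgs] D sD /=.
  have D0 z : D z = 0%N.
    by case: z => j y; have /eqP := sD y; rewrite sum_nat_eq0 => /forallP/(_ j)/eqP.
  rewrite big1 => [|z _]; last by rewrite D0.
  rewrite big1 // mulr1 (_ : [forall z, _]) //.
  by apply/forallP => z; rewrite D0.
rewrite big_distrl /=.
transitivity (\sum_j (D (j, y0))%:R * (\prod_y (count_mem y gs)`!)%:R : int).
  apply: eq_bigr => j0 _.
  have [D0|D_gt0] := posnP (D (j0, y0)).
    rewrite D0 mul0r sum_list0 ?mul0r // => ls _.
    rewrite (_ : [forall z, _] = false) //; apply/negbTE/forallPn.
    by exists (j0, y0); rewrite /= eqxx D0.
  pose D' z := if z == (j0, y0) then (D z).-1 else D z.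
  have sD' y : (\sum_j D' (j, y) = count_mem y gs)%N.
    have := sD y; rewrite /= (bigD1 j0) //= [X in _ -> X = _](bigD1 j0) //=.
    have -> : (\sum_(i | i != j0) D' (i, y) = \sum_(i | i != j0) D (i, y))%N.
      by apply: eq_bigr => i ni; rewrite /D' xpair_eqE (negbTE ni).
    rewrite /D' xpair_eqE eqxx /= (eq_sym y0); case: eqP => [->|_] /=; last by rewrite add0n.
    by move: D_gt0; lia.
  rewrite -(IHgs _ sD').
  have -> : (\prod_z (D z)`!)%N = (D (j0, y0) * \prod_z (D' z)`!)%N.
    rewrite (bigD1 (j0, y0)) //= [in RHS](bigD1 (j0, y0)) //= mulnA.
    congr (_ * _)%N; first by rewrite /D' eqxx -[in LHS](prednK D_gt0) factS prednK.
    by apply: eq_bigr => z nz; rewrite /D' (negbTE nz).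
  rewrite natrM mulrCA; congr (_ * (_ * _)); apply: eq_sum_list => ls _.
  congr (_%:R); congr nat_of_bool; apply: eq_forallb => z /=.
  rewrite /D' (eq_sym (j0, y0)); have [->|_] := eqVneq z (j0, y0) => //=.
  by case: (D (j0, y0)) D_gt0.
rewrite -big_distrl /= -natr_sum sD /= eqxx -natrM; congr (_%:R).
rewrite (bigD1 y0) //= [in RHS](bigD1 y0) //= eqxx mulnA add1n -factS.
by congr (_ * _)%N; apply: eq_bigr => y ny; rewrite (eq_sym y0) (negbTE ny).
Qed.

Lemma multinomial_count (X : finType) (g : X -> Y) D :
  (forall y, \sum_j D (j, y) = #|[set x | g x == y]|)%N ->
  (#|[set w : {ffun X -> J} |
      [forall z, #|[set x | (w x, g x) == z]| == D z]]| * \prod_z (D z)`! =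
   \prod_y #|[set x | g x == y]|`!)%N.
Proof.
move=> sD; pose gs := [seq g x | x <- enum X].
have cg y : count_mem y gs = #|[set x | g x == y]|.
  by rewrite count_map -sum1dep_card -sum1_count big_enum_cond.
have sg : size gs = size (enum X) by rewrite size_map.
have /= := @multinomial_count_seq gs D; rewrite sg.
rewrite -(sum_list_ffun _ (perm_refl (enum X))) => H.
have {}H := H (fun y => etrans (sD y) (esym (cg y))).
apply/eqP; rewrite -(eqr_nat int) natrM -sum1dep_card natr_sum.
under [in X in _ == X]eq_bigr => y _ do rewrite -cg.
rewrite -H big_mkcond /=; apply/eqP; congr (_ * _); apply: eq_bigr => w _.
rewrite (_ : [forall z, _] = [forall z, count_mem z (zip [seq w x | x <- enum X] gs) == D z]).
  by case: [forall z, _].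
apply: eq_forallb => z; congr (_ == _).
rewrite /gs zip_map count_map -[RHS]sum1_count.
by rewrite [RHS]big_enum_cond -[LHS]sum1dep_card.
Qed.

End MultinomialCount.
Lemma prod_fact_dvd (J : finType) (P : pred J) (c : J -> nat) :
  (\prod_(j | P j) (c j)`! %| (\sum_(j | P j) c j)`!)%N.
Proof.
pose D (z : J * unit) := if P z.1 then c z.1 else 0%N.
pose m := (\sum_(j | P j) c j)%N.
have H : forall y : unit, (\sum_j D (j, y) = #|[set x : 'I_m | tt == y]|)%N.
  case; rewrite /D -big_mkcond /= -[LHS]/m -[LHS]card_ord -cardsT.
  by apply: eq_card => x; rewrite !inE.
have := multinomial_count H.
rewrite (big_pred1 tt) => [|[]] //; rewrite -(H tt) /D -big_mkcond /= => <-.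
rewrite dvdn_mull // -(pair_big predT predT (fun j (_ : unit) => (if P j then c j else 0)`!)).
rewrite big_mkcond /= (eq_bigr (fun j => \prod_(y : unit) (if P j then c j else 0)`!)) //.
by move=> j _; rewrite (big_pred1 tt) => [|[]] //; case: (P j).
Qed.

Section Comultiplication.
Variables (K : fieldType) (n : nat) (I J : finType) (p : J -> I).
Variables (al : I -> nat) (ga : J -> nat).

Lemma dcomul_pure (v : I -> 'I_n -> K) :
  (forall i, \sum_(j | p j == i) ga j = al i)%N ->
  dcomul K n p al ga (pure al v) = pure ga (fun j => v (p j)).
Proof.
move=> sga; apply/ffunP => C; rewrite lin_extE pureE.
have sC i : (\sum_k \sum_(j | p j == i) expo C j k = al i)%N.
  by rewrite exchange_big -sga; apply: eq_bigr => j _; rewrite sum_expo.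
have [A eA] := dpbasis_of sC.
rewrite (bigD1 A) //= big1 ?addr0 => [|B nB].
  rewrite (_ : merges p A C) ?mulr1; last first.
    by apply/forallP => i; apply/forallP => k; rewrite eA.
  rewrite pureE [RHS](partition_big p predT) //=; apply: eq_bigr => i _.
  rewrite exchange_big /=; apply: eq_bigr => k _; rewrite eA -prodrXr.
  by apply: eq_bigr => j /eqP->.
case: (boolP (merges p B C)) => [/forallP m|]; last by rewrite mulr0.
case/eqP: nB; apply: expo_inj => i k; rewrite eA.
by have /forallP/(_ k)/eqP <- := m i.
Qed.

End Comultiplication.

Section Multiplication.
Variables (K : fieldType) (n q : nat) (mu : 'I_q -> nat).
Variables (J : finType) (p : J -> 'I_q) (ga : J -> nat).
Local Notation N := 'I_n.

Definition fills (w : {ffun box mu -> J}) : bool :=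
  [forall x, p (w x) == (val x).1] && [forall j, #|[set x | w x == j]| == ga j].

Lemma row_comul_dmul (u : J -> N -> K) :
  row_comul K n mu (dmul K n p ga mu (pure ga u)) =
  \sum_(w | fills w) pure_tens (fun x => u (w x)).
Proof.
apply/ffunP => u0; rewrite lin_extE sum_ffunE.
have [A eA] := dpbasis_of (sum_row_count u0).
rewrite (bigD1 A) //= big1 ?addr0 => [|B nB]; last first.
  case: (boolP [forall i, _]) => [/forallP e|]; last by rewrite mulr0.
  case/eqP: nB; apply: expo_inj => i k; rewrite eA.
  by have /forallP/(_ k)/eqP <- := e i.
rewrite (_ : [forall i, _]) ?mulr1; last first.
  by apply/forallP => i; apply/forallP => k; rewrite eA.
rewrite lin_extE.
pose matches (C : dpbasis n ga) (w : {ffun box mu -> J}) :=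
  [forall j, forall k, #|[set x | (w x == j) && (u0 x == k)]| == expo C j k].
transitivity (\sum_(w | fills w) \sum_(C | matches C w) \prod_j \prod_k u j k ^+ expo C j k).
  rewrite (exchange_big_dep predT) //=; apply: eq_bigr => C _.
  rewrite sumr_const pureE -mulr_natr; congr (_ * _).
  pose D (z : J * ('I_q * N)) := if p z.1 == z.2.1 then expo C z.1 z.2.2 else 0%N.
  pose g (x : box mu) := ((val x).1, u0 x).
  have gA i k : #|[set x | g x == (i, k)]| = expo A i k.
    by rewrite eA /row_count; apply: eq_card => x; rewrite !inE xpair_eqE.
  have memE (w : {ffun box mu -> J}) : (fills w && matches C w) =
      [forall z, #|[set x | (w x, g x) == z]| == D z].
    apply/andP/forallP => [[/andP[/forallP pw _] /forallP m] [j [i k]]|Dw].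
      rewrite /D /=; case: ifP => [/eqP pj|npj]; last first.
        rewrite cards_eq0; apply/eqP/setP => x; rewrite !inE !xpair_eqE.
        apply/negP => /and3P[/eqP wj /eqP xi _].
        by rewrite -wj (eqP (pw x)) xi eqxx in npj.
      have /forallP/(_ k)/eqP <- := m j; apply/eqP/eq_card => x; rewrite !inE.
      rewrite !xpair_eqE; case: (w x =P j) => //= wj.
      by rewrite -(eqP (pw x)) wj pj eqxx.
    have pw x : p (w x) = (val x).1.
      have := Dw (w x, g x); rewrite /D /=; case: ifP => [/eqP//|_].
      by rewrite cards_eq0 => /eqP/setP/(_ x); rewrite !inE eqxx.
    have mC : matches C w.
      apply/forallP => j; apply/forallP => k; have := Dw (j, (p j, k)).
      rewrite /D /= eqxx => /eqP <-; apply/eqP/eq_card => x; rewrite !inE.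
      rewrite !xpair_eqE; case: (w x =P j) => //= <-.
      by rewrite pw eqxx.
    split => //; apply/andP; split; first by apply/forallP => x; rewrite pw.
    apply/forallP => j.
    rewrite -(sum_expo C j) -sum1dep_card (partition_big u0 predT) //=.
    apply/eqP/eq_bigr => k _; have /forallP/(_ j)/forallP/(_ k)/eqP <- := mC.
    by rewrite -sum1dep_card.
  have [mrg|nmrg] := boolP (merges p A C); last first.
    rewrite eq_card0 // => w; apply/negP => wP.
    have /andP[/andP[/forallP pw _] /forallP m] : fills w && matches C w by exact: wP.
    case/negP: nmrg; apply/forallP => i; apply/forallP => k.
    rewrite -gA -sum1dep_card (partition_big w (fun j => p j == i)) /=; last first.
      by move=> x; rewrite xpair_eqE (eqP (pw x)) => /andP[].
    apply/eqP/eq_bigr => j pj; have /forallP/(_ k)/eqP <- := m j.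
    rewrite -sum1dep_card; apply: eq_bigl => x; rewrite xpair_eqE.
    case: (w x =P j) => [wj|_]; last by rewrite andbF.
    by rewrite andbT -(eqP (pw x)) wj pj.
  have mE i k : (\sum_(j | p j == i) expo C j k)%N = expo A i k.
    by have /forallP/(_ i)/forallP/(_ k)/eqP := mrg.
  have sD (y : 'I_q * N) : (\sum_j D (j, y) = #|[set x | g x == y]|)%N.
    by case: y => i k; rewrite gA -mE [RHS]big_mkcond.
  have cnt := multinomial_count sD.
  transitivity ((\prod_i \prod_k
     ((expo A i k)`! %/ \prod_(j | p j == i) (expo C j k)`!))%:R : K).
    by rewrite natr_prod; apply: eq_bigr => i _; rewrite natr_prod.
  congr (_%:R); apply/eqP.
  have Pgt0 : (0 < \prod_z (D z)`!)%N by apply: prodn_gt0 => z; exact: fact_gt0.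
  rewrite -(eqn_pmul2r Pgt0).
  rewrite (_ : #|_| = #|[set w : {ffun box mu -> J} |
     [forall z, #|[set x | (w x, g x) == z]| == D z]]|); last first.
    by apply: eq_card => w; rewrite !inE -memE.
  rewrite cnt.
  have -> : (\prod_z (D z)`! = \prod_i \prod_k \prod_(j | p j == i) (expo C j k)`!)%N.
    rewrite pair_big /= [RHS](eq_bigr (fun y => \prod_j (D (j, y))`!)%N); last first.
      case=> i k _ /=; rewrite /D /= big_mkcond; apply: eq_bigr => j _.
      by case: ifP.
    rewrite exchange_big pair_big /=; apply: eq_bigr => -[] //.
  apply/eqP; rewrite -big_split [RHS](eq_bigr (fun y => (expo A y.1 y.2)`!)%N); last first.
    by case=> i k _; rewrite gA.
  rewrite -(pair_big predT predT (fun i k => (expo A i k)`!)) /=.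
  apply: eq_bigr => i _; rewrite -big_split; apply: eq_bigr => k _ /=.
  by rewrite divnK // -mE prod_fact_dvd.
apply: eq_bigr => w /andP[/forallP pw /forallP gw]; rewrite ffunE.
have sC j : (\sum_k #|[set x | (w x == j) && (u0 x == k)]| = ga j)%N.
  rewrite -(eqP (gw j)) -sum1dep_card (partition_big u0 predT) //=.
  by apply: eq_bigr => k _; rewrite sum1dep_card.
have [C eC] := dpbasis_of sC.
rewrite (big_pred1 C) => [|C']; last first.
  apply/idP/eqP => [/forallP m|->].
    by apply: expo_inj => j k; have /forallP/(_ k)/eqP <- := m j; rewrite eC.
  by apply/forallP => j; apply/forallP => k; rewrite eC.
rewrite [RHS](partition_big w predT) //=; apply: eq_bigr => j _.
rewrite [RHS](partition_big u0 predT) //=; apply: eq_bigr => k _.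
rewrite eC -prodr_const; apply: eq_big => x; rewrite inE //.
by move=> /andP[/eqP-> /eqP->].
Qed.

End Multiplication.

Lemma phi_pure (K : fieldType) (n q : nat) (la : 'I_n -> nat) (mu : 'I_q -> nat)
    (T : tableau) (v : 'I_n -> 'I_n -> K) :
  (forall l, \sum_i @tcount n q T (l, i) = la l)%N ->
  vsval (phi K la mu T (pure la v)) =
  \sum_(w : {ffun box mu -> 'I_n * 'I_q} | fills snd (@tcount n q T) w)
     wedges (fun x => v (w x).1).
Proof.
move=> wT; rewrite /phi /Weyl_proj !comp_lfunE dcomul_pure; last first.
  move=> l; rewrite -wT.
  transitivity (\sum_(i | i == l) \sum_(k < q) @tcount n q T (i, k))%N.
    by rewrite pair_big_dep /=; apply: eq_big => -[i k] /=; rewrite ?andbT.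
  by rewrite (big_pred1 l).
rewrite lfunE /= vsprojK; last first.
  by rewrite -comp_lfunE -/(dprime K n mu) memv_img ?memvf.
rewrite row_comul_dmul linear_sum.
by apply: eq_bigr => w _; rewrite /= col_wedge_pure.
Qed.

(** * The universal property of Weyl modules *)

Lemma sum_digits (P : finType) (idx : P -> nat) (e : P -> nat) M m k :
  (forall x, idx x < m)%N ->
  (\sum_(x | k <= idx x) e x * M ^ idx x =
   \sum_(k <= i < m) (\sum_(x | idx x == i) e x) * M ^ i)%N.
Proof.
move=> lt_idx; pose o x := Ordinal (lt_idx x).
rewrite big_geq_mkord (partition_big o (fun i : 'I_m => k <= i)%N) //=.
apply: eq_bigr => i le_ki; rewrite big_distrl /=.
apply: eq_big => [x|x /andP[_ /eqP <-]] //.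
by rewrite -val_eqE /=; case: eqP => [->|]; rewrite ?andbT ?andbF.
Qed.

Lemma sum_leq_termwise (P : finType) (f g : P -> nat) :
  (forall x, f x <= g x)%N -> (\sum_x g x <= \sum_x f x)%N ->
  forall x, (g x <= f x)%N.
Proof.
move=> le_fg le x; move: le; rewrite (bigD1 x) //= [X in (_ <= X)%N](bigD1 x) //=.
have : (\sum_(y | y != x) f y <= \sum_(y | y != x) g y)%N by apply: leq_sum.
by move: (\sum_(y | y != x) f y)%N (\sum_(y | y != x) g y)%N => u w; lia.
Qed.

Lemma size_prod_deg (R : idomainType) (P : finType) (F : P -> {poly R}) (D : P -> nat) :
  (forall x, size (F x) <= (D x).+1)%N ->
  (size (\prod_x F x)%R <= (\sum_x D x).+1)%N.
Proof.
move=> sF; elim/big_ind2: _ => [|d p d' q sp sq|x _]; rewrite ?size_poly1 //.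
apply: leq_trans (size_polyMleq _ _) _; rewrite -ltnS.
by move: (size p) (size q) sp sq => x y; lia.
Qed.

Section Straightening.
Variables (K : fieldType) (n : nat) (al : 'I_n -> nat).
Hypothesis K_inf : forall s : seq K, exists x, x \notin s.
Local Notation N := 'I_n.
Local Notation dpb := (dpbasis n al).

Definition ev (c : dpb -> K) (v : N -> N -> K) : K := \sum_A c A * pure al v A.

Definition row_op (z : K) (P : pred N) (j j' : N) (v : N -> N -> K) : N -> N -> K :=
  fun i k => if (i == j') && P k then v i k + z * v j k else v i k.

Definition unip_invariant (c : dpb -> K) := forall (j j' : N) z v,
  j' = j.+1 :> nat -> ev c (row_op z predT j j' v) = ev c v.

Definition bdd := (\max_i al i).+2.

Definition pos (x : N * N) : nat := (x.2 * n + (n - x.1.+1))%N.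

Lemma pos_lt x : (pos x < n * n)%N.
Proof. by rewrite /pos; case: x => i k /=; have := ltn_ord i; have := ltn_ord k; nia. Qed.

Lemma pos_inj : injective pos.
Proof.
move=> [i k] [i' k'] /= e.
have lt (i0 : N) : (n - i0.+1 < n)%N by have := ltn_ord i0; lia.
have ek : k = k'.
  have := congr1 (divn^~ n) e; rewrite /pos /= !divnMDl ?(leq_ltn_trans _ (ltn_ord i)) //.
  by rewrite !divn_small // !addn0 => /val_inj.
congr (_, _) => //; apply: val_inj; move: e; rewrite /pos /= ek => /addnI.
by have := ltn_ord i; have := ltn_ord i'; lia.
Qed.

(* Monomials are compared by their exponent matrices, read from the last column
   to the first and, in each column, from the first row to the last. *)
Definition key (A : dpb) : nat := (\sum_(x : N * N) expo A x.1 x.2 * bdd ^ pos x)%N.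

Definition key_above t (A : dpb) : nat :=
  (\sum_(x : N * N | t <= pos x) expo A x.1 x.2 * bdd ^ pos x)%N.

Lemma expo_lt_bdd (A : dpb) i k : (expo A i k < bdd)%N.
Proof.
rewrite /bdd -addn1 ltnW // addn1 ltnS ltnS; apply: leq_trans (leq_bigmax i).
by rewrite -(sum_expo A i) (bigD1 k) //= leq_addr.
Qed.

Definition digit (A : dpb) i : nat := (\sum_(x : N * N | pos x == i) expo A x.1 x.2)%N.

Lemma digitE (A : dpb) x : digit A (pos x) = expo A x.1 x.2.
Proof. by rewrite /digit (big_pred1 x) // => y; rewrite (inj_eq pos_inj). Qed.

Lemma digit_lt A i : (digit A i < bdd)%N.
Proof.
have [x /eqP <-|no] := pickP (fun x => pos x == i); first by rewrite digitE expo_lt_bdd.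
by rewrite /digit big_pred0.
Qed.

Lemma key_aboveE t A : key_above t A = (\sum_(t <= i < n * n) digit A i * bdd ^ i)%N.
Proof. exact: (sum_digits (fun x : N * N => expo A x.1 x.2) bdd t pos_lt). Qed.

Lemma keyE A : key A = key_above 0 A.
Proof. by apply: eq_bigl => x; rewrite leq0n. Qed.

Lemma key_above_le t t' A B : (t <= t')%N -> (t' <= n * n)%N ->
  (key_above t A <= key_above t B)%N -> (key_above t' A <= key_above t' B)%N.
Proof.
move=> le_t le_t'; rewrite !key_aboveE => le.
pose trunc C i := if (t <= i)%N then digit C i else 0%N.
have truncE C s : (t <= s)%N ->
    (\sum_(s <= i < n * n) digit C i * bdd ^ i = \sum_(s <= i < n * n) trunc C i * bdd ^ i)%N.
  move=> le_s; apply: eq_big_nat => i /andP[le_i _].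
  by rewrite /trunc (leq_trans le_s le_i).
have trunc0 C : (\sum_(0 <= i < n * n) trunc C i * bdd ^ i =
    \sum_(t <= i < n * n) trunc C i * bdd ^ i)%N.
  rewrite (@big_cat_nat _ _ _ t) ?(leq_trans le_t) //= big_nat big1 ?add0n // => i.
  by case/andP=> _ lt; rewrite /trunc leqNgt lt.
have lt C i : (trunc C i < bdd)%N by rewrite /trunc; case: ifP => // _; exact: digit_lt.
rewrite !truncE //; apply: base_high_le => //.
by rewrite !trunc0 -!truncE.
Qed.

Lemma key_above_inj t A B : key_above t A = key_above t B ->
  forall x, (t <= pos x)%N -> expo A x.1 x.2 = expo B x.1 x.2.
Proof.
move=> e x le_t; have lt_x := pos_lt x.
have le1 : (key_above (pos x) A <= key_above (pos x) B)%N.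
  by apply: (key_above_le le_t); rewrite ?e // ltnW.
have le2 : (key_above (pos x) B <= key_above (pos x) A)%N.
  by apply: (key_above_le le_t); rewrite ?e // ltnW.
have le3 : (key_above (pos x).+1 A <= key_above (pos x).+1 B)%N.
  by apply: (key_above_le _ _ le1).
have le4 : (key_above (pos x).+1 B <= key_above (pos x).+1 A)%N.
  by apply: (key_above_le _ _ le2).
move: le1 le2 le3 le4; rewrite !key_aboveE !(big_ltn lt_x) !digitE => *.
have b_gt0 : (0 < bdd ^ pos x)%N by rewrite expn_gt0.
apply/eqP; rewrite -(eqn_pmul2r b_gt0); lia.
Qed.

Lemma key_inj : injective key.
Proof.
move=> A B; rewrite !keyE => e; apply: expo_inj => i k.
exact: (key_above_inj e (x := (i, k))).
Qed.

Lemma key_above_expo A B x :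
  key_above (pos x).+1 A = key_above (pos x).+1 B ->
  (key A <= key B)%N -> (expo A x.1 x.2 <= expo B x.1 x.2)%N.
Proof.
move=> e; rewrite !keyE => le; have lt_x := pos_lt x.
have := key_above_le (leq0n (pos x)) (ltnW lt_x) le.
rewrite !key_aboveE !(big_ltn lt_x) -!key_aboveE e leq_add2r !digitE.
by rewrite leq_mul2r -[(_ ^ _ == 0)%N]negbK -lt0n expn_gt0.
Qed.

Lemma eq_ev c v1 v2 : v1 =2 v2 -> ev c v1 = ev c v2.
Proof. by move=> e; rewrite /ev (eq_pure al e). Qed.

Lemma pure_scale_powers (w : N -> N -> nat) (t : K) v A :
  pure al (fun i k => t ^+ w i k * v i k) A =
  t ^+ (\sum_i \sum_k w i k * expo A i k)%N * pure al v A.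
Proof.
rewrite !pureE -prodrXr -big_split; apply: eq_bigr => i _ /=.
rewrite -prodrXr -big_split; apply: eq_bigr => k _ /=.
by rewrite exprMn -exprM.
Qed.

Section LeadingMonomial.
Variables (c : dpb -> K) (A0 : dpb) (j j' i : N).
Hypotheses (c_inv : unip_invariant c) (c_A0 : c A0 != 0).
Hypothesis A0_min : forall A, c A != 0 -> (key A0 <= key A)%N.
Hypothesis j'E : j' = j.+1 :> nat.

Let t := (pos (j, i)).+1.
Let hi A := key_above t A.
Let c1 A := if hi A == hi A0 then c A else 0.

Lemma leading_hi_le A : c A != 0 -> (hi A0 <= hi A)%N.
Proof.
move=> /A0_min; rewrite !keyE => le.
exact: (key_above_le (leq0n t) (pos_lt (j, i)) le).
Qed.

(* Rescaling the variables by powers of a parameter tending to 0 degenerates the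
   row operation to the letters <= i. *)
Lemma leading_part_invariant z v :
  ev c1 (row_op z (fun k : N => k <= i)%N j j' v) = ev c1 v.
Proof.
pose w a k := if (t <= pos (a, k))%N then (bdd ^ pos (a, k))%N else 0%N.
have hiE A : hi A = (\sum_a \sum_k w a k * expo A a k)%N.
  rewrite /hi /key_above big_mkcond pair_big /=; apply: eq_bigr => -[a k] _ /=.
  by rewrite /w; case: ifP => _; rewrite ?mul0n // mulnC.
have jn : (j.+1 < n)%N by rewrite -j'E.
have posE k : pos (j, k) = (pos (j', k)).+1 by rewrite /pos /= j'E; lia.
have tj k : (t <= pos (j, k))%N = (i < k)%N by rewrite /t /pos /=; nia.
have tj' k : (t <= pos (j', k))%N = (i < k)%N.
  by rewrite /t /pos /= j'E; apply/idP/idP; nia.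
pose dl k := (w j k - w j' k)%N.
have wE k : w j k = (w j' k + dl k)%N.
  rewrite /dl subnKC // /w tj tj'; case: ifP => // _.
  by rewrite posE leq_pexp2l.
have dl0 k : (dl k == 0)%N = (k <= i)%N.
  rewrite /dl subn_eq0 /w tj tj' posE; case: ltnP => // _.
  by rewrite leq_exp2l // ltnn.
pose q : {poly K} := \sum_A (c A *: 'X^(hi A - hi A0)) * \prod_a \prod_k
  (if a == j' then (v j' k)%:P + (z * v j k) *: 'X^(dl k) else (v a k)%:P) ^+ expo A a k.
pose p : {poly K} := \sum_A (c A *: 'X^(hi A - hi A0)) * (pure al v A)%:P.
pose ut x : N -> N -> K :=
  fun a k => if a == j' then v j' k + z * v j k * x ^+ dl k else v a k.
have qE x : q.[x] = \sum_A c A * x ^+ (hi A - hi A0) * pure al (ut x) A.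
  rewrite horner_sum; apply: eq_bigr => A _.
  rewrite !hornerE; congr (_ * _); rewrite pureE horner_prod.
  apply: eq_bigr => a _; rewrite horner_prod; apply: eq_bigr => k _.
  by rewrite horner_exp /ut; case: ifP; rewrite !hornerE ?hornerXn.
have pE x : p.[x] = \sum_A c A * x ^+ (hi A - hi A0) * pure al v A.
  by rewrite horner_sum; apply: eq_bigr => A _; rewrite !hornerE.
have ev_scale x u : x ^+ hi A0 * (\sum_A c A * x ^+ (hi A - hi A0) * pure al u A) =
    ev c (fun a k => x ^+ w a k * u a k).
  rewrite big_distrr; apply: eq_bigr => A _ /=; rewrite pure_scale_powers -hiE.
  have [->|nz] := eqVneq (c A) 0; first by rewrite !(mul0r, mulr0).
  by rewrite !mulrA; congr (_ * _); rewrite [_ * c A]mulrC -mulrA -exprD subnKC // leading_hi_le.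
have pq : q = p.
  apply/eqP; rewrite -subr_eq0; apply/eqP.
  apply: (poly_eq0_cofinite K_inf (s := [:: 0])) => x; rewrite inE => nz_x.
  rewrite hornerD hornerN; apply/eqP; rewrite subr_eq0; apply/eqP.
  apply: (mulfI (expf_neq0 (hi A0) nz_x)); rewrite qE pE !ev_scale.
  rewrite -[RHS](c_inv z _ j'E); apply: eq_ev => a k.
  rewrite /row_op andbT /ut; case: eqP => // ->.
  by rewrite wE mulrDr exprD; ring.
have ev1 u : \sum_A c A * 0 ^+ (hi A - hi A0) * pure al u A = ev c1 u.
  apply: eq_bigr => A _; congr (_ * _); rewrite /c1 expr0n subn_eq0.
  have [->|nz] := eqVneq (c A) 0; first by rewrite mul0r; case: ifP.
  by rewrite eqn_leq (leading_hi_le nz) andbT; case: ifP; rewrite ?mulr1 ?mulr0.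
rewrite -[RHS]ev1 -pE -pq qE ev1; apply: eq_ev => a k.
rewrite /row_op /ut; case: eqP => //= ->; rewrite expr0n dl0.
by case: ifP; rewrite ?mulr1 // mulr0 addr0.
Qed.

Let beta := (\sum_(k : N | k <= i) expo A0 j' k)%N.
Let alpha := (\sum_(k : N | k < i) expo A0 j k)%N.

Lemma leading_part_rows A : c1 A != 0 ->
  [/\ (\sum_(k : N | k <= i) expo A j' k = beta)%N,
      (\sum_(k : N | k < i) expo A j k <= alpha)%N & c A != 0].
Proof.
rewrite /c1; case: ifP => [/eqP eh nzA|_ /eqP//].
have jn : (j.+1 < n)%N by rewrite -j'E.
have e1 (k : N) : (i < k)%N -> expo A j k = expo A0 j k.
  by move=> ltik; apply: (key_above_inj eh (x := (j, k))); rewrite /t /pos /=; nia.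
have e2 (k : N) : (i < k)%N -> expo A j' k = expo A0 j' k.
  move=> ltik; apply: (key_above_inj eh (x := (j', k))).
  by rewrite /t /pos /= j'E; nia.
split=> //.
  have := sum_expo A j'; rewrite -(sum_expo A0 j').
  rewrite (bigID (fun k : N => k <= i)%N) /= [RHS](bigID (fun k : N => k <= i)%N) /=.
  rewrite (@eq_bigr _ _ _ _ _ (fun k : N => ~~ (k <= i)%N) _ (expo A0 j')).
    by move/addIn.
  by move=> k; rewrite -ltnNge; apply: e2.
have e3 : (expo A0 j i <= expo A j i)%N.
  by apply: (key_above_expo (x := (j, i))) => //; apply: A0_min.
have := sum_expo A j; rewrite -(sum_expo A0 j).
rewrite (bigID (fun k : N => k < i)%N) /= [RHS](bigID (fun k : N => k < i)%N) /=.
rewrite [X in (_ + X)%N](bigD1 i) ?ltnn //= [X in _ = (_ + X)%N](bigD1 i) ?ltnn //=.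
rewrite [X in (_ + (_ + X))%N](@eq_bigr _ _ _ _ _ _ _ (expo A0 j)); last first.
  by move=> k /andP[le_ik neq]; apply: e1; rewrite ltn_neqAle eq_sym neq leqNgt.
rewrite -/alpha; move: e3; lia.
Qed.

Lemma leading_part_vanish v : (alpha < beta)%N -> v j i = - v j' i -> ev c1 v = 0.
Proof.
move=> lt_ab vi.
have neq : j == j' = false by apply/eqP => e; have := j'E; rewrite -e; lia.
pose P k := v j k + v j' k.
pose entry (a k : N) : {poly K} := if a == j then
  (if (k <= i)%N then (P k) *: 'X - (v j' k)%:P else (v j k)%:P) else (v a k)%:P.
pose L : {poly K} := \sum_A c1 A *: \prod_a \prod_k entry a k ^+ expo A a k.
pose entry' (a k : N) : {poly K} := if (a == j') && (k <= i)%N then (P k)%:P else entry a k.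
pose R : {poly K} := \sum_A c1 A *: \prod_a \prod_k entry' a k ^+ expo A a k.
have hornE (e : N -> N -> {poly K}) x :
    (\sum_A c1 A *: \prod_a \prod_k e a k ^+ expo A a k).[x] =
    ev c1 (fun a k => (e a k).[x]).
  rewrite horner_sum; apply: eq_bigr => A _; rewrite hornerZ pureE horner_prod.
  congr (_ * _); apply: eq_bigr => a _; rewrite horner_prod; apply: eq_bigr => k _.
  by rewrite horner_exp.
have LR : L = 'X^beta * R.
  apply/eqP; rewrite -subr_eq0; apply/eqP.
  apply: (poly_eq0_cofinite K_inf (s := [::])) => x _.
  rewrite hornerD hornerN hornerM hornerXn !hornE; apply/eqP; rewrite subr_eq0.
  rewrite -(leading_part_invariant 1) big_distrr; apply/eqP/eq_bigr => A _ /=.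
  have [->|nzA] := eqVneq (c1 A) 0; first by rewrite !mul0r mulr0.
  rewrite mulrCA; congr (_ * _).
  have [eb _ _] := leading_part_rows nzA.
  rewrite !pureE (bigD1 j') //= [in RHS](bigD1 j') //= mulrA; congr (_ * _).
    rewrite (bigID (fun k : N => k <= i)%N) /= [in RHS](bigID (fun k : N => k <= i)%N) /=.
    rewrite mulrA; congr (_ * _).
      rewrite -eb -prodrXr -big_split; apply: eq_bigr => k le_ki /=.
      rewrite /row_op /entry' /entry eqxx le_ki /= eq_sym neq eqxx !hornerE.
      rewrite -exprMn; congr (_ ^+ _); rewrite /=; ring.
    apply: eq_bigr => k /negbTE gt; rewrite /row_op /entry' gt andbF.
    by [].
  apply: eq_bigr => a /negbTE na; apply: eq_bigr => k _.
  by rewrite /row_op /entry' na.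
have sL : (size L <= beta)%N.
  apply: (big_ind (fun p : {poly K} => size p <= beta)%N) => [|p q sp sq|A _].
  - by rewrite size_poly0.
  - by rewrite (leq_trans (size_polyD _ _)) // geq_max sp.
  have [->|nzA] := eqVneq (c1 A) 0; first by rewrite scale0r size_poly0.
  apply: leq_trans (size_scale_leq _ _) _.
  have [_ le_alpha _] := leading_part_rows nzA.
  apply: leq_trans lt_ab; apply: leq_trans _
    (_ : (\sum_(k : N | k < i) expo A j k).+1 <= _)%N; last by rewrite ltnS.
  pose D (x : N * N) : nat := if (x.1 == j) && (x.2 < i)%N then expo A x.1 x.2 else 0%N.
  rewrite pair_big /=.
  have -> : (\sum_(k : N | k < i) expo A j k = \sum_x D x)%N.
    rewrite /D -(pair_big predT predT
      (fun a k : N => if (a == j) && (k < i)%N then expo A a k else 0%N)) /=.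
    rewrite [RHS](bigD1 j) //= [X in (_ + X)%N]big1 ?addn0; last first.
      by move=> a /negbTE na; rewrite big1 // => k _; rewrite na.
    by rewrite big_mkcond; apply: eq_bigr => k _; rewrite eqxx.
  apply: size_prod_deg => -[a k] /=.
  have szC (x : K) m : (size (x%:P ^+ m : {poly K}) <= 1)%N.
    by rewrite -rmorphXn /= size_polyC; case: (_ != _).
  rewrite /D /entry /=; case: (a =P j) => [->|_] /=; last exact: szC.
  have [lt_ki|le_ik] := ltnP k i.
    have s2 : (size (P k *: 'X - (v j' k)%:P)%R <= 2)%N.
      rewrite (leq_trans (size_polyD _ _)) // geq_max size_polyN.
      rewrite (leq_trans (size_scale_leq _ _)) ?size_polyX //=.
      by rewrite size_polyC; case: (_ != _).
    rewrite (ltnW lt_ki); apply: leq_trans (size_poly_exp_leq _ _) _.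
    rewrite ltnS -[X in (_ <= X)%N]mul1n leq_mul2r; apply/orP; right.
    by move: s2; case: (size _) => // m; rewrite ltnS.
  case: ifP => [le_ki|_]; last exact: szC.
  have -> : k = i by apply: val_inj; apply/eqP; rewrite eqn_leq le_ki.
  by rewrite /P vi addNr scale0r sub0r -polyCN szC.
have R0 : R = 0.
  apply/eqP/negPn/negP => nzR; move: sL; rewrite LR.
  by rewrite size_monicM ?monicXn // size_polyXn addSn /= leqNgt -[X in (X < _)%N]addn0
    ltn_add2l size_poly_gt0 nzR.
have : L.[1] = 0 by rewrite LR R0 mulr0 horner0.
rewrite hornE => <-; apply: eq_ev => a k; rewrite /entry.
case: eqP => [->|_]; last by rewrite hornerC.
by case: ifP => _; rewrite !hornerE // addrK.
Qed.

Lemma leading_semistandard :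
  (\sum_(k : N | k <= i) expo A0 j' k <= \sum_(k : N | k < i) expo A0 j k)%N.
Proof.
rewrite leqNgt; apply/negP => lt_ab.
have : c1 A0 = 0.
  apply: (pure_monomials_indep K_inf) => v nz_v.
  rewrite -[LHS]/(ev c1 v) -(leading_part_invariant (- (v j i + v j' i) / v j i) v).
  apply: leading_part_vanish => //.
  have neq : j == j' = false by apply/eqP => e; have := j'E; rewrite -e; lia.
  by rewrite /row_op neq /= eqxx leqnn /= divfK //; ring.
by rewrite /c1 eqxx; apply/eqP.
Qed.

End LeadingMonomial.

Lemma descent_exists (u : seq N) : uniq u -> ~~ sorted ltn [seq val x | x <- u] ->
  exists u1 x y u2, u = u1 ++ x :: y :: u2 /\ (y < x)%N.
Proof.
elim: u => [|x [|y u] IHu] //= /andP[xu Uu]; rewrite negb_and => /orP[|ns].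
  rewrite -leqNgt leq_eqVlt => /orP[/eqP/val_inj e|lt]; last by exists [::], x, y, u.
  by rewrite e mem_head in xu.
by have [u1 [x' [y' [u2 [-> lt]]]]] := IHu Uu ns; exists (x :: u1), x', y', u2.
Qed.

Definition wgt (xs u : seq N) : nat := (\sum_(z <- zip xs u) bdd ^ pos z)%N.

Lemma wgt_swap (r r' x y : N) : (r < r')%N -> (y < x)%N ->
  (bdd ^ pos (r, y) + bdd ^ pos (r', x) < bdd ^ pos (r, x) + bdd ^ pos (r', y))%N.
Proof.
move=> lt_r lt_y; rewrite /pos /= !expnD.
have lt1 : (bdd ^ (y * n) < bdd ^ (x * n))%N.
  by rewrite ltn_exp2l // ltn_mul2r lt_y andbT (leq_ltn_trans _ (ltn_ord r)).
have lt2 : (bdd ^ (n - r'.+1) < bdd ^ (n - r.+1))%N.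
  by rewrite ltn_exp2l //; have := ltn_ord r'; lia.
move: (bdd ^ (y * n))%N (bdd ^ (x * n))%N lt1 => a b lt1.
by move: (bdd ^ (n - r'.+1))%N (bdd ^ (n - r.+1))%N lt2 => c d lt2; nia.
Qed.

(* A column weighs least when it is increasing. *)
Lemma wgt_sorted_min (xs u s : seq N) :
  sorted ltn [seq val x | x <- xs] -> sorted ltn [seq val x | x <- s] ->
  size xs = size u -> uniq u -> perm_eq u s ->
  (wgt xs s <= wgt xs u)%N /\ ((wgt xs u <= wgt xs s)%N -> u = s).
Proof.
move=> sxs ss; have [m le_m] := ubnP (ninv u).
elim: m u le_m => // m IHm u le_m su Uu pus.
have [su1|nsu] := boolP (sorted ltn [seq val x | x <- u]).
  suff -> : u = s by [].
  apply: (inj_map (val_inj : injective (val : N -> nat))).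
  apply: (irr_sorted_eq ltn_trans ltnn su1 ss) => k.
  by apply: perm_mem; apply: perm_map.
have [u1 [x [y [u2 [eu lt_yx]]]]] := descent_exists Uu nsu.
pose u' := u1 ++ y :: x :: u2.
have puu' : perm_eq u' u.
  by rewrite eu perm_cat2l; apply/seq.permP => a /=; rewrite addnCA.
have lt' : (ninv u' < m)%N.
  have := ninv_swap u1 u2 x y; rewrite -eu -/u' lt_yx ltnNge (ltnW lt_yx) /=.
  by move: le_m; lia.
have [|le_s _] := IHm u' lt' _ (etrans (perm_uniq puu') Uu) (perm_trans puu' pus).
  by rewrite su (perm_size puu').
suff lt_w : (wgt xs u' < wgt xs u)%N.
  split; first exact: leq_trans le_s (ltnW lt_w).
  by move=> le; have := leq_trans lt_w (leq_trans le le_s); rewrite ltnn.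
move: su sxs; rewrite /u' eu /wgt -{1 2 3 4}(cat_take_drop (size u1) xs) => su sxs.
have st : size (take (size u1) xs) = size u1.
  rewrite size_takel //; move: su; rewrite cat_take_drop size_cat => ->.
  by rewrite leq_addr.
rewrite !zip_cat // !big_cat /= ltn_add2l.
move: su sxs; rewrite !size_cat st => /addnI; rewrite map_cat.
case: (drop _ _) => [|r [|r' xs']] //= _ /cat_sorted2[_ /= /andP[lt_r _]].
by rewrite !big_cons !addnA ltn_add2r wgt_swap.
Qed.

Lemma card_row_lt (r : N) m : (m <= al r)%N ->
  #|[set x : box al | ((val x).1 == r) && ((val x).2 < m)%N]| = m.
Proof.
move=> le_m; have le_al : (al r <= ncols al)%N := leq_bigmax r.
have lt0 (k : 'I_m) : (k < al r)%N := leq_trans (ltn_ord k) le_m.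
have lt (k : 'I_m) : (k < ncols al)%N := leq_trans (lt0 k) le_al.
have lt2 (k : 'I_m) : ((r, Ordinal (lt k)).2 < al (r, Ordinal (lt k)).1)%N := lt0 k.
pose f (k : 'I_m) : box al := Sub (r, Ordinal (lt k)) (lt2 k).
have f_inj : injective f.
  by move=> k k' /(congr1 val) /= [] /= e; apply: val_inj.
rewrite -[RHS]card_ord -(card_codom f_inj); apply: eq_card => x.
rewrite inE; apply/andP/codomP => [[/eqP e xlt]|[k ->]]; last by rewrite /= eqxx.
exists (Ordinal xlt); apply: val_inj; rewrite [LHS]surjective_pairing e.
by congr (_, _); apply: val_inj.
Qed.

Definition lead_coord (S : extbasis n al) (A : dpb) : K := dprime K n al (dvec K A) S.

Lemma ev_lead_coord S v : ev (lead_coord S) v = wedges (fun x => v (val x).1) S.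
Proof.
rewrite -dprime_pure (dvec_sum (pure al v)) linear_sum sum_ffunE.
by apply: eq_bigr => A _; rewrite linearZ /= [RHS]ffunE scale_regular mulrC.
Qed.

Definition has_content (w : {ffun box al -> N}) (A : dpb) :=
  [forall i, forall k, row_count w i k == expo A i k].

Lemma lead_coordE S A : lead_coord S A = \sum_(w | has_content w A)
  \prod_j wedge_coef K [seq w x | x <- col_boxes (al := al) j] (val (S j)).
Proof.
rewrite /lead_coord comp_lfunE lin_extE [RHS]big_mkcond; apply: eq_bigr => w _.
rewrite lin_extE (bigD1 A) //= ffunE eqxx mul1r big1 ?addr0; last first.
  by move=> B nB; rewrite ffunE (negbTE nB) mul0r.
rewrite -/(has_content w A).
by case: (has_content w A); rewrite ?mul1r ?mul0r.
Qed.

Lemma key_content w A : has_content w A ->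
  key A = (\sum_(x : box al) bdd ^ pos ((val x).1, w x))%N.
Proof.
move=> /forallP wA.
rewrite /key -(pair_big predT predT (fun i k => expo A i k * bdd ^ pos (i, k))%N) /=.
rewrite (partition_big (fun x : box al => (val x).1) predT) //=.
apply: eq_bigr => i _; rewrite (partition_big w predT) //=.
apply: eq_bigr => k _; have /forallP/(_ k)/eqP <- := wA i.
rewrite /row_count -sum_nat_const; apply: eq_big => x; rewrite inE //.
by move=> /andP[/eqP-> /eqP->].
Qed.

Hypothesis al_dec : forall i i' : N, (i <= i')%N -> (al i' <= al i)%N.

Lemma col_boxes_rows (j : 'I_(ncols al)) :
  [seq (val x).1 | x <- col_boxes (al := al) j] = [seq i <- enum 'I_n | (j < al i)%N].
Proof.
rewrite /col_boxes; elim: (enum 'I_n) => //= i s IHs.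
by case: insubP => [x /= -> vx|/= /negbTE->] //=; rewrite IHs vx.
Qed.

Lemma sorted_col_rows (j : 'I_(ncols al)) :
  sorted ltn [seq val (val x).1 | x <- col_boxes (al := al) j].
Proof.
rewrite (map_comp (val : N -> nat) (fun x : box al => (val x).1)) col_boxes_rows.
apply: (subseq_sorted ltn_trans (map_subseq _ (filter_subseq _ _))).
by rewrite val_enum_ord iota_ltn_sorted.
Qed.

Lemma lead_coord_invariant S : unip_invariant (lead_coord S).
Proof.
move=> j j' z v j'E; rewrite !ev_lead_coord !ffunE; apply: eq_bigr => c _.
have [lt_c|le_c] := ltnP c (al j'); last first.
  congr col_coef; apply/eq_in_map => x; rewrite mem_col_boxes => /eqP xc.
  apply/funext => k; rewrite /row_op andbT; case: eqP => // e.
  by have := valP x; rewrite /= xc e ltnNge le_c.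
have lt_c' : (c < al j)%N by apply: leq_trans lt_c (al_dec _); rewrite j'E.
have eE : enum 'I_n = take j (enum 'I_n) ++ j :: j' :: drop j.+2 (enum 'I_n).
  rewrite -[LHS](cat_take_drop j) (drop_nth j) ?size_enum_ord //.
  rewrite (drop_nth j) ?size_enum_ord -?j'E // j'E; congr (_ ++ _ :: _ :: _).
    by apply: val_inj; rewrite /= nth_enum_ord.
  by apply: val_inj; rewrite /= nth_enum_ord -?j'E.
pose xj : box al := Sub (j, c) lt_c'; pose xj' : box al := Sub (j', c) lt_c.
pose f i : option (box al) := insub (i, c).
have cE : col_boxes (al := al) c = pmap f (take j (enum 'I_n)) ++
    xj :: xj' :: pmap f (drop j.+2 (enum 'I_n)).
  by rewrite /col_boxes {1}eE pmap_cat /= /f !insubT.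
have := uniq_col_boxes c; rewrite cE cat_uniq /= => /and4P[_ nh nxj /andP[nxj' _]].
rewrite !map_cat /=.
have neq : j == j' = false by apply/eqP => e; have := j'E; rewrite -e; lia.
have other (s : seq (box al)) : {subset s <= col_boxes (al := al) c} -> xj' \notin s ->
    [seq row_op z predT j j' v (val x).1 | x <- s] = [seq v (val x).1 | x <- s].
  move=> sub ns; apply/eq_in_map => x xs; apply/funext => k; rewrite /row_op andbT.
  case: eqP => // e; case/negP: ns; suff <- : x = xj' by [].
  apply: val_inj; rewrite [LHS]surjective_pairing e; congr (_, _).
  by apply/eqP; rewrite -mem_col_boxes sub.
have sub1 : {subset pmap f (take j (enum 'I_n)) <= col_boxes (al := al) c}.
  by move=> x xs; rewrite cE mem_cat xs.
have sub2 : {subset pmap f (drop j.+2 (enum 'I_n)) <= col_boxes (al := al) c}.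
  by move=> x xs; rewrite cE mem_cat !inE xs !orbT.
have nxj1 : xj' \notin pmap f (take j (enum 'I_n)).
  by apply: contra nh => ->; rewrite orbT.
rewrite (other _ sub1 nxj1) (other _ sub2 nxj').
rewrite -[in RHS](col_coef_add_row _ _ _ z); congr (col_coef (_ ++ _ :: _ :: _) _).
  by apply/funext => k; rewrite /row_op neq.
by apply/funext => k; rewrite /row_op eqxx.
Qed.
Section LeadingTableau.
Variable A : dpb.
Hypothesis A_ss : forall (j j' i : N), j' = j.+1 :> nat ->
  (\sum_(k : N | k <= i) expo A j' k <= \sum_(k : N | k < i) expo A j k)%N.

Let cum (r : N) m := (\sum_(k : N | k < m) expo A r k)%N.

Lemma lead_cum_mono r m m' : (m <= m')%N -> (cum r m <= cum r m')%N.
Proof.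
move=> le_m; rewrite /cum [X in (_ <= X)%N](bigID (fun k : N => k < m)%N) /=.
apply: leq_trans (leq_addr _ _); rewrite leq_eqVlt; apply/orP; left; apply/eqP.
apply: eq_bigl => k; apply/idP/andP => [lt|[]//]; split=> //.
exact: leq_trans lt le_m.
Qed.

Lemma lead_cum_n r : cum r n = al r.
Proof. by rewrite -(sum_expo A r); apply: eq_bigl => k; rewrite ltn_ord. Qed.

Lemma lead_cum_le r m : (m <= n)%N -> (cum r m <= al r)%N.
Proof. by move=> le; rewrite -lead_cum_n lead_cum_mono. Qed.

Let letter (r : N) (c : nat) := #|[set k : N | (cum r k.+1 <= c)%N]|.

Lemma lead_letter_lt r c m : (m <= n)%N -> (letter r c < m)%N = (c < cum r m)%N.
Proof.
case: m => [|m] lt_m; first by rewrite /cum big_pred0.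
have card_lt p : (p <= n)%N -> #|[set k : N | (k < p)%N]| = p.
  by move=> le_p; rewrite -sum1dep_card big_ord_narrow // sum1_card card_ord.
rewrite ltnS [RHS]ltnNge; apply/idP/idP => [le|nle].
  apply/negP => le_c; have : (m.+1 <= letter r c)%N; last by rewrite ltnNge le.
  rewrite -(card_lt _ lt_m); apply: subset_leq_card; apply/subsetP => k.
  by rewrite !inE => lt_k; apply: leq_trans le_c; apply: lead_cum_mono.
rewrite -(card_lt _ (ltnW lt_m)); apply: subset_leq_card; apply/subsetP => k.
rewrite !inE => le_c; rewrite ltnNge; apply: contra nle => le_mk.
by apply: leq_trans le_c; apply: lead_cum_mono.
Qed.

Lemma lead_letter_n (x : box al) : (letter (val x).1 (val x).2 < n)%N.
Proof. by rewrite lead_letter_lt // lead_cum_n (valP x). Qed.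

Definition lead_fill : {ffun box al -> N} := [ffun x => Ordinal (lead_letter_n x)].

Lemma lead_fillE x : lead_fill x = letter (val x).1 (val x).2 :> nat.
Proof. by rewrite ffunE. Qed.

Lemma lead_fill_content : has_content lead_fill A.
Proof.
apply/forallP => r; apply/forallP => k; apply/eqP.
pose B m := [set x : box al | ((val x).1 == r) && ((val x).2 < m)%N].
have subB : B (cum r k) \subset B (cum r k.+1).
  apply/subsetP => x; rewrite !inE => /andP[-> lt] /=; apply: leq_trans lt _.
  exact: lead_cum_mono.
have -> : row_count lead_fill r k = #|B (cum r k.+1) :\: B (cum r k)|.
  apply: eq_card => x; rewrite !inE; case: eqP => [<-|] //=.
  rewrite -(lead_letter_lt _ _ (ltnW (ltn_ord k))) -(lead_letter_lt _ _ (ltn_ord k)).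
  by rewrite -val_eqE /= lead_fillE ltnS -leqNgt eqn_leq andbC.
rewrite cardsD (setIidPr subB) !card_row_lt ?lead_cum_le ?(ltnW (ltn_ord k)) //.
rewrite /cum (bigD1 k) //= (eq_bigl (fun i : N => (i < k)%N)) ?addnK // => i.
by rewrite ltnS ltn_neqAle andbC.
Qed.

Lemma lead_letter_strict (r r' : N) c : (r < r')%N -> (c < al r')%N ->
  (letter r c < letter r' c)%N.
Proof.
move=> lt_r lt_c; have [m e] : exists m, r' = (r + m).+1 :> nat.
  by exists (r' - r.+1)%N; lia.
elim: m r' e lt_c {lt_r} => [|m IHm] r' e lt_c.
  have lt_n : (letter r' c < n)%N by rewrite lead_letter_lt // lead_cum_n.
  rewrite lead_letter_lt; last exact: ltnW.
  have e' : r' = r.+1 :> nat by rewrite e addn0.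
  have /= := A_ss (Ordinal lt_n) e'; apply: leq_trans.
  by have := leqnn (letter r' c).+1; rewrite lead_letter_lt.
have lt_r1 : ((r + m).+1 < n)%N by have := ltn_ord r'; lia.
pose r1 := Ordinal lt_r1.
have lt_c1 : (c < al r1)%N by apply: leq_trans lt_c (al_dec _); rewrite /= e; lia.
apply: leq_trans (IHm r1 erefl lt_c1) _; apply: ltnW.
have lt_n : (letter r' c < n)%N by rewrite lead_letter_lt // lead_cum_n.
rewrite lead_letter_lt; last exact: ltnW.
have e' : r' = r1.+1 :> nat by rewrite e /= addnS.
have /= := A_ss (Ordinal lt_n) e'; apply: leq_trans.
by have := leqnn (letter r' c).+1; rewrite lead_letter_lt.
Qed.

Lemma lead_fill_sorted (j : 'I_(ncols al)) :
  sorted ltn [seq val (lead_fill x) | x <- col_boxes (al := al) j].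
Proof.
have := sorted_col_rows j; rewrite !sorted_pairwise; try exact: ltn_trans.
rewrite !pairwise_map; apply: sub_in_pairwise (allss _) => x y xj yj /=.
move=> lt; rewrite !lead_fillE.
move: xj yj; rewrite !mem_col_boxes => /eqP -> /eqP ej; rewrite ej.
by apply: lead_letter_strict => //; rewrite -ej (valP y).
Qed.

Lemma lead_fill_col_card (j : 'I_(ncols al)) :
  #|[set k in [seq lead_fill x | x <- col_boxes (al := al) j]]| == conjp al j.
Proof.
rewrite cardsE -size_col_boxes -(size_map lead_fill); apply/eqP/card_uniqP.
rewrite -(map_inj_uniq val_inj) -map_comp.
exact: (sorted_uniq ltn_trans ltnn (lead_fill_sorted j)).
Qed.

Definition lead_cols : extbasis n al :=
  [ffun j : 'I_(ncols al) => (Sub [set k in [seq lead_fill x | x <- col_boxes (al := al) j]]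
    (lead_fill_col_card j) : extmon n (conjp al j))].

Lemma lead_cols_key (w : {ffun box al -> N}) B : has_content w B ->
  \prod_j wedge_coef K [seq w x | x <- col_boxes (al := al) j] (val (lead_cols j)) != 0 ->
  (key A <= key B)%N /\ ((key B <= key A)%N -> w = lead_fill).
Proof.
move=> wB /prodf_neq0 nz.
have colP j : uniq [seq w x | x <- col_boxes (al := al) j] /\
   perm_eq [seq w x | x <- col_boxes (al := al) j]
           [seq lead_fill x | x <- col_boxes (al := al) j].
  have := nz j isT; rewrite /wedge_coef ffunE /=.
  case: ifP => [/andP[Uw /eqP e] _|]; last by rewrite eqxx.
  split=> //; apply: uniq_perm => //.
    rewrite -(map_inj_uniq val_inj) -map_comp.
    exact: (sorted_uniq ltn_trans ltnn (lead_fill_sorted j)).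
  by move=> k; move/setP/(_ k): e; rewrite !inE.
have keyW (u : {ffun box al -> N}) : (\sum_(x : box al) bdd ^ pos ((val x).1, u x) =
    \sum_j wgt [seq (val x).1 | x <- col_boxes (al := al) j]
               [seq u x | x <- col_boxes (al := al) j])%N.
  rewrite -[LHS]big_enum -(perm_big _ (flatten_col_boxes al)) /= big_flatten big_map.
  rewrite big_enum; apply: eq_bigr => j _.
  by rewrite /wgt zip_map big_map.
have colmin j : (wgt [seq (val x).1 | x <- col_boxes (al := al) j]
      [seq lead_fill x | x <- col_boxes (al := al) j] <=
    wgt [seq (val x).1 | x <- col_boxes (al := al) j]
      [seq w x | x <- col_boxes (al := al) j])%N /\
   ((wgt [seq (val x).1 | x <- col_boxes (al := al) j]
      [seq w x | x <- col_boxes (al := al) j] <=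
    wgt [seq (val x).1 | x <- col_boxes (al := al) j]
      [seq lead_fill x | x <- col_boxes (al := al) j])%N ->
    [seq w x | x <- col_boxes (al := al) j] =
    [seq lead_fill x | x <- col_boxes (al := al) j]).
  have [Uw pw] := colP j; apply: wgt_sorted_min => //.
  - by rewrite -map_comp; apply: sorted_col_rows.
  - by rewrite -map_comp; apply: lead_fill_sorted.
  - by rewrite !size_map.
rewrite (key_content wB) (key_content lead_fill_content) !keyW.
split=> [|le]; first by apply: leq_sum => j _; case: (colmin j).
apply/ffunP => x; pose j := (val x).2.
have [_ H] := colmin j.
have hle := sum_leq_termwise (fun i => proj1 (colmin i)) le j.
move/eq_in_map: (H hle) => /(_ x); apply.
by rewrite mem_col_boxes.
Qed.

Lemma lead_coord_self : lead_coord lead_cols A = 1.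
Proof.
rewrite lead_coordE (bigD1 lead_fill) ?lead_fill_content //= [X in _ + X]big1 ?addr0.
  apply: big1 => j _; rewrite /wedge_coef ffunE /= eqxx.
  have sj := lead_fill_sorted j.
  have U : uniq [seq lead_fill x | x <- col_boxes (al := al) j].
    by rewrite -(map_inj_uniq val_inj) -map_comp; exact: (sorted_uniq ltn_trans ltnn sj).
  rewrite U andbT; suff -> : ninv [seq lead_fill x | x <- col_boxes (al := al) j] = 0%N by [].
  move: sj; rewrite (map_comp (val : N -> nat) lead_fill).
  elim: [seq lead_fill x | x <- _] => //= k s IHs sk; rewrite IHs ?(path_sorted sk) // addn0.
  apply/eqP; rewrite -leqn0 leqNgt -has_count -all_predC.
  have := order_path_min ltn_trans sk; rewrite all_map; apply: sub_all => z /=.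
  by move/ltnW; rewrite leqNgt.
move=> w /andP[wA nw]; apply/eqP/negPn/negP => nz.
have [_ /(_ (leqnn _)) e] := lead_cols_key wA nz.
by rewrite e eqxx in nw.
Qed.

Lemma lead_coord_key B : lead_coord lead_cols B != 0 -> (key A <= key B)%N.
Proof.
rewrite lead_coordE => nz.
have [w /andP[wB nzw]|no] := pickP (fun w : {ffun box al -> N} => has_content w B &&
   (\prod_j wedge_coef K [seq w x | x <- col_boxes (al := al) j] (val (lead_cols j)) != 0)).
  by have [] := lead_cols_key wB nzw.
case/eqP: nz; apply: big1 => w wB; apply/eqP; have := no w.
by rewrite wB /= => /negbFE.
Qed.

End LeadingTableau.

Lemma ev_lin c1 c2 x v : ev (fun A => c1 A - x * c2 A) v = ev c1 v - x * ev c2 v.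
Proof.
rewrite /ev big_distrr -sumrB; apply: eq_bigr => A _ /=.
by rewrite mulrBl mulrA.
Qed.

(* Triangularity: the minimal monomial of an invariant is semistandard, hence is
   the minimal monomial of a product of minors, which can be subtracted. *)
Lemma invariant_span c : unip_invariant c ->
  exists xi : extbasis n al -> K, forall v,
    ev c v = \sum_S xi S * wedges (fun x => v (val x).1) S.
Proof.
pose Kb := (\max_A key A).+1.
have key_lt A : (key A < Kb)%N by rewrite ltnS; apply: leq_bigmax.
suff H m : forall c, unip_invariant c -> (forall A, c A != 0 -> (Kb <= key A + m)%N) ->
    exists xi : extbasis n al -> K, forall v,
    ev c v = \sum_S xi S * wedges (fun x => v (val x).1) S.
  by move=> c_inv; apply: (H Kb) => // A _; exact: leq_addl.
elim: m => [|m IHm] {}c c_inv c_key.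
  exists (fun=> 0) => v; rewrite [RHS]big1 => [|S _]; last by rewrite mul0r.
  apply: big1 => A _; case: (eqVneq (c A) 0) => [->|/c_key]; first by rewrite mul0r.
  by rewrite addn0 leqNgt key_lt.
have [A0 /andP[nzA0 /eqP kA0]|no] := pickP (fun A => (c A != 0) && (key A + m.+1 == Kb)%N);
  last first.
  apply: IHm => // A nzA; have := c_key A nzA; rewrite leq_eqVlt => /orP[/eqP e|].
    by have := no A; rewrite nzA /= e eqxx.
  by rewrite addnS ltnS.
have A0_min A : c A != 0 -> (key A0 <= key A)%N by move/c_key; lia.
have A0_ss (j j' i : N) : j' = j.+1 :> nat ->
    (\sum_(k : N | k <= i) expo A0 j' k <= \sum_(k : N | k < i) expo A0 j k)%N.
  exact: leading_semistandard c_inv nzA0 A0_min.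
pose S0 := lead_cols A0_ss.
have [|A|xi xiE] := IHm (fun A => c A - c A0 * lead_coord S0 A).
- move=> j j' z v e; rewrite !ev_lin (c_inv _ _ _ _ e).
  by rewrite (lead_coord_invariant S0 _ _ e).
- have [->|nA] := eqVneq A A0; first by rewrite lead_coord_self mulr1 subrr eqxx.
  move=> nz; have le : (key A0 <= key A)%N.
    have [cA|/A0_min//] := eqVneq (c A) 0.
    apply: (lead_coord_key (A_ss := A0_ss)); apply: contraNneq nz => e.
    by rewrite e mulr0 cA subrr.
  have : key A0 != key A by rewrite (inj_eq key_inj) eq_sym.
  by lia.
exists (fun S => xi S + (S == S0)%:R * c A0) => v.
under eq_bigr => S _ do rewrite mulrDl.
rewrite big_split /= -xiE ev_lin (bigD1 S0) //= eqxx mul1r.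
rewrite big1 ?addr0 => [|S nS]; last by rewrite (negbTE nS) !mul0r.
by rewrite ev_lead_coord subrK.
Qed.

Lemma factor_dprime (C : finType) (F : 'Hom(dpow K n al, free_on K C)) :
  (forall (j j' : N) z v, j' = j.+1 :> nat ->
    F (pure al (row_op z predT j j' v)) = F (pure al v)) ->
  exists Phi : 'Hom(ext K n al, free_on K C), F = (Phi \o dprime K n al)%VF.
Proof.
move=> F_inv.
have FE v s : F (pure al v) s = ev (fun A => F (dvec K A) s) v.
  rewrite [in LHS](dvec_sum (pure al v)) linear_sum sum_ffunE.
  by apply: eq_bigr => A _; rewrite linearZ /= [LHS]ffunE scale_regular mulrC.
have ex s : exists xi : extbasis n al -> K, forall v,
    F (pure al v) s = \sum_S xi S * wedges (fun x => v (val x).1) S.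
  have [|xi xiE] := @invariant_span (fun A => F (dvec K A) s).
    by move=> j j' z v e; rewrite -!FE F_inv.
  by exists xi => v; rewrite FE.
have [xi xiE] := fin_all_exists ex.
exists (lin_ext (fun S s => xi s S)); apply: (pure_hom_eq K_inf) => v.
apply/ffunP => s; rewrite comp_lfunE lin_extE xiE dprime_pure.
by apply: eq_bigr => S _; rewrite mulrC.
Qed.

End Straightening.

(** * Binomial coefficients modulo 2 *)

Section BinomialParity.
Local Open Scope nat_scope.

Lemma odd_bin n k : odd 'C(n, k) = (odd k ==> odd n) && odd 'C(n./2, k./2).
Proof.
have [m] := ubnP n; elim: m n k => // m IHm [|[|n]] [|[|k]] lt_n; rewrite ?bin0 ?bin1 //=.
- by rewrite ?bin0n /= ?andbF.
- by rewrite ?bin0n /= ?andbF.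
- by rewrite ?negbK ?bin0 ?andbT.
rewrite !binS !oddD (IHm n k.+2) ?(IHm n k) /=; [|lia..].
rewrite !negbK; case: (odd 'C(n, k.+1)); case: (odd k ==> odd n) => //=;
  by case: (odd 'C(n./2, k./2.+1)); case: (odd 'C(n./2, k./2)).
Qed.

Lemma odd_bin_addM x e w q : q < 2 ^ e -> odd 'C(x + 2 ^ e * w, q) = odd 'C(x, q).
Proof.
elim: e x w q => [|e IHe] x w q; first by case: q => //; rewrite !bin0.
move=> lt_q; rewrite odd_bin [RHS]odd_bin oddD oddM oddX /= addbF.
have -> : (x + 2 ^ e.+1 * w)./2 = x./2 + 2 ^ e * w.
  by rewrite expnS -mulnA mul2n halfD odd_double andbF add0n doubleK.
by rewrite IHe // -(ltn_pmul2l (isT : 0 < 2)) -expnS (leq_ltn_trans _ lt_q) // mul2n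
  -[X in _ <= X](odd_double_half q) leq_addl.
Qed.

Lemma odd_bin_pow v u : odd u -> odd 'C(2 ^ v * u, 2 ^ v).
Proof.
elim: v => [|v IHv] ou; first by rewrite mul1n bin1.
rewrite odd_bin oddX /= expnS -mulnA !mul2n !doubleK; exact: IHv.
Qed.

Lemma trinomial_revision B q j : 'C(B, q) * 'C(B - q, j) = 'C(B, j) * 'C(B - j, q).
Proof.
have [le|lt] := leqP (q + j) B; last first.
  have [lt1|le1] := ltnP B q.
    by rewrite (bin_small lt1) [in RHS](@bin_small (B - j)) ?muln0 //; lia.
  rewrite (@bin_small (B - q)) ?muln0 //; last by lia.
  have [lt1|le2] := ltnP B j; first by rewrite (bin_small lt1).
  by rewrite (@bin_small (B - j)) ?muln0 //; lia.
have f_gt0 : 0 < q`! * j`! * (B - q - j)`! by rewrite !muln_gt0 !fact_gt0.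
apply/eqP; rewrite -(eqn_pmul2r f_gt0); apply/eqP.
have e1 := @bin_fact B q; have e2 := @bin_fact (B - q) j.
have e3 := @bin_fact B j; have e4 := @bin_fact (B - j) q.
have {}e1 := e1 (leq_trans (leq_addr _ _) le).
have {}e3 := e3 (leq_trans (leq_addl _ _) le).
have {}e2 : 'C(B - q, j) * (j`! * (B - q - j)`!) = (B - q)`! by apply: e2; lia.
have {}e4 : 'C(B - j, q) * (q`! * (B - j - q)`!) = (B - j)`! by apply: e4; lia.
transitivity B`!; first by rewrite -e1 -e2; ring.
by rewrite -e3 -e4 (_ : B - j - q = B - q - j); [ring | lia].
Qed.

Lemma vandermonde_shift B q m G : q <= m -> m <= B ->
  \sum_(i < m.+1) 'C(B, i) * 'C(i, q) * 'C(G, m - i) = 'C(B, q) * 'C(B - q + G, m - q).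
Proof.
move=> le_q le_m.
rewrite -(big_mkord xpredT (fun i => 'C(B, i) * 'C(i, q) * 'C(G, m - i))).
rewrite (@big_cat_nat _ _ _ q) ?(leq_trans le_q) //= big_nat big1 ?add0n => [|i]; last first.
  by case/andP=> _ lt_i; rewrite (bin_small lt_i) muln0.
rewrite -{1}[q]add0n big_addn big_mkord -binomial.Vandermonde big_distrr /= subSn //.
apply: eq_bigr => i _; have lt_i : i <= m - q by rewrite -ltnS.
rewrite mulnA; congr (_ * 'C(_, _)); last by lia.
have le_B : i + q <= B by lia.
rewrite -(bin_sub le_B) -{2}(subKn le_B) trinomial_revision; congr (_ * _).
by rewrite -bin_sub; [congr 'C(_, _); lia | lia].
Qed.

Lemma even_neg_binomial N m :
  ~~ odd (\sum_(q < m.+2) 'C(N + (m.+1 - q), m.+1 - q) * 'C(N.+1, q)).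
Proof.
elim: N => [|N IHN].
  rewrite big_ord_recl big_ord_recl big1 ?addn0 => [|i _]; last first.
    by rewrite [X in _ * X]bin_small // muln0.
  by rewrite !add0n !binn bin0.
pose B := \sum_(q < m.+1) 'C(N.+1 + (m - q), m - q) * 'C(N.+1, q).
suff -> : \sum_(q < m.+2) 'C(N.+1 + (m.+1 - q), m.+1 - q) * 'C(N.+2, q) =
    \sum_(q < m.+2) 'C(N + (m.+1 - q), m.+1 - q) * 'C(N.+1, q) + (B + B).
  by rewrite oddD addnn odd_double addbF.
rewrite addnA; transitivity (\sum_(q < m.+2) 'C(N.+1 + (m.+1 - q), m.+1 - q) * 'C(N.+1, q) + B).
  rewrite big_ord_recl [in RHS]big_ord_recl -addnA !bin0; congr (_ + _).
  rewrite /B -big_split; apply: eq_bigr => i _ /=; rewrite /bump /= add1n binS mulnDr.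
  by rewrite subSS.
congr (_ + _); rewrite big_ord_recr [in RHS]big_ord_recr /= subnn !addn0 !bin0 addnAC.
congr (_ + _); rewrite /B -big_split; apply: eq_bigr => i _ /=.
have -> : m.+1 - i = (m - i).+1 by have := ltn_ord i; lia.
by rewrite [N.+1 + (m - i)]addSnnS addSn binS mulnDl.
Qed.

End BinomialParity.

Section BinaryDigits.
Local Open Scope nat_scope.

Lemma bitS x j : bit x j.+1 = bit x./2 j.
Proof. by rewrite /bit expnS divnMA divn2. Qed.

Lemma bit0 x : bit x 0 = odd x.
Proof. by rewrite /bit divn1. Qed.

Lemma contains2E x y : contains2 x y = odd 'C(x, y).
Proof.
apply/asboolP/idP; have [m] := ubnP y; elim: m x y => // m IHm x y lt_y.
  move=> xy; have [->|y_gt0] := posnP y; first by rewrite bin0.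
  rewrite odd_bin; apply/andP; split; first by apply/implyP; have := xy 0; rewrite !bit0.
  apply: IHm => [|j]; first by rewrite -divn2; lia.
  by rewrite -!bitS; apply: xy.
have [->|y_gt0] := posnP y; first by move=> _ j; rewrite /bit div0n.
rewrite odd_bin => /andP[/implyP o0 o1] [|j]; first by rewrite !bit0.
by rewrite !bitS; apply: (IHm _ _ _ o1); rewrite -divn2; lia.
Qed.

Lemma all_bits x m : all (bit x) (iota 0 m) = (2 ^ m %| x.+1).
Proof.
elim: m x => [|m IHm] x; first by rewrite dvd1n.
rewrite /= bit0 (iotaDl 1 0) all_map (eq_all (a2 := bit x./2)); last first.
  by move=> j /=; rewrite -bitS.
rewrite IHm expnS mulnC; case: (boolP (odd x)) => ox /=.
  have -> : x.+1 = (x./2).+1 * 2 by have := odd_double_half x; rewrite ox; lia.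
  by rewrite dvdn_pmul2r.
apply/esym/negbTE/negP => /(dvdn_trans (dvdn_mull _ (dvdnn 2))).
by rewrite dvdn2 /= ox.
Qed.

Definition good j g := exists2 e, j < 2 ^ e & 2 ^ e %| (j + g).+1.

Lemma good0 g : good 0 g. Proof. by exists 0; rewrite ?dvd1n. Qed.

Lemma two_compl_good j g : 0 < j -> two_compl j g <-> good j g.
Proof.
move=> j_gt0; rewrite /two_compl gtn_eqF // all_bits.
split=> [dv|[e lt_j dv]]; first by exists (trunc_log 2 j).+1; rewrite ?trunc_log_ltn.
apply: dvdn_trans dv; apply: dvdn_exp2l.
by rewrite -(ltn_exp2l _ _ (isT : 1 < 2)) (leq_ltn_trans _ lt_j) // trunc_logP.
Qed.

Lemma max_two_compl M g (j0 := \max_(j < M.+1 | two_compl j g) j) :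
  [/\ j0 <= M, good j0 g & forall j, j0 < j -> j <= M -> ~ good j g].
Proof.
have le_M : j0 <= M by apply/bigmax_leqP => j _; rewrite -ltnS.
split=> // [|j lt_j le_j gj].
  have [c0|] := posnP #|[pred j : 'I_M.+1 | two_compl j g]|.
    suff -> : j0 = 0 by exact: good0.
    by apply: big_pred0 => j; have := card0_eq c0 j; rewrite inE.
  move/(eq_bigmax_cond (fun j : 'I_M.+1 => j : nat)) => [j]; rewrite inE.
  move=> tj; rewrite -/j0 => ->; have [->|j_gt0] := posnP j; first exact: good0.
  exact/two_compl_good.
have j_gt0 : 0 < j by apply: leq_ltn_trans lt_j.
have tj := iffRL (two_compl_good g j_gt0) gj.
have := @leq_bigmax_cond _ (fun j : 'I_M.+1 => two_compl j g) (fun j => j : nat)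
  (Ordinal (le_j : j < M.+1)) tj.
by rewrite -/j0 /= leqNgt lt_j.
Qed.

Definition parity_rec g M (b : nat -> bool) := forall q B, q <= B -> B <= M ->
  odd 'C(B, q) && b (B - q) = odd 'C((B + g).+1, q) && b B.

Lemma contains_parity_rec g M j0 : good j0 g ->
  (forall j, j0 < j -> j <= M -> ~ good j g) ->
  parity_rec g M (fun h => odd 'C(h, j0)).
Proof.
move=> [e0 lt_j0 dv0] j0_max q B le_q le_B.
rewrite -oddM trinomial_revision oddM andbC; case: (boolP (odd 'C(B, j0))) => oB; last first.
  by rewrite !andbF.
rewrite !andbT; have le_j0 : j0 <= B.
  by rewrite leqNgt; apply/negP => lt; rewrite bin_small in oB.
suff [E lt_B dvE] : exists2 E, B < 2 ^ E & 2 ^ E %| (j0 + g).+1.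
  have -> : (B + g).+1 = B - j0 + (j0 + g).+1 by lia.
  by case/dvdnP: dvE => w ->; rewrite mulnC odd_bin_addM // (leq_ltn_trans le_q).
have step E : j0 < 2 ^ E -> 2 ^ E %| (j0 + g).+1 -> 2 ^ E <= B -> 2 ^ E.+1 %| (j0 + g).+1.
  move=> lt_j dvE le_E; case/dvdnP: (dvE) => w ew.
  have [ow|ew2] := boolP (odd w); last first.
    by rewrite ew expnS dvdn_mul // dvdn2.
  case: (j0_max (j0 + 2 ^ E)).
  - by rewrite -[X in X < _]addn0 ltn_add2l expn_gt0.
  - apply: leq_trans le_B; rewrite [B](divn_eq _ (2 ^ E)) addnC leq_add //.
      by rewrite leq_pmull // divn_gt0 ?expn_gt0.
    rewrite leqNgt; apply/negP => lt.
    move: oB; rewrite [B](divn_eq _ (2 ^ E)) addnC mulnC odd_bin_addM //.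
    by rewrite bin_small.
  exists E.+1; first by rewrite expnS mul2n -addnn ltn_add2r.
  have -> : (j0 + 2 ^ E + g).+1 = w.+1 * 2 ^ E by rewrite mulSn; move: ew; lia.
  by rewrite expnS dvdn_mul // dvdn2 /= ow.
have H m : (exists2 E, B < 2 ^ E & 2 ^ E %| (j0 + g).+1) \/
    exists E, [/\ m <= E, j0 < 2 ^ E & 2 ^ E %| (j0 + g).+1].
  elim: m => [|m [H|[E [le_m lt_E dvE]]]]; first by right; exists e0.
    by left.
  have [lt_B|le_E] := ltnP B (2 ^ E); first by left; exists E.
  right; exists E.+1; split=> //; last exact: step.
  by rewrite expnS mul2n -addnn ltn_addl.
have [//|[E [le_E _ dvE]]] := H B.
by exists E => //; apply: leq_ltn_trans le_E (ltn_expl _ _).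
Qed.

Lemma parity_rec_odd k M j0 : parity_rec k M./2 (fun h => odd 'C(h, j0)) ->
  parity_rec k.*2 M.+1 (fun h => odd h && odd 'C(h./2, j0)).
Proof.
move=> rec q B le_q le_B; rewrite odd_bin [odd 'C(_.+1, q)]odd_bin.
rewrite oddB //= oddD odd_double addbF.
have [oB|eB] /= := boolP (odd B); last first.
  by rewrite ?andbF; case: (odd q); rewrite /= ?andbF.
rewrite implybT; case: (boolP (odd q)) => oq /=; first by rewrite andbF.
have -> : (B - q)./2 = B./2 - q./2.
  have := odd_double_half B; have := odd_double_half q.
  have := odd_double_half (B - q); rewrite oddB // oB (negbTE oq) /=; lia.
have -> : uphalf (B + k.*2) = (B./2 + k).+1.
  have := odd_double_half B; rewrite uphalf_half oddD odd_double oB /=.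
  by rewrite halfD odd_double andbF add0n doubleK; lia.
apply: rec; first exact: half_leq.
have := odd_double_half B; rewrite oB; have := odd_double_half M; lia.
Qed.

End BinaryDigits.
Section BinomialRecursion.
Variables (K : fieldType) (K2 : 2%N \in [pchar K]).
Implicit Types (c : nat -> K) (g M : nat).

Lemma natr_odd m : m%:R = (odd m)%:R :> K.
Proof.
rewrite -[in LHS](odd_double_half m) -muln2 natrD natrM.
by rewrite (pcharf0 K2) mulr0 addr0.
Qed.

Lemma addrr2 (x : K) : x + x = 0.
Proof. by rewrite -mulr2n -mulr_natr (pcharf0 K2) mulr0. Qed.

Lemma oppr2 (x : K) : - x = x.
Proof. by apply/eqP; rewrite eq_sym -addr_eq0 addrr2. Qed.

Definition closed_rec g M c := forall q B, (q <= B)%N -> (B <= M)%N ->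
  'C(B, q)%:R * c (B - q)%N = 'C((B + g).+1, q)%:R * c B.

Definition sum_rec g M c := forall m B, (0 < m)%N -> (m <= B)%N -> (B <= M)%N ->
  \sum_(q < m.+1) ('C(B, q) * 'C(B + g + (m - q), m - q))%:R * c (B - q)%N = 0.

Lemma sum_neg_binomial N m : (0 < m)%N ->
  \sum_(q < m.+1) ('C(N + (m - q), m - q) * 'C(N.+1, q))%:R = 0 :> K.
Proof.
case: m => // m _; rewrite -natr_sum natr_odd.
by rewrite (negbTE (even_neg_binomial N m)).
Qed.

(* Both say that sum_q 'C(B, q) c(B - q) y^q agrees with c(B) (1 - y)^(B + g + 1)
   up to y^B. *)
Lemma sum_recP g M c : sum_rec g M c <-> closed_rec g M c.
Proof.
split=> [rec q B|rec m B m_gt0 le_m le_B]; last first.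
  transitivity (c B * \sum_(q < m.+1) ('C(B + g + (m - q), m - q) * 'C((B + g).+1, q))%:R).
    rewrite big_distrr /=; apply: eq_bigr => q _.
    have le_q : (q <= B)%N by rewrite (leq_trans _ le_m) // -ltnS.
    by rewrite natrM mulrAC rec // natrM; ring.
  by rewrite sum_neg_binomial // mulr0.
elim/ltn_ind: q => q IHq le_q le_B; have [->|q_gt0] := posnP q.
  by rewrite !bin0 subn0.
have := rec q B q_gt0 le_q le_B; rewrite big_ord_recr /= subnn bin0 muln1.
have := sum_neg_binomial (B + g) q_gt0; rewrite big_ord_recr /= subnn bin0 mul1n.
move/eqP; rewrite addr_eq0 oppr2 => /eqP <-.
move/eqP; rewrite addrC addr_eq0 oppr2 => /eqP ->.
rewrite big_distrl; apply: eq_bigr => i _ /=.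
rewrite natrM mulrAC IHq //; last exact: leq_trans (ltnW (ltn_ord i)) le_q.
by rewrite natrM; ring.
Qed.

Lemma closed_rec_parity g M (b : nat -> bool) :
  parity_rec g M b -> closed_rec g M (fun h => (b h)%:R).
Proof.
move=> rec q B le_q le_B; have := rec q B le_q le_B.
by rewrite (natr_odd 'C(B, q)) (natr_odd 'C(_, q)) -!natrM !mulnb => ->.
Qed.

Lemma closed_rec_eq0 g M c j0 : closed_rec g M c -> (j0 <= M)%N -> good j0 g ->
  (forall j, j0 < j -> j <= M -> ~ good j g)%N -> c j0 = 0 ->
  forall B, (B <= M)%N -> c B = 0.
Proof.
move=> rec le_j0 [e0 lt_j0 dv0] j0_max c_j0 B; elim/ltn_ind: B => B IHB le_B.
apply/eqP/negPn/negP => nz; case/negP: (nz); apply/eqP.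
pose N := (B + g).+1; pose v := logn 2 N.
have eN : N = (2 ^ v * (N %/ 2 ^ v))%N by rewrite mulnC divnK // pfactor_dvdnn.
have oddu : odd (N %/ 2 ^ v).
  apply/negPn/negP => ev; have : (2 ^ v.+1 %| N)%N.
    by rewrite [X in (_ %| X)%N]eN expnS mulnC dvdn_mul // dvdn2.
  by rewrite pfactor_dvdn // ltnn.
have lt_B : (B < 2 ^ v)%N.
  rewrite ltnNge; apply/negP => le_v.
  have := rec (2 ^ v)%N B le_v le_B; rewrite IHB; last 2 first.
  - by rewrite ltn_subrL expn_gt0 (leq_trans _ le_v) ?expn_gt0.
  - by rewrite (leq_trans (leq_subr _ _)).
  rewrite mulr0 -/N eN natr_odd odd_bin_pow // mul1r => /esym/eqP.
  by rewrite (negbTE nz).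
have gB : good B g by exists v => //; exact: pfactor_dvdnn.
have lt_Bj : (B < j0)%N.
  rewrite ltnNge leq_eqVlt; apply/negP => /orP[/eqP e|lt]; last exact: (j0_max B).
  by rewrite -e c_j0 eqxx in nz.
have le_v : (v <= e0)%N.
  rewrite leqNgt; apply/negP => lt_v.
  have dvB : (2 ^ e0 %| (B + g).+1)%N.
    by apply: dvdn_trans (pfactor_dvdnn 2 N); apply: dvdn_exp2l; exact: ltnW.
  have : (2 ^ e0 %| j0 - B)%N.
    by rewrite (_ : j0 - B = (j0 + g).+1 - (B + g).+1)%N ?dvdn_sub //; lia.
  by move/dvdn_leq; rewrite subn_gt0 => /(_ lt_Bj); lia.
have dvd_v : (2 ^ v %| j0 - B)%N.
  rewrite (_ : j0 - B = (j0 + g).+1 - (B + g).+1)%N; last by lia.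
  apply: dvdn_sub; last exact: pfactor_dvdnn.
  by apply: dvdn_trans dv0; apply: dvdn_exp2l.
have := rec (j0 - B)%N j0 (leq_subr _ _) le_j0.
rewrite c_j0 mulr0 subKn ?(ltnW lt_Bj) // bin_sub ?(ltnW lt_Bj) //.
rewrite (_ : 'C(j0, B)%:R = 1) ?mul1r //.
have -> : j0 = (B + 2 ^ v * ((j0 - B) %/ 2 ^ v))%N.
  by rewrite mulnC divnK // subnKC // ltnW.
by rewrite natr_odd odd_bin_addM // binn.
Qed.

End BinomialRecursion.

(** * Functionals on two-row tensors *)

Lemma prod_nseq (R : pzSemiRingType) (T : Type) (f : T -> R) r x :
  \prod_(y <- nseq r x) f y = f x ^+ r.
Proof. by rewrite big_nseq -Monoid.iteropE. Qed.

Section TwoRowFunctionals.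
Variables (K : fieldType) (n : nat).
Local Notation N := 'I_n.
Local Notation vec := (N -> K).
Implicit Types (s : seq (N * N)) (l ks : seq N) (p q : vec).

(* A tensor of pairs of vectors is handled through its pairings with products of
   2 x 2 minors of (p, q) and coordinates of p. *)
Definition minor (x : N * N) p q : K := p x.1 * q x.2 - p x.2 * q x.1.

Definition mono s l p q : K := (\prod_(x <- s) minor x p q) * \prod_(k <- l) p k.

Definition pairing (m : seq (K * (vec * vec))) (phi : vec -> vec -> K) : K :=
  \sum_(t <- m) t.1 * phi t.2.1 t.2.2.

Definition cnt s l k : nat :=
  (count_mem k (unzip1 s) + count_mem k (unzip2 s) + count_mem k l)%N.

Definition sbst (j j' : N) (z : K) p : vec := fun k => p k + (k == j)%:R * z * p j'.

Section Pairing.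
Variable m : seq (K * (vec * vec)).
Local Notation E := (pairing m).
Local Notation F := (fun s l => pairing m (mono s l)).

Lemma eq_pairing phi1 phi2 : (forall p q, phi1 p q = phi2 p q) -> E phi1 = E phi2.
Proof. by move=> e; apply: eq_bigr => t _; rewrite e. Qed.

Lemma pairingD phi1 phi2 : E (fun p q => phi1 p q + phi2 p q) = E phi1 + E phi2.
Proof. by rewrite -big_split; apply: eq_bigr => t _ /=; rewrite mulrDr. Qed.

Lemma pairingZ c phi : E (fun p q => c * phi p q) = c * E phi.
Proof. by rewrite /pairing big_distrr; apply: eq_bigr => t _ /=; rewrite mulrCA. Qed.

Lemma pairing_sum (I : finType) (P : pred I) (phi : I -> vec -> vec -> K) :
  E (fun p q => \sum_(i | P i) phi i p q) = \sum_(i | P i) E (phi i).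
Proof.
by rewrite exchange_big; apply: eq_bigr => t _ /=; rewrite big_distrr.
Qed.

Lemma pairing0 phi : (forall p q, phi p q = 0) -> E phi = 0.
Proof. by move=> e; apply: big1 => t _; rewrite e mulr0. Qed.

Lemma mono_perm s s' l l' : perm_eq s s' -> perm_eq l l' -> mono s l =2 mono s' l'.
Proof.
by move=> ps pl p q; rewrite /mono (perm_big s' ps) /= (perm_big l' pl).
Qed.

Lemma cnt_perm s s' l l' k : perm_eq s s' -> perm_eq l l' -> cnt s l k = cnt s' l' k.
Proof.
move=> ps pl; rewrite /cnt (seq.permP pl).
by rewrite (seq.permP (perm_map fst ps)) (seq.permP (perm_map snd ps)).
Qed.

Lemma mono_cat s1 s2 l1 l2 p q :
  mono (s1 ++ s2) (l1 ++ l2) p q = mono s1 l1 p q * mono s2 l2 p q.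
Proof. by rewrite /mono !big_cat /= mulrACA. Qed.

Lemma cnt_cat s1 s2 l1 l2 k : cnt (s1 ++ s2) (l1 ++ l2) k = (cnt s1 l1 k + cnt s2 l2 k)%N.
Proof. by rewrite /cnt /unzip1 /unzip2 !map_cat !count_cat; lia. Qed.

Lemma minor_flip i k p q : minor (i, k) p q = - minor (k, i) p q.
Proof. by rewrite /minor /= opprB. Qed.

Lemma minorii i p q : minor (i, i) p q = 0.
Proof. by rewrite /minor subrr. Qed.

Lemma minor_sbst j j' z i k p q : minor (i, k) (sbst j j' z p) (sbst j j' z q) =
  minor (i, k) p q + (i == j)%:R * z * minor (j', k) p q +
  (k == j)%:R * z * minor (i, j') p q.
Proof. by rewrite /minor /sbst /=; case: (i == j); case: (k == j); ring. Qed.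

Lemma pluecker o i k p q :
  minor (i, k) p q * p o = minor (o, k) p q * p i - minor (o, i) p q * p k.
Proof. by rewrite /minor /=; ring. Qed.

Definition row1 (o : N) ks : seq (N * N) := [seq (o, k) | k <- ks].

Section Determination.
Variables (o : N) (b e : nat).
Hypothesis F_low : forall s l, size s = b -> size l = e -> (cnt s l o < b)%N -> F s l = 0.
Hypothesis F_row1 : forall ks l, size ks = b -> size l = e -> F (row1 o ks) l = 0.

Lemma orient s : all (fun x => (x.1 == o) || (x.2 == o)) s ->
  exists ks c, size ks = size s /\ forall l p q, mono s l p q = c * mono (row1 o ks) l p q.
Proof.
elim: s => [|[i k] s IHs] /=; first by exists [::], 1; split=> // l p q; rewrite mul1r.
case/andP=> ik /IHs[ks [c [sz eq]]]; case/orP: ik => /eqP ->.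
  exists (k :: ks), c; split=> /= [|l p q]; first by rewrite sz.
  by move: (eq l p q); rewrite /mono /= !big_cons -!mulrA => ->; ring.
exists (i :: ks), (- c); split=> /= [|l p q]; first by rewrite sz.
by move: (eq l p q); rewrite /mono /= !big_cons minor_flip -!mulrA => ->; ring.
Qed.

Lemma determination s l : size s = b -> size l = e -> F s l = 0.
Proof.
have [m'] := ubnP (count (fun x : N * N => (x.1 != o) && (x.2 != o)) s).
elim: m' s l => // m' IHm s l lt_m ss sl.
have [al_o|] := boolP (all (fun x => (x.1 == o) || (x.2 == o)) s).
  have [ks [c [sz eq]]] := orient al_o.
  by rewrite (eq_pairing (eq l)) pairingZ F_row1 ?mulr0 // sz.
have [lt_o|ge_o] := ltnP (cnt s l o) b; first by move=> _; apply: F_low.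
have [oo|noo] := boolP ((o, o) \in s).
  move=> _; apply: pairing0 => p q; rewrite /mono (perm_big _ (perm_to_rem oo)) /=.
  by rewrite big_cons minorii !mul0r.
case/allPn => -[i k] ik; rewrite negb_or /= => /andP[ni nk].
have ps := perm_to_rem ik; set s' := rem (i, k) s in ps.
have ol : o \in l.
  rewrite -has_pred1 has_count.
  have H t : (o, o) \notin t ->
      (count_mem o (unzip1 t) + count_mem o (unzip2 t) <= size t)%N.
    elim: t => //= -[x y] t IHt; rewrite inE negb_or xpair_eqE => /andP[xy /IHt le] /=.
    by move: xy; rewrite (eq_sym o x) (eq_sym o y); case: (x == o); case: (y == o) => //=; lia.
  have := H s'; rewrite (contra (@mem_rem _ _ _ _)) // => /(_ isT) le.
  move: ge_o; rewrite (cnt_perm o ps (perm_refl l)) /cnt /= (negbTE ni) (negbTE nk) /=.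
  move: ss; rewrite (perm_size ps) /= !add0n => <- ge; rewrite lt0n.
  by apply/eqP => c0; move: ge; rewrite c0 addn0 => ge; have := leq_trans ge le; rewrite ltnn.
have pl := perm_to_rem ol; set l' := rem o l in pl.
have ss' : (size s').+1 = b by rewrite -ss (perm_size ps).
have sl' : (size l').+1 = e by rewrite -sl (perm_size pl).
rewrite (eq_pairing (mono_perm ps pl)).
rewrite (eq_pairing (phi2 := fun p q =>
   mono ((o, k) :: s') (i :: l') p q + (-1) * mono ((o, i) :: s') (k :: l') p q)); last first.
  move=> p q; rewrite /mono !big_cons.
  transitivity (minor (i, k) p q * p o *
     ((\prod_(x <- s') minor x p q) * (\prod_(x <- l') p x))); first by ring.
  by rewrite pluecker; ring.
have lt_m' : (count (fun x : N * N => (x.1 != o) && (x.2 != o)) s' < m')%N.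
  by move: lt_m; rewrite (seq.permP ps) /= ni nk; lia.
by rewrite pairingD pairingZ !IHm /= ?eqxx ?ss' ?sl' ?mulr0 ?addr0.
Qed.

End Determination.

(* A condition on contents that is stable under replacing a letter j by j' can be
   checked before the substitution. *)
Lemma sbst_content (Q : (N -> nat) -> Prop) (j j' : N) z b e :
  (forall f h, Q f -> (forall k, f k + (k == j') = h k + (k == j))%N -> Q h) ->
  (forall f h, Q f -> f =1 h -> Q h) ->
  (forall s l, size s = b -> size l = e -> Q (cnt s l) -> F s l = 0) ->
  forall s l, size s = b -> size l = e -> Q (cnt s l) ->
    E (fun p q => mono s l (sbst j j' z p) (sbst j j' z q)) = 0.
Proof.
move=> Qmove Qext F0.
suff H s2 l2 s1 l1 : (size s1 + size s2 = b)%N -> (size l1 + size l2 = e)%N ->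
    Q (fun k => cnt s1 l1 k + cnt s2 l2 k)%N ->
    E (fun p q => mono s1 l1 p q * mono s2 l2 (sbst j j' z p) (sbst j j' z q)) = 0.
  move=> s l ss sl Qs; rewrite -(H s l [::] [::]) //.
    by apply: eq_pairing => p q; rewrite {2}/mono !big_nil !mul1r.
elim: s2 l2 s1 l1 => [|[i k] s2 IHs] l2 s1 l1.
  elim: l2 l1 => [|k l2 IHl] l1 ss sl Qs.
    rewrite (eq_pairing (phi2 := mono s1 l1)); last first.
      by move=> p q; rewrite {2}/mono !big_nil !mulr1.
    apply: F0; first by move: ss; rewrite /= addn0.
      by move: sl; rewrite /= addn0.
    by apply: Qext Qs _ => k; rewrite addn0.
  rewrite (eq_pairing (phi2 := fun p q =>
     mono s1 (k :: l1) p q * mono [::] l2 (sbst j j' z p) (sbst j j' z q) +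
     (k == j)%:R * z *
     (mono s1 (j' :: l1) p q * mono [::] l2 (sbst j j' z p) (sbst j j' z q)))); last first.
    by move=> p q; rewrite /mono !big_nil !big_cons {1}/sbst; ring.
  have sl' : (size (k :: l1) + size l2 = e)%N by move: sl => /=; lia.
  rewrite pairingD pairingZ IHl //; last first.
    by apply: Qext Qs _ => x; rewrite /cnt /=; lia.
  case: (k =P j) => [kj|_]; last by rewrite !mul0r addr0.
  rewrite IHl ?mulr0 ?addr0 //; apply: Qmove Qs _ => x.
  by rewrite /cnt /= kj !(eq_sym _ x); lia.
move=> ss sl Qs; rewrite (eq_pairing (phi2 := fun p q =>
     mono ((i, k) :: s1) l1 p q * mono s2 l2 (sbst j j' z p) (sbst j j' z q) +
     (i == j)%:R * z *
     (mono ((j', k) :: s1) l1 p q * mono s2 l2 (sbst j j' z p) (sbst j j' z q)) +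
     (k == j)%:R * z *
     (mono ((i, j') :: s1) l1 p q * mono s2 l2 (sbst j j' z p) (sbst j j' z q)))); last first.
  by move=> p q; rewrite /mono !big_cons minor_sbst; ring.
have ss' : ((size s1).+1 + size s2 = b)%N by move: ss => /=; lia.
rewrite !pairingD !pairingZ IHs //; last by apply: Qext Qs _ => x; rewrite /cnt /=; lia.
case: (i =P j) => [ij|_]; case: (k =P j) => [kj|_];
  rewrite ?(mul0r, addr0) ?IHs ?(mulr0, addr0) //; apply: Qmove Qs _ => x;
  by rewrite /cnt /= ?ij ?kj !(eq_sym x); lia.
Qed.

End Pairing.
Lemma count_nseq_eq (T : eqType) (x y : T) r : count_mem x (nseq r y) = ((y == x) * r)%N.
Proof. by rewrite count_nseq. Qed.

Lemma sum_low_degree (f : nat -> nat -> K) r t :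
  (forall i k, (1 < i + k)%N -> f i k = 0) ->
  \sum_(i < r.+1) \sum_(k < t.+1) f i k =
  f 0%N 0%N + ((0 < r)%N%:R * f 1%N 0%N + (0 < t)%N%:R * f 0%N 1%N).
Proof.
move=> f0.
have row0 : \sum_(k < t.+1) f 0%N k = f 0%N 0%N + (0 < t)%N%:R * f 0%N 1%N.
  rewrite big_ord_recl /=; congr (_ + _); case: t => [|t]; first by rewrite big_ord0 mul0r.
  by rewrite big_ord_recl big1 ?addr0 ?mul1r // => i _; apply: f0.
have row1' : \sum_(k < t.+1) f 1%N k = f 1%N 0%N.
  by rewrite big_ord_recl big1 ?addr0 // => i _; apply: f0.
rewrite big_ord_recl row0 -addrA; congr (_ + _); rewrite addrC; congr (_ + _).
case: r => [|r]; first by rewrite big_ord0 mul0r.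
rewrite big_ord_recl row1' mul1r big1 ?addr0 // => i _.
by apply: big1 => k _; apply: f0.
Qed.

Section Weighted.
Variables (m : seq (K * (vec * vec))) (a b d : nat) (o1 o2 : N).
Local Notation E := (pairing m).
Local Notation F := (fun s l => pairing m (mono s l)).
Local Notation g := (a - b)%N.
Local Notation e := (a - b + d)%N.

Definition lw (k : N) : nat := nth 0%N (lam a b d) k.

Hypotheses (o1E : o1 = 0%N :> nat) (o2E : o2 = 1%N :> nat).
Hypotheses (le_ba : (b <= a)%N) (b_gt0 : (0 < b)%N).
Hypothesis F_wt : forall s l k, size s = b -> size l = e -> cnt s l k <> lw k -> F s l = 0.

Lemma lw_o1 : lw o1 = a. Proof. by rewrite /lw o1E. Qed.

Lemma lw_o2 : lw o2 = b. Proof. by rewrite /lw o2E. Qed.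

Lemma o12 : (o1 == o2) = false. Proof. by rewrite -val_eqE /= o1E o2E. Qed.

Lemma lw_le1 k : k != o1 -> k != o2 -> (lw k <= 1)%N.
Proof.
rewrite -!val_eqE /= o1E o2E /lw; case: (nat_of_ord k) => [|[|i]] //= _ _.
by rewrite nth_nseq; case: ifP.
Qed.

Lemma perm_letter (j : N) ks : exists r ks', [/\ perm_eq ks (nseq r j ++ ks'),
  j \notin ks', r = count_mem j ks & {subset ks' <= ks}].
Proof.
exists (count_mem j ks), [seq k <- ks | k != j]; split=> //.
- apply/allP => x _ /=; apply/eqP; rewrite count_cat count_nseq_eq count_filter.
  have [->|xj] := eqVneq j x.
    rewrite mul1n -[LHS]addn0; congr (_ + _)%N.
    by rewrite (eq_count (a2 := pred0)) ?count_pred0 // => y /=; case: eqP.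
  rewrite mul0n add0n; apply: eq_count => y /=.
  by case: (y =P x) => // ->; rewrite eq_sym xj.
- by rewrite mem_filter eqxx.
by move=> x; rewrite mem_filter => /andP[].
Qed.

Lemma cnt_row1 o ks l k :
  cnt (row1 o ks) l k = ((o == k) * size ks + count_mem k ks + count_mem k l)%N.
Proof.
rewrite /cnt /row1 /unzip1 /unzip2 -!map_comp; congr (_ + _ + _)%N.
  by elim: ks => [|x ks /= ->]; rewrite ?muln0 //= mulnS.
by congr (count _ _); rewrite -[RHS]map_id; apply: eq_map.
Qed.

Lemma mono_row1_o1 ks l p q : o1 \in ks -> mono (row1 o1 ks) l p q = 0.
Proof.
move=> ok; rewrite /mono /row1 big_map (perm_big _ (perm_to_rem ok)) /= big_cons.
by rewrite minorii !mul0r.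
Qed.

Definition fit (s : seq (N * N)) (l : seq N) := [/\ size s = b, size l = e &
  forall k, cnt s l k = lw k].

Lemma F_unfit s l : size s = b -> size l = e -> ~ fit s l -> F s l = 0.
Proof.
move=> ss sl nf; have [k /eqP ne|all_eq] := pickP (fun k => cnt s l k != lw k).
  exact: F_wt ne.
by case: nf; split=> // k; apply/eqP; rewrite -[_ == _]negbK all_eq.
Qed.

Lemma row1_cat o ks1 ks2 : row1 o (ks1 ++ ks2) = row1 o ks1 ++ row1 o ks2.
Proof. exact: map_cat. Qed.

Section OtherLetters.
Variables (j j' : N).
Hypotheses (nj : j != o1) (nj' : j' != o1) (njj' : j != j') (le1 : (lw j' <= 1)%N).

Lemma sbst_row1 z r t ks0 l0 p q : j \notin ks0 -> j \notin l0 ->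
  mono (row1 o1 (nseq r j ++ ks0)) (nseq t j ++ l0) (sbst j j' z p) (sbst j j' z q) =
  (minor (o1, j) p q + z * minor (o1, j') p q) ^+ r * (p j + z * p j') ^+ t *
  mono (row1 o1 ks0) l0 p q.
Proof.
move=> nk nl; rewrite row1_cat mono_cat; congr (_ * _).
  rewrite /mono /row1 big_map !big_nseq -!Monoid.iteropE; congr (_ ^+ _ * _ ^+ _).
    by rewrite minor_sbst (eq_sym o1) (negbTE nj) eqxx !mul0r addr0 mul1r.
  by rewrite /sbst eqxx mul1r.
rewrite /mono /row1 !big_map; congr (_ * _); apply: eq_big_seq => k kin.
  rewrite minor_sbst (eq_sym o1) (negbTE nj).
  have /negbTE-> : k != j by apply: contraNneq nk => <-.
  by rewrite !mul0r !addr0.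
have /negbTE nkj : k != j by apply: contraNneq nl => <-.
by rewrite /sbst nkj !mul0r addr0.
Qed.

(* Only the terms of degree at most one in z have a content that is not too
   large at j'. *)
Lemma pairing_sbst_row1 z r t ks0 l0 : j \notin ks0 -> j \notin l0 ->
  size (nseq r j ++ ks0) = b -> size (nseq t j ++ l0) = e ->
  E (fun p q => mono (row1 o1 (nseq r j ++ ks0)) (nseq t j ++ l0)
       (sbst j j' z p) (sbst j j' z q)) =
  F (row1 o1 (nseq r j ++ ks0)) (nseq t j ++ l0) +
  z * (r%:R * F (row1 o1 (nseq r.-1 j ++ j' :: ks0)) (nseq t j ++ l0) +
       t%:R * F (row1 o1 (nseq r j ++ ks0)) (nseq t.-1 j ++ j' :: l0)).
Proof.
move=> nk nl sk sl.
pose f i k := ('C(r, i) * 'C(t, k))%:R * z ^+ (i + k) *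
  F (row1 o1 (nseq (r - i) j ++ nseq i j' ++ ks0))
    (nseq (t - k) j ++ nseq k j' ++ l0).
transitivity (\sum_(i < r.+1) \sum_(k < t.+1) f i k).
  transitivity (E (fun p q => \sum_(i < r.+1) \sum_(k < t.+1)
    ('C(r, i) * 'C(t, k))%:R * z ^+ (i + k) *
    mono (row1 o1 (nseq (r - i) j ++ nseq i j' ++ ks0))
     (nseq (t - k) j ++ nseq k j' ++ l0) p q)).
    apply: eq_pairing => p q.
    rewrite sbst_row1 // !exprDn big_distrlr /= big_distrl.
    apply: eq_bigr => x _ /=; rewrite big_distrl; apply: eq_bigr => y _ /=.
    rewrite -[_ *+ 'C(r, x)]mulr_natl -[_ *+ 'C(t, y)]mulr_natl.
    rewrite !row1_cat !mono_cat.
    have -> r0 t0 i : mono (row1 o1 (nseq r0 i)) (nseq t0 i) p q =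
        minor (o1, i) p q ^+ r0 * p i ^+ t0.
      by rewrite /mono /row1 big_map !big_nseq -!Monoid.iteropE.
    have -> : mono (row1 o1 (nseq x j')) (nseq y j') p q =
        minor (o1, j') p q ^+ x * p j' ^+ y.
      by rewrite /mono /row1 big_map !big_nseq -!Monoid.iteropE.
    by rewrite natrM !exprMn exprD; ring.
  rewrite pairing_sum; apply: eq_bigr => x _; rewrite pairing_sum.
  by apply: eq_bigr => y _; rewrite pairingZ.
rewrite sum_low_degree => [|i k lt]; last first.
  rewrite /f; have [lt_r|le_r] := ltnP r i; first by rewrite (bin_small lt_r) !mul0r.
  have [lt_t|le_t] := ltnP t k; first by rewrite (bin_small lt_t) muln0 !mul0r.
  rewrite (@F_wt _ _ j') ?mulr0 //.
  - by rewrite size_map !size_cat !size_nseq; move: sk; rewrite size_cat size_nseq; lia.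
  - by rewrite !size_cat !size_nseq; move: sl; rewrite size_cat size_nseq; lia.
  by rewrite cnt_row1 !count_cat !count_nseq_eq eqxx; move: le1; lia.
rewrite /f !bin0 !subn0 !subn1 !mul1r; congr (_ + _); rewrite mulrDr; congr (_ + _).
  case: (posnP r) => [->|r_gt0]; first by rewrite !mul0r mulr0.
  by rewrite bin1 muln1 addn0 expr1 !mulrA /=; ring.
case: (posnP t) => [->|t_gt0]; first by rewrite !mul0r mulr0.
by rewrite bin1 mul1n add0n expr1 !mulrA /=; ring.
Qed.

End OtherLetters.

Definition closed_form (cc : nat -> K) := forall ks l, o1 \notin ks ->
  fit (row1 o1 ks) l -> F (row1 o1 ks) l = cc (b - count_mem o2 ks)%N.

Definition step_rec (cc : nat -> K) := forall t, (t <= b)%N -> (t < d)%N ->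
  (b - t)%:R * cc t.+1 + t.+1%:R * cc t = 0.

Lemma lw_succ (j j' : N) : j' = j.+1 :> nat -> j != o1 -> j != o2 -> (lw j' <= lw j)%N.
Proof.
rewrite -!val_eqE /= o1E o2E /lw => ->; case: (nat_of_ord j) => [|[|i]] //= _ _.
by rewrite !nth_nseq; case: ifP => // lt; rewrite (ltn_trans _ lt).
Qed.

Lemma sbst_fixed (j j' : N) z : (forall s l, size s = b -> size l = e ->
    (cnt s l o1 < b)%N -> F s l = 0) -> j' != o1 ->
  (forall ks l, size ks = b -> size l = e ->
    E (fun p q => mono (row1 o1 ks) l (sbst j j' z p) (sbst j j' z q)) =
    F (row1 o1 ks) l) ->
  forall s l, size s = b -> size l = e ->
    E (fun p q => mono s l (sbst j j' z p) (sbst j j' z q)) = F s l.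
Proof.
move=> F_low nj' inv s l ss sl.
pose m' := [seq (t.1, (sbst j j' z t.2.1, sbst j j' z t.2.2)) | t <- m] ++
  [seq (- t.1, t.2) | t <- m].
have m'E phi : pairing m' phi = E (fun p q => phi (sbst j j' z p) (sbst j j' z q)) - E phi.
  rewrite /pairing big_cat !big_map; congr (_ + _); rewrite -sumrN.
  by apply: eq_bigr => t _; rewrite mulNr.
apply/eqP; rewrite -subr_eq0 -m'E; apply/eqP.
apply: (determination (o := o1) (b := b) (e := e)) => // {ss sl}s' l' ss sl; last first.
  by rewrite m'E inv ?subrr.
move=> lt; rewrite m'E [X in _ - X]F_low // subr0.
apply: (sbst_content (Q := fun f => (f o1 < b)%N) z _ _ _ ss sl lt) => //.
- move=> f h lt_f /(_ o1); rewrite (eq_sym o1) (negbTE nj') addn0 => eq_f.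
  by apply: leq_ltn_trans lt_f; rewrite eq_f leq_addr.
- by move=> f h lt_f eq_f; rewrite -eq_f.
Qed.

Lemma F_low s l : size s = b -> size l = e -> (cnt s l o1 < b)%N -> F s l = 0.
Proof.
move=> ss sl lt; apply: (F_wt (k := o1)) => // eq_a; move: lt.
by rewrite eq_a lw_o1 ltnNge le_ba.
Qed.

Section CharTwo.
Hypothesis K2 : 2%N \in [pchar K].
Variable cc : nat -> K.
Hypothesis F_cc : closed_form cc.

Lemma other_letters_bracket (j j' : N) r t ks0 l0 : step_rec cc ->
  j' = j.+1 :> nat -> j != o1 -> j \notin ks0 -> j \notin l0 -> o1 \notin ks0 ->
  size (nseq r j ++ ks0) = b -> size (nseq t j ++ l0) = e ->
  r%:R * F (row1 o1 (nseq r.-1 j ++ j' :: ks0)) (nseq t j ++ l0) +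
  t%:R * F (row1 o1 (nseq r j ++ ks0)) (nseq t.-1 j ++ j' :: l0) = 0.
Proof.
move=> rec j'E nj njk njl no1 sk sl.
have nj' : j' != o1 by rewrite -val_eqE /= j'E o1E.
have nj'2 : j' != o2.
  by apply: contraNneq nj => e2; rewrite -val_eqE /= o1E; move: j'E; rewrite e2 o2E => -[<-].
have njj' : j != j' by rewrite -val_eqE /= j'E neq_ltn ltnSn.
have sk1 : (0 < r)%N -> size (row1 o1 (nseq r.-1 j ++ j' :: ks0)) = b.
  by move=> r0; move: sk; rewrite size_map !size_cat !size_nseq /=; lia.
have sl1 : (0 < t)%N -> size (nseq t.-1 j ++ j' :: l0) = e.
  by move=> t0; move: sl; rewrite !size_cat !size_nseq /=; lia.
have srk : size (row1 o1 (nseq r j ++ ks0)) = b by rewrite size_map.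
pose P := forall k, (cnt (row1 o1 (nseq r j ++ ks0)) (nseq t j ++ l0) k + (k == j') =
   lw k + (k == j))%N.
have c1 k : (0 < r)%N -> (cnt (row1 o1 (nseq r.-1 j ++ j' :: ks0)) (nseq t j ++ l0) k + (k == j) =
   cnt (row1 o1 (nseq r j ++ ks0)) (nseq t j ++ l0) k + (k == j'))%N.
  move=> r0; rewrite !cnt_row1 !count_cat !count_nseq_eq -(size_map (pair o1)).
  rewrite -/(row1 o1 _) (sk1 r0) sk /= !(eq_sym k) -{2}(prednK r0) mulnS; ring.
have c2 k : (0 < t)%N -> (cnt (row1 o1 (nseq r j ++ ks0)) (nseq t.-1 j ++ j' :: l0) k + (k == j) =
   cnt (row1 o1 (nseq r j ++ ks0)) (nseq t j ++ l0) k + (k == j'))%N.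
  move=> t0; rewrite !cnt_row1 !count_cat !count_nseq_eq /= !(eq_sym k).
  rewrite -{2}(prednK t0) mulnS; ring.
have [PP|nP] := EM P; last first.
  have R1 : r%:R * F (row1 o1 (nseq r.-1 j ++ j' :: ks0)) (nseq t j ++ l0) = 0.
    have [->|r0] := posnP r; first by rewrite mul0r.
    rewrite F_unfit ?mulr0 ?sk1 // => -[_ _ wt]; apply: nP => k.
    by rewrite -c1 // wt.
  rewrite R1 add0r; have [->|t0] := posnP t; first by rewrite mul0r.
  rewrite F_unfit ?mulr0 ?sl1 // => -[_ _ wt]; apply: nP => k.
  by rewrite -c2 // wt.
have o1nseq u : o1 \notin nseq u j by rewrite mem_nseq eq_sym (negbTE nj) andbF.
have E1 : r%:R * F (row1 o1 (nseq r.-1 j ++ j' :: ks0)) (nseq t j ++ l0) =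
    r%:R * cc (b - count_mem o2 (nseq r.-1 j ++ j' :: ks0))%N.
  have [->|r0] := posnP r; first by rewrite !mul0r.
  rewrite F_cc //; first by rewrite mem_cat inE !negb_or o1nseq eq_sym nj'.
  split=> // [|k]; first exact: sk1.
  by have := c1 k r0; rewrite PP => /addIn.
have E2 : t%:R * F (row1 o1 (nseq r j ++ ks0)) (nseq t.-1 j ++ j' :: l0) =
    t%:R * cc (b - count_mem o2 (nseq r j ++ ks0))%N.
  have [->|t0] := posnP t; first by rewrite !mul0r.
  rewrite F_cc //; first by rewrite mem_cat negb_or o1nseq.
  split=> // [|k]; first exact: sl1.
  by have := c2 k t0; rewrite PP => /addIn.
have Pj := PP j; rewrite eqxx (negbTE njj') addn0 addn1 cnt_row1 eq_sym (negbTE nj) in Pj.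
rewrite !count_cat !count_nseq_eq eqxx (count_memPn njk) (count_memPn njl) in Pj.
rewrite E1 E2 !count_cat !count_nseq_eq /= (negbTE nj'2) add0n.
have [j2|nj2] := eqVneq j o2; last first.
  rewrite !mul0n !add0n -mulrDl -natrD.
  have -> : (r + t)%N = 2%N.
    have := PP j'; rewrite eqxx eq_sym (negbTE njj') addn0 addn1.
    by have := lw_succ j'E nj nj2; have := lw_le1 nj nj2; clear -Pj; lia.
  by rewrite (natr_odd K2) mul0r.
have n2 : count_mem o2 ks0 = 0%N by apply/count_memPn; rewrite -j2.
rewrite n2 !mul1n !addn0.
have er : (r + t = b.+1)%N by move: Pj; rewrite j2 lw_o2 => Pj; clear -Pj; lia.
have le_r : (r <= b)%N by rewrite -sk size_cat size_nseq leq_addr.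
have lt_d : (b - r < d)%N.
  have := PP o1; rewrite (eq_sym o1 j) (negbTE nj) eq_sym (negbTE nj') !addn0 lw_o1.
  rewrite cnt_row1 eqxx !count_cat !count_nseq_eq (negbTE nj) (count_memPn no1) sk.
  rewrite mul1n !mul0n !add0n addn0 => co1.
  have cs : (count_mem o1 l0 <= size l0)%N by exact: count_size.
  move: sl co1 cs; rewrite size_cat size_nseq; move: (count_mem o1 l0) (size l0) => c s'.
  by clear -le_ba er le_r; lia.
have := rec (b - r)%N (leq_subr _ _) lt_d; rewrite subKn //.
have -> : (b - r).+1 = t by lia.
have [->|r0] := posnP r; first by rewrite !mul0r.
by have -> : (b - r.-1)%N = t by lia.
Qed.

Lemma other_letters_invariant (j j' : N) z : step_rec cc ->
  j' = j.+1 :> nat -> j != o1 -> forall s l, size s = b -> size l = e ->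
  E (fun p q => mono s l (sbst j j' z p) (sbst j j' z q)) = F s l.
Proof.
move=> rec j'E nj; have nj' : j' != o1 by rewrite -val_eqE /= j'E o1E.
apply: sbst_fixed => //; first exact: F_low.
move=> ks l sk sl.
have [r [ks0 [pk njk _ subk]]] := perm_letter j ks.
have [t [l0 [pl njl _ _]]] := perm_letter j l.
have prow : perm_eq (row1 o1 ks) (row1 o1 (nseq r j ++ ks0)) by apply: perm_map.
have e1 := mono_perm prow pl.
have -> : F (row1 o1 ks) l = F (row1 o1 (nseq r j ++ ks0)) (nseq t j ++ l0).
  exact: eq_pairing.
transitivity (E (fun p q => mono (row1 o1 (nseq r j ++ ks0)) (nseq t j ++ l0)
  (sbst j j' z p) (sbst j j' z q))).
  by apply: eq_pairing => p q; rewrite e1.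
have njj' : j != j' by rewrite -val_eqE /= j'E neq_ltn ltnSn.
have le1 : (lw j' <= 1)%N.
  apply: lw_le1 => //; apply: contraNneq nj => e2.
  by rewrite -val_eqE /= o1E; move: j'E; rewrite e2 o2E => -[<-].
have sk' : size (nseq r j ++ ks0) = b by rewrite -(perm_size pk).
have sl' : size (nseq t j ++ l0) = e by rewrite -(perm_size pl).
rewrite pairing_sbst_row1 //.
have [no1|o1in] := boolP (o1 \notin ks0).
  by rewrite other_letters_bracket // mulr0 addr0.
have z0 (s0 l1 : seq N) : o1 \in s0 -> F (row1 o1 s0) l1 = 0.
  by move=> os; apply: pairing0 => p q; rewrite mono_row1_o1.
rewrite negbK in o1in.
by rewrite !z0 ?mem_cat ?inE ?o1in ?orbT // !(mulr0, addr0).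
Qed.

Lemma pascal_sum (f : nat -> K) r :
  \sum_(i < r.+2) 'C(r.+1, i)%:R * f i =
  \sum_(i < r.+1) 'C(r, i)%:R * f i + \sum_(i < r.+1) 'C(r, i)%:R * f i.+1.
Proof.
rewrite big_ord_recl !bin0 mul1r.
under eq_bigr => i _ do rewrite lift0 binS natrD mulrDl.
rewrite big_split /= addrA; congr (_ + _).
rewrite [RHS]big_ord_recl bin0 mul1r; congr (_ + _).
by rewrite big_ord_recr /= bin_small // mul0r addr0.
Qed.

(* The coordinate at a configuration with i columns (2, x), in terms of those
   whose two-box columns all contain 1. *)
Definition mixed i w : K := \sum_(q < i.+1) 'C(i, q)%:R * cc (w - q)%N.

Lemma mixedS i w : mixed i.+1 w = mixed i w + mixed i w.-1.
Proof.
rewrite /mixed (pascal_sum (fun i0 : nat => cc (w - i0)%N)); congr (_ + _).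
by apply: eq_bigr => q _; congr (_ * cc _); lia.
Qed.

Lemma cnt_rows A Bk l k : cnt (row1 o2 A ++ row1 o1 Bk) l k =
  ((o2 == k) * size A + count_mem k A + ((o1 == k) * size Bk + count_mem k Bk) +
   count_mem k l)%N.
Proof.
by rewrite -[l]cat0s cnt_cat !cnt_row1 /= addn0 !addnA.
Qed.

Lemma F_mixed A Bk l : o1 \notin A -> o2 \notin A -> o1 \notin Bk ->
  fit (row1 o2 A ++ row1 o1 Bk) l ->
  F (row1 o2 A ++ row1 o1 Bk) l = mixed (size A) (b - count_mem o2 Bk)%N.
Proof.
elim: A Bk l => [|k A IHA] Bk l.
  move=> _ _ nB ft; rewrite /= F_cc // /mixed big_ord_recl big_ord0.
  by rewrite bin0 mul1r subn0 addr0.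
rewrite !inE !negb_or => /andP[nk nA] /andP[nk2 nA2] nB [ss sl wt].
have ol : o1 \in l.
  rewrite -has_pred1 has_count lt0n; apply/eqP => c0.
  have := wt o1; rewrite cnt_rows c0 (count_memPn nB) lw_o1 eqxx eq_sym o12.
  rewrite /= eq_sym (negbTE nk) (count_memPn nA) mul0n mul1n !addn0 add0n => ea.
  by move: ss; rewrite size_cat !size_map /= ea => eb; move: le_ba; rewrite -eb; lia.
have pl := perm_to_rem ol; set l' := rem o1 l in pl.
rewrite (@eq_pairing m _ (fun p q =>
   mono (row1 o2 A ++ row1 o1 (k :: Bk)) (o2 :: l') p q + (-1) *
   mono (row1 o2 A ++ row1 o1 (o2 :: Bk)) (k :: l') p q)); last first.
  move=> p q; rewrite (mono_perm (perm_refl _) pl) /mono !big_cat /= !big_cons.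
  set f1 := \prod_(x <- row1 o2 A) _; set f2 := \prod_(x <- row1 o1 Bk) _.
  set f3 := \prod_(x <- l') _.
  transitivity (minor (o2, k) p q * p o1 * (f1 * f2 * f3)); first by ring.
  by rewrite pluecker; ring.
have szl : (size l').+1 = e by rewrite -sl (perm_size pl).
have szs : (size A + (size Bk).+1)%N = b by rewrite -ss size_cat !size_map addnS.
have cl x : count_mem x l = ((o1 == x) + count_mem x l')%N by rewrite (seq.permP pl).
rewrite pairingD pairingZ mulN1r (oppr2 K2).
have F1 : F (row1 o2 A ++ row1 o1 (k :: Bk)) (o2 :: l') =
    mixed (size A) (b - count_mem o2 (k :: Bk))%N.
  apply: IHA => //; first by rewrite inE negb_or nk nB.
  split=> [||x]; first by rewrite size_cat !size_map.
    by rewrite /= szl.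
  by rewrite -wt !cnt_rows cl /= !mulnS; ring.
have F2 : F (row1 o2 A ++ row1 o1 (o2 :: Bk)) (k :: l') =
    mixed (size A) (b - count_mem o2 (o2 :: Bk))%N.
  apply: IHA => //; first by rewrite inE negb_or o12 nB.
  split=> [||x]; first by rewrite size_cat !size_map.
    by rewrite /= szl.
  by rewrite -wt !cnt_rows cl /= !mulnS; ring.
rewrite F1 F2.
rewrite mixedS /= eq_sym (negbTE nk2) eqxx add0n.
by congr (_ + mixed _ _); lia.
Qed.

Definition shifted z A Bk R P l0 : K :=
  E (fun p q => mono (row1 o2 A ++ row1 o1 Bk) l0 p q *
    (\prod_(k <- R) (minor (o1, k) p q + z * minor (o2, k) p q)) *
    (p o1 + z * p o2) ^+ P).

Section Shift.
Variable mu : nat.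
Local Notation gm := (a - b + mu)%N.

Definition coefV w al r : K := \sum_(i < r.+1) 'C(r, i)%:R *
  (if (al + i <= mu)%N then 'C(gm, mu - (al + i))%:R * mixed (al + i) w else 0).

Lemma coefVS w al r : coefV w al r.+1 = coefV w al r + coefV w al.+1 r.
Proof.
rewrite /coefV (pascal_sum (fun i => if (al + i <= mu)%N
  then 'C(gm, mu - (al + i))%:R * mixed (al + i) w else 0)); congr (_ + _).
by apply: eq_bigr => i _; rewrite addSnnS.
Qed.

Lemma shifted_eval z A Bk R l0 : o1 \notin A -> o2 \notin A -> o1 \notin Bk ->
  o1 \notin R -> o2 \notin R -> o1 \notin l0 ->
  (size A + size Bk + size R = b)%N -> (gm + size l0 = e)%N ->
  (count_mem o2 Bk + count_mem o2 l0 + mu = b)%N ->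
  (forall k, k != o1 -> k != o2 ->
    count_mem k A + count_mem k Bk + count_mem k R + count_mem k l0 = lw k)%N ->
  z ^+ size A * shifted z A Bk R gm l0 =
  z ^+ mu * coefV (b - count_mem o2 Bk)%N (size A) (size R).
Proof.
elim: R A Bk => [|k R IHR] A Bk nA nA2 nB nR nR2 nl ss sl c2 wt; last first.
  move: nR nR2; rewrite !inE !negb_or => /andP[nk nR] /andP[nk2 nR2].
  have -> : shifted z A Bk (k :: R) gm l0 =
      shifted z A (k :: Bk) R gm l0 + z * shifted z (k :: A) Bk R gm l0.
    rewrite /shifted -pairingZ -pairingD; apply: eq_pairing => p q.
    rewrite /mono !big_cat /= !big_cons.
    set f1 := \prod_(x <- row1 o2 A) _; set f2 := \prod_(x <- row1 o1 Bk) _.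
    set f3 := \prod_(x <- l0) _; set f4 := \prod_(x <- R) _; set f5 := _ ^+ _.
    by ring.
  rewrite mulrDr mulrA -exprSr coefVS [RHS]mulrDr; congr (_ + _).
    rewrite IHR //=; first by rewrite eq_sym (negbTE nk2).
    - by rewrite inE negb_or nB andbT.
    - by move: ss => /=; lia.
    - by rewrite eq_sym (negbTE nk2).
    by move=> x n1 n2; rewrite -wt //=; ring.
  rewrite (IHR (k :: A) Bk) //=.
  - by rewrite inE negb_or nA andbT.
  - by rewrite inE negb_or nA2 andbT.
  - by move: ss => /=; lia.
  by move=> x n1 n2; rewrite -wt //=; ring.
have le_A : (size A <= b)%N by move: ss => /=; lia.
pose G j := F (row1 o2 A ++ row1 o1 Bk) (nseq (gm - j) o1 ++ nseq j o2 ++ l0).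
have cntG j x : (j <= gm)%N -> cnt (row1 o2 A ++ row1 o1 Bk)
    (nseq (gm - j) o1 ++ nseq j o2 ++ l0) x =
   ((o2 == x) * (size A + j) + (o1 == x) * (size Bk + (gm - j)) +
    (count_mem x A + count_mem x Bk + count_mem x l0))%N.
  by move=> le; rewrite cnt_rows !count_cat !count_nseq_eq; ring.
have szG j : (j <= gm)%N -> size (nseq (gm - j) o1 ++ nseq j o2 ++ l0) = e.
  by move=> le; rewrite !size_cat !size_nseq -sl; lia.
have ssG : size (row1 o2 A ++ row1 o1 Bk) = b.
  by rewrite size_cat !size_map; move: ss => /=; lia.
have -> : shifted z A Bk [::] gm l0 = \sum_(j < gm.+1) 'C(gm, j)%:R * z ^+ j * G j.
  rewrite /shifted /G.
  rewrite (@eq_pairing m _ (fun p q => \sum_(j < gm.+1) 'C(gm, j)%:R * z ^+ j *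
     mono (row1 o2 A ++ row1 o1 Bk) (nseq (gm - j) o1 ++ nseq j o2 ++ l0) p q)).
    by rewrite pairing_sum; apply: eq_bigr => j _; rewrite pairingZ.
  move=> p q; rewrite big_nil mulr1 exprDn big_distrr; apply: eq_bigr => j _ /=.
  rewrite -[_ *+ 'C(_, j)]mulr_natl exprMn /mono !big_cat /= !prod_nseq.
  set f1 := \prod_(x <- row1 o2 A) _; set f2 := \prod_(x <- row1 o1 Bk) _.
  by set f3 := \prod_(x <- l0) _; ring.
have G0 j : (j <= gm)%N -> (size A + j)%N != mu -> G j = 0.
  move=> le ne; apply: (@F_wt _ _ o1) => //; first exact: szG.
  rewrite cntG // lw_o1 eqxx eq_sym o12 (count_memPn nA) (count_memPn nB) (count_memPn nl).
  by move: ss le_ba le_A ne => /=; move: (size A) (size Bk) => x y; lia.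
rewrite [size [::]]/= [coefV _ _ _]/coefV big_ord1 bin0 mul1r addn0.
case: leqP => [le_mu|lt_mu]; last first.
  rewrite big1 ?mulr0 // => j _; rewrite G0 ?mulr0 //; first exact: (ltn_ord j).
  by rewrite neq_ltn (leq_trans lt_mu) ?orbT // leq_addr.
have lt_j : (mu - size A < gm.+1)%N by lia.
rewrite (bigD1 (Ordinal lt_j)) //= big1 ?addr0; last first.
  move=> j nj; rewrite G0 ?mulr0 //; first exact: (ltn_ord j).
  by apply: contra nj => /eqP ej; apply/eqP/val_inj;
    have := congr1 (subn^~ (size A)) ej; rewrite /= addKn.
rewrite /G F_mixed //; last first.
  split=> // [|x]; first exact: szG lt_j.
  rewrite cntG; last exact: lt_j.
  have [->|n1] := eqVneq x o1.
    rewrite lw_o1 ?eqxx (eq_sym o2) o12 (count_memPn nA) (count_memPn nB) (count_memPn nl).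
    by clear -ss le_ba le_mu; move: ss => /=; move: (size A) (size Bk) le_mu => u v; lia.
  have [->|n2] := eqVneq x o2.
    rewrite lw_o2 ?eqxx ?o12 (count_memPn nA2) mul0n mul1n.
    clear -c2 le_mu; move: (count_mem o2 Bk) (count_mem o2 l0) (size A) c2 le_mu => u v w; lia.
  by rewrite -wt //= !addn0; ring.
have -> : z ^+ mu = z ^+ size A * z ^+ (mu - size A) by rewrite -exprD subnKC.
by ring.
Qed.

Lemma coefV_sum B : (mu <= B)%N -> coefV B 0 B =
  \sum_(q < mu.+1) ('C(B, q) * 'C(B + (a - b) + (mu - q), mu - q))%:R * cc (B - q)%N.
Proof.
move=> le_mu; rewrite /coefV.
transitivity (\sum_(i < mu.+1) \sum_(x < mu.+1)
   ('C(B, i) * 'C(i, x) * 'C(gm, mu - i))%:R * cc (B - x)%N).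
  rewrite (big_ord_widen_cond B.+1 predT (fun i => \sum_(x < mu.+1)
   ('C(B, i) * 'C(i, x) * 'C(gm, mu - i))%:R * cc (B - x)%N)) // [RHS]big_mkcond /=.
  apply: eq_bigr => i _; rewrite add0n ltnS; case: ifP => [le_i|_]; last by rewrite mulr0.
  rewrite /mixed (big_ord_widen_cond mu.+1 predT (fun x => 'C(i, x)%:R * cc (B - x)%N)) //.
  rewrite big_mkcond /= !big_distrr; apply: eq_bigr => x _ /=; rewrite !natrM.
  case: ifP => [_|]; first by ring.
  by rewrite ltnS leqNgt => /negbFE lt; rewrite (bin_small lt) !(mulr0, mul0r).
rewrite exchange_big; apply: eq_bigr => x _ /=; rewrite -big_distrl -natr_sum /=.
have le_x : (x <= mu)%N by exact: ltn_ord x.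
by rewrite vandermonde_shift //; congr ((_ * 'C(_, _))%:R * _); lia.
Qed.

Lemma first_letter_shifted z c R P l0 p q : o1 \notin R -> o1 \notin l0 ->
  mono (row1 o1 (nseq c o2 ++ R)) (nseq P o1 ++ l0) (sbst o1 o2 z p) (sbst o1 o2 z q) =
  mono (row1 o2 [::] ++ row1 o1 (nseq c o2)) l0 p q *
    (\prod_(k <- R) (minor (o1, k) p q + z * minor (o2, k) p q)) *
    (p o1 + z * p o2) ^+ P.
Proof.
move=> nR nl; rewrite /mono /row1 /= map_cat !big_cat !big_map !prod_nseq /=.
have mE k : k != o1 -> minor (o1, k) (sbst o1 o2 z p) (sbst o1 o2 z q) =
    minor (o1, k) p q + z * minor (o2, k) p q.
  by move=> nk; rewrite minor_sbst eqxx (negbTE nk) !mul0r addr0 mul1r.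
rewrite mE ?minorii ?mulr0 ?addr0; last by rewrite eq_sym o12.
rewrite (eq_big_seq (fun k => minor (o1, k) p q + z * minor (o2, k) p q)); last first.
  by move=> k kR; apply: mE; apply: contraNneq nR => <-.
have -> : \prod_(k <- l0) sbst o1 o2 z p k = \prod_(k <- l0) p k.
  apply: eq_big_seq => k kl; rewrite /sbst; case: eqP => [e|_]; last by rewrite !mul0r addr0.
  by rewrite -e kl in nl.
rewrite {1}/sbst eqxx mul1r.
set f1 := _ ^+ c; set f2 := \prod_(k <- R) _; set f3 := \prod_(k <- l0) _.
by set f4 := _ ^+ P; ring.
Qed.

Lemma first_letter_expand z ks l : o1 \notin ks -> size ks = b -> size l = e ->
  count_mem o1 l = gm -> (count_mem o2 ks + count_mem o2 l + mu = b)%N ->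
  (forall k, k != o1 -> k != o2 -> count_mem k ks + count_mem k l = lw k)%N ->
  E (fun p q => mono (row1 o1 ks) l (sbst o1 o2 z p) (sbst o1 o2 z q)) =
  z ^+ mu * coefV (b - count_mem o2 ks)%N 0 (b - count_mem o2 ks)%N.
Proof.
move=> nks sk sl c1 c2 wt.
have [c [R [pk nR2 cE subR]]] := perm_letter o2 ks.
have [P [l0 [pl nl PE _]]] := perm_letter o1 l.
have nR : o1 \notin R by apply: contra nks; apply: subR.
have prow : perm_eq (row1 o1 ks) (row1 o1 (nseq c o2 ++ R)) by apply: perm_map.
transitivity (shifted z [::] (nseq c o2) R P l0).
  by apply: eq_pairing => p q; rewrite (mono_perm prow pl) first_letter_shifted.
have cR : count_mem o2 (nseq c o2) = c by rewrite count_nseq_eq eqxx mul1n.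
have PE' : P = gm by rewrite PE c1.
have := @shifted_eval z [::] (nseq c o2) R l0; rewrite expr0 mul1r cR PE' => ->//.
- by rewrite -cE; congr (_ * coefV _ _ _); rewrite -sk (perm_size pk) size_cat size_nseq addKn.
- by rewrite mem_nseq o12 andbF.
- by rewrite size_nseq add0n -sk (perm_size pk) size_cat size_nseq.
- by rewrite -PE' -sl (perm_size pl) size_cat size_nseq.
- by rewrite -c2 cE (seq.permP pl) count_cat count_nseq_eq o12 mul0n add0n.
move=> k n1 n2; rewrite -wt // (seq.permP pl) (seq.permP pk) !count_cat !count_nseq_eq.
by rewrite !(eq_sym _ k) (negbTE n1) (negbTE n2) !mul0n !add0n.
Qed.

End Shift.

Lemma first_letter_invariant z : sum_rec (a - b) (minn b d) cc ->
  forall s l, size s = b -> size l = e ->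
  E (fun p q => mono s l (sbst o1 o2 z p) (sbst o1 o2 z q)) = F s l.
Proof.
move=> rec; apply: sbst_fixed; [exact: F_low | by rewrite eq_sym o12|].
move=> ks l sk sl.
have srow : size (row1 o1 ks) = b by rewrite size_map.
have [ok|nok] := boolP (o1 \in ks).
  rewrite (pairing0 _ (phi := mono (row1 o1 ks) l)) => [|p q]; last exact: mono_row1_o1.
  apply: pairing0 => p q; rewrite /mono /row1 big_map (perm_big _ (perm_to_rem ok)) /=.
  by rewrite big_cons minorii !mul0r.
have both0 (Q : (N -> nat) -> Prop) :
    (forall f h, Q f -> (forall k, f k + (k == o2) = h k + (k == o1))%N -> Q h) ->
    (forall f h, Q f -> f =1 h -> Q h) ->
    (forall s l, size s = b -> size l = e -> Q (cnt s l) -> F s l = 0) ->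
    Q (cnt (row1 o1 ks) l) ->
    E (fun p q => mono (row1 o1 ks) l (sbst o1 o2 z p) (sbst o1 o2 z q)) =
    F (row1 o1 ks) l.
  move=> Q1 Q2 Q3 Q4; rewrite Q3 //.
  exact: (sbst_content z Q1 Q2 Q3).
have c1 : cnt (row1 o1 ks) l o1 = (b + count_mem o1 l)%N.
  by rewrite cnt_row1 eqxx (count_memPn nok) sk mul1n addn0.
have c2 : cnt (row1 o1 ks) l o2 = (count_mem o2 ks + count_mem o2 l)%N.
  by rewrite cnt_row1 o12.
have [lt_g|le_g] := ltnP (count_mem o1 l) (a - b).
  apply: (both0 (fun f => (f o1 < a)%N)) => [f h lt /(_ o1)|f h lt <-//|s' l' ss' sl' lt|].
  - by rewrite eqxx o12 addn0 => ef; move: lt; rewrite ef; lia.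
  - by apply: (F_wt (k := o1)) => // ea; rewrite ea lw_o1 ltnn in lt.
  by rewrite c1; lia.
have [good2|bad] := eqVneq (cnt (row1 o1 ks) l o1 + cnt (row1 o1 ks) l o2)%N (a + b)%N; last first.
  apply: (both0 (fun f => f o1 + f o2 <> a + b)%N) => [f h ne ef|f h ne ef|s' l' ss' sl' ne|].
  - have := ef o1; have := ef o2; rewrite !eqxx o12 eq_sym o12 => e2 e1 eh; apply: ne.
    by move: e1 e2 eh; lia.
  - by rewrite -!ef.
  - have [e1|ne1] := eqVneq (cnt s' l' o1) a; last first.
      by apply: (F_wt (k := o1)) => //; rewrite lw_o1; apply/eqP.
    by apply: (F_wt (k := o2)) => //; rewrite lw_o2 => e2; apply: ne; rewrite e1 e2.
  exact/eqP.
have [k0 /and3P[n1 n2 bad]|good3] := pickP (fun k => [&& k != o1, k != o2 &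
    cnt (row1 o1 ks) l k != lw k]).
  apply: (both0 (fun f => f k0 <> lw k0)) => [f h ne ef|f h ne ef|s' l' ss' sl' ne|].
  - by have := ef k0; rewrite (negbTE n1) (negbTE n2) !addn0 => <-.
  - by rewrite -ef.
  - exact: F_wt ne.
  exact/eqP.
pose mu := (count_mem o1 l - (a - b))%N.
have wt k : k != o1 -> k != o2 -> (count_mem k ks + count_mem k l)%N = lw k.
  move=> n1 n2; have := good3 k; rewrite n1 n2 /= => /negbFE/eqP <-.
  by rewrite cnt_row1 (eq_sym o1) (negbTE n1).
have muE : count_mem o1 l = (a - b + mu)%N by rewrite /mu subnKC.
have c3 : (count_mem o2 ks + count_mem o2 l + mu = b)%N.
  move: good2 le_ba muE; rewrite c1 c2; clear.
  by move: (count_mem o2 ks) (count_mem o1 l) (count_mem o2 l) mu => u v w x; lia.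
rewrite (first_letter_expand _ nok sk sl muE c3 wt).
set B := (b - count_mem o2 ks)%N.
have le_muB : (mu <= B)%N.
  by rewrite /B; move: c3; clear; move: (count_mem o2 ks) (count_mem o2 l) mu => u v w; lia.
rewrite coefV_sum //; have [mu0|mu_gt0] := posnP mu.
  rewrite mu0 big_ord1 !subn0 !bin0 expr0 muln1 !mul1r F_cc //; split=> // k.
  have [->|n1] := eqVneq k o1.
    by rewrite c1 lw_o1; move: muE le_ba; rewrite mu0; lia.
  have [->|n2] := eqVneq k o2; first by rewrite c2 lw_o2 -[RHS]c3 mu0 addn0.
  by rewrite -wt // cnt_row1 (eq_sym o1) (negbTE n1).
rewrite rec ?mulr0 // ?leq_min ?leq_subr /=.
  rewrite (F_wt (k := o1)) // c1 lw_o1 muE; move: le_ba mu_gt0; clear; lia.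
have le_l : (count_mem o1 l + count_mem o2 l <= size l)%N.
  elim: (l) => //= x l0 IHl0; have [->|] := eqVneq x o1; rewrite ?o12; case: (x == o2) => //=; lia.
move: le_l; rewrite sl /B; move: muE c3; clear.
by move: (count_mem o2 ks) (count_mem o1 l) (count_mem o2 l) mu => u v w x; lia.
Qed.

End CharTwo.

Section Necessity.
Hypothesis lt_dn : (d.+1 < n)%N.
Hypothesis F_inv : forall j j' : N, j' = j.+1 :> nat -> forall s l,
  size s = b -> size l = e ->
  E (fun p q => mono s l (sbst j j' 1 p) (sbst j j' 1 q)) = F s l.

Definition X (i : nat) : N := insubd o1 i.+2.

Lemma XE i : (i < d)%N -> X i = i.+2 :> nat.
Proof. by move=> lt_i; rewrite /X insubdK // -topredE /=; lia. Qed.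

Lemma X_o1 i : (i < d)%N -> X i != o1.
Proof. by move=> lt_i; rewrite -val_eqE /= XE // o1E. Qed.

Lemma X_o2 i : (i < d)%N -> X i != o2.
Proof. by move=> lt_i; rewrite -val_eqE /= XE // o2E. Qed.

Lemma lwX i : (i < d)%N -> lw (X i) = 1%N.
Proof. by move=> lt_i; rewrite /lw XE //= nth_nseq lt_i. Qed.

Lemma lw_X k : k != o1 -> k != o2 -> lw k != 0%N -> exists2 i, (i < d)%N & k = X i.
Proof.
rewrite -!val_eqE /= o1E o2E /lw => n1 n2.
case ek: (nat_of_ord k) n1 n2 => [|[|i]] //= _ _; rewrite nth_nseq; case: ifP => // lt_i _.
by exists i => //; apply: val_inj; rewrite /= XE.
Qed.

Lemma count_X (u r : nat) (k : N) : (u + r <= d)%N ->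
  count_mem k [seq X i | i <- iota u r] = ((u.+2 <= k) && (k < (u + r).+2))%N.
Proof.
elim: r u => [|r IHr] u le; first by rewrite /= addn0 [(k < _)%N]ltnNge andbN.
rewrite /= IHr ?addSnnS // -val_eqE /= XE; last by lia.
by case: eqP => e0; lia.
Qed.

Lemma bracket (j j' : N) r t ks0 l0 : j' = j.+1 :> nat -> j != o1 ->
  j \notin ks0 -> j \notin l0 ->
  size (nseq r j ++ ks0) = b -> size (nseq t j ++ l0) = e ->
  r%:R * F (row1 o1 (nseq r.-1 j ++ j' :: ks0)) (nseq t j ++ l0) +
  t%:R * F (row1 o1 (nseq r j ++ ks0)) (nseq t.-1 j ++ j' :: l0) = 0.
Proof.
move=> j'E nj njk njl sk sl.
have nj' : j' != o1 by rewrite -val_eqE /= j'E o1E.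
have njj' : j != j' by rewrite -val_eqE /= j'E neq_ltn ltnSn.
have le1 : (lw j' <= 1)%N.
  apply: lw_le1 => //; apply: contraNneq nj => e2.
  by rewrite -val_eqE /= o1E; move: j'E; rewrite e2 o2E => -[<-].
have srow : size (row1 o1 (nseq r j ++ ks0)) = b by rewrite size_map.
have := F_inv j'E srow sl; rewrite pairing_sbst_row1 // mul1r => /eqP.
by rewrite -subr_eq0 addrAC subrr add0r => /eqP.
Qed.

Lemma F_row1_perm ks ks' l l' : perm_eq ks ks' -> perm_eq l l' ->
  F (row1 o1 ks) l = F (row1 o1 ks') l'.
Proof. by move=> pk pl; apply: eq_pairing; apply: mono_perm => //; apply: perm_map. Qed.

Lemma fit_row1_perm ks ks' l l' : perm_eq ks ks' -> perm_eq l l' ->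
  fit (row1 o1 ks) l -> fit (row1 o1 ks') l'.
Proof.
move=> pk pl [sk sl wt]; split=> [||k].
- by rewrite -sk !size_map (perm_size pk).
- by rewrite -sl (perm_size pl).
by rewrite -wt; apply/esym/cnt_perm => //; apply: perm_map.
Qed.

Lemma fit_X ks l i : fit (row1 o1 ks) l -> (i < d)%N ->
  (count_mem (X i) ks + count_mem (X i) l = 1)%N.
Proof.
move=> [_ _ wt] lt_i; rewrite -(lwX lt_i) -wt cnt_row1.
by rewrite (eq_sym o1) (negbTE (X_o1 lt_i)).
Qed.

Lemma only_in (x : N) (l ks : seq N) : x \in l -> (count_mem x ks + count_mem x l = 1)%N ->
  count_mem x l = 1%N /\ count_mem x ks = 0%N.
Proof. by rewrite -has_pred1 has_count; lia. Qed.

Lemma rem_X ks i : count_mem (X i) ks = 1%N ->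
  exists2 ks0, perm_eq ks (X i :: ks0) & X i \notin ks0.
Proof.
move=> c1; have Xin : X i \in ks by rewrite -has_pred1 has_count c1.
exists (rem (X i) ks); first exact: perm_to_rem.
apply/count_memPn; have := seq.permP (perm_to_rem Xin) (pred1 (X i)).
by rewrite c1 /= eqxx => -[].
Qed.

Lemma swap_letters ks l i : (i.+1 < d)%N -> o1 \notin ks -> fit (row1 o1 ks) l ->
  X i \in l -> X i.+1 \in ks -> exists ks0 l0,
  [/\ perm_eq ks (X i.+1 :: ks0), perm_eq l (X i :: l0),
      fit (row1 o1 (X i :: ks0)) (X i.+1 :: l0) &
      F (row1 o1 ks) l = - F (row1 o1 (X i :: ks0)) (X i.+1 :: l0)].
Proof.
move=> lt_i nk ft xl xk; have lt_i' := ltnW lt_i.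
have cl : count_mem (X i) l = 1%N /\ count_mem (X i) ks = 0%N.
  exact: only_in (fit_X ft lt_i').
have ck : count_mem (X i.+1) ks = 1%N /\ count_mem (X i.+1) l = 0%N.
  by apply: only_in => //; rewrite addnC (fit_X ft lt_i).
have [l0 pl nl] := rem_X cl.1; have [ks0 pk nk1] := rem_X ck.1.
exists ks0, l0; have ft0 := fit_row1_perm pk pl ft; have [sk sl wt] := ft0.
have j'E : X i.+1 = (X i).+1 :> nat by rewrite !XE.
have nki : X i \notin ks0.
  by apply/count_memPn; have := seq.permP pk (pred1 (X i)); rewrite cl.2 /=; clear; lia.
split=> //.
  split=> [||k]; [by rewrite -sk | by rewrite -sl |].
  by rewrite -wt !cnt_row1 /=; clear; lia.
have := @bracket (X i) (X i.+1) 1 1 ks0 l0 j'E (X_o1 lt_i') nki nl.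
rewrite !mul1r /= => H; rewrite (F_row1_perm pk pl); apply/eqP; rewrite -addr_eq0.
by apply/eqP/H; [move: sk; rewrite size_map | move: sl].
Qed.

Lemma doubled_in_ks ks l i : (i.+1 < d)%N -> fit (row1 o1 ks) l ->
  X i \in ks -> X i.+1 \in ks -> F (row1 o1 ks) l *+ 2 = 0.
Proof.
move=> lt_i ft xk xk'; have lt_i' := ltnW lt_i.
have ck : count_mem (X i) ks = 1%N /\ count_mem (X i) l = 0%N.
  by apply: only_in => //; rewrite addnC (fit_X ft lt_i').
have [ks0 pk nk] := rem_X ck.1.
have xk0 : X i.+1 \in ks0.
  move: xk'; rewrite (perm_mem pk) inE => /orP[|//].
  by rewrite -val_eqE /= !XE // (gtn_eqF (ltnSn _)).
have pk' : perm_eq ks (X i :: X i.+1 :: rem (X i.+1) ks0).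
  by apply: perm_trans pk _; rewrite perm_cons perm_to_rem.
have [sk sl wt] := fit_row1_perm pk' (perm_refl l) ft.
have j'E : X i.+1 = (X i).+1 :> nat by rewrite !XE.
have nk0 : X i \notin rem (X i.+1) ks0 by apply: contra nk; apply: mem_rem.
have nl : X i \notin l by apply/count_memPn; case: ck.
have := @bracket (X i) (X i.+1) 2 0 _ l j'E (X_o1 lt_i') nk0 nl.
rewrite mul0r addr0 /= (F_row1_perm pk' (perm_refl l)) mulr_natl; apply=> //.
by move: sk; rewrite size_map.
Qed.

Lemma doubled_in_l ks l i : (i.+1 < d)%N -> fit (row1 o1 ks) l ->
  X i \in l -> X i.+1 \in l -> F (row1 o1 ks) l *+ 2 = 0.
Proof.
move=> lt_i ft xk xk'; have lt_i' := ltnW lt_i.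
have ck : count_mem (X i) l = 1%N /\ count_mem (X i) ks = 0%N.
  exact: only_in (fit_X ft lt_i').
have [l0 pl nl] := rem_X ck.1.
have xl0 : X i.+1 \in l0.
  move: xk'; rewrite (perm_mem pl) inE => /orP[|//].
  by rewrite -val_eqE /= !XE // (gtn_eqF (ltnSn _)).
have pl' : perm_eq l (X i :: X i.+1 :: rem (X i.+1) l0).
  by apply: perm_trans pl _; rewrite perm_cons perm_to_rem.
have [sk sl wt] := fit_row1_perm (perm_refl ks) pl' ft.
have j'E : X i.+1 = (X i).+1 :> nat by rewrite !XE.
have nl0 : X i \notin rem (X i.+1) l0 by apply: contra nl; apply: mem_rem.
have nk : X i \notin ks by apply/count_memPn; case: ck.
have := @bracket (X i) (X i.+1) 0 2 ks _ j'E (X_o1 lt_i') nk nl0.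
rewrite mul0r add0r /= (F_row1_perm (perm_refl ks) pl') mulr_natl; apply=> //.
by move: sk; rewrite size_map.
Qed.

Lemma X_in_or ks l i : fit (row1 o1 ks) l -> (i < d)%N -> X i \in ks \/ X i \in l.
Proof.
move=> ft lt_i; have := fit_X ft lt_i.
have [?|/count_memPn ->] := boolP (X i \in ks); first by left.
by rewrite add0n => c1; right; rewrite -has_pred1 has_count c1.
Qed.

Lemma lwE k : lw k = (if k == 0 :> nat then a else if k == 1 :> nat then b
  else (k < d.+2)%N)%N.
Proof.
rewrite /lw; case: (nat_of_ord k) => [|[|i]] //=; rewrite nth_nseq.
by rewrite !ltnS; case: ifP.
Qed.

Lemma count_o1 (u : nat) k : count_mem k (nseq u o1) = ((k == 0%N :> nat) * u)%N.
Proof. by rewrite count_nseq_eq -val_eqE /= o1E eq_sym. Qed.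

Lemma count_o2 (u : nat) k : count_mem k (nseq u o2) = ((k == 1%N :> nat) * u)%N.
Proof. by rewrite count_nseq_eq -val_eqE /= o2E eq_sym. Qed.

Section OddCharacteristic.
Hypothesis K_odd : 2%:R != 0 :> K.
Hypothesis d_ge2 : (2 <= d)%N.

Lemma double_eq0 (x : K) : x *+ 2 = 0 -> x = 0.
Proof. by move/eqP; rewrite -mulr_natr mulf_eq0 (negbTE K_odd) orbF => /eqP. Qed.

Lemma same_side ks l i : (i.+1 < d)%N -> fit (row1 o1 ks) l ->
  (X i \in ks /\ X i.+1 \in ks) \/ (X i \in l /\ X i.+1 \in l) -> F (row1 o1 ks) l = 0.
Proof.
move=> lt_i ft [[x y]|[x y]]; apply: double_eq0.
  exact: doubled_in_ks ft x y.
exact: doubled_in_l ft x y.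
Qed.

Lemma two_letters ks l : d = 2 -> o1 \notin ks -> fit (row1 o1 ks) l ->
  X 0 \in l -> X 1 \in ks -> F (row1 o1 ks) l = 0.
Proof.
move=> d2 nk ft x0l x1k; have [sk sl wt] := ft.
have c0 : count_mem (X 0) l = 1%N /\ count_mem (X 0) ks = 0%N.
  exact: only_in (fit_X ft (ltnW d_ge2)).
have c1 : count_mem (X 1) ks = 1%N.
  by have [] := @only_in (X 1) ks l x1k; rewrite // addnC (fit_X ft d_ge2).
have [l1 pl1 nl1] := rem_X c0.1.
have [r [ks0 [pk nk0 rE subk]]] := perm_letter o2 ks.
have [t [l0 [pl nl0 tE subl]]] := perm_letter o2 l1.
have o2X i : (i < d)%N -> (o2 == X i) = false.
  by move=> lt_i; rewrite eq_sym; apply/negbTE/X_o2.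
have ksE : ks0 = [:: X 1].
  have al : all (pred1 (X 1)) ks0.
    apply/allP => k kin; have kks := subk k kin.
    have n1 : k != o1 by apply: contraNneq nk => <-.
    have n2 : k != o2 by apply: contraNneq nk0 => <-.
    have [|i lt_i kE] := lw_X n1 n2.
      rewrite -wt cnt_row1; move: kks; rewrite -has_pred1 has_count.
      by rewrite !addn_eq0 => c; apply/negP => /andP[/andP[_ /eqP z]]; rewrite z in c.
    move: kks lt_i; rewrite {}kE; rewrite {1}d2; case: i => [|[|]] // kks _; rewrite /= ?eqxx //.
    by have /count_memPn/negP[] := c0.2.
  move: c1; rewrite (seq.permP pk) count_cat count_nseq_eq o2X // mul0n add0n.
  by rewrite (all_pred1P _ _ al) count_nseq_eq eqxx mul1n => ->.
have pk' : perm_eq ks (nseq r o2 ++ [:: X 1]) by rewrite -ksE.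
have rb : r.+1 = b by move: sk; rewrite size_map (perm_size pk') size_cat size_nseq addn1.
have t1 : t = 1%N.
  have := wt o2; rewrite cnt_row1 o12 lw_o2 (seq.permP pl1) /= eq_sym o2X ?(ltnW d_ge2) // add0n.
  by rewrite -rE -tE -rb; clear; lia.
have pl' : perm_eq l (nseq 1 o2 ++ X 0 :: l0).
  rewrite -t1 (perm_trans pl1) // perm_sym -cat1s perm_catCA perm_cons perm_sym.
  by [].
have XE2 : X 0 = o2.+1 :> nat by rewrite XE ?(ltnW d_ge2) // o2E.
have no2 : o2 != o1 by rewrite eq_sym o12.
have n1 : o2 \notin [:: X 1] by rewrite inE o2X.
have n2 : o2 \notin X 0 :: l0 by rewrite inE o2X ?(ltnW d_ge2).
have ft' := fit_row1_perm pk' pl' ft; have [sk' sl' _] := ft'.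
have := @bracket o2 (X 0) r 2 [:: X 1] l0 XE2 no2 n1 nl0.
rewrite /= (F_row1_perm pk' pl') => H; apply: double_eq0; rewrite -mulr_natl -[LHS]add0r.
rewrite -[RHS]H; first last.
- by move: sl'; rewrite /= => <-.
- by move: sk'; rewrite size_map.
congr (_ + _); case: (posnP r) => [->|r0]; first by rewrite mul0r.
rewrite (@same_side _ _ 0) ?mulr0 //; last by left; rewrite !mem_cat !inE !eqxx !orbT.
split=> [||k].
- by move: r0; rewrite -sk' !size_map !size_cat !size_nseq /=; clear; lia.
- by rewrite -sl' /=.
have [_ _ wt'] := ft'; rewrite -wt' !cnt_row1 !size_cat !count_cat !size_nseq /= !count_nseq_eq.
by move: r0; clear; case: r => // r _ /=; lia.
Qed.

Lemma F_zero_odd s l : size s = b -> size l = e -> F s l = 0.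
Proof.
apply: (determination (o := o1)); first exact: F_low.
move=> ks {}l sk sl; have srow : size (row1 o1 ks) = b by rewrite size_map.
have [ok|nk] := boolP (o1 \in ks).
  by apply: pairing0 => p q; apply: mono_row1_o1.
have [ft|nft] := EM (fit (row1 o1 ks) l); last exact: F_unfit.
have d0 := ltnW d_ge2.
case: (X_in_or ft d0) (X_in_or ft d_ge2) => x0 [] x1.
- by apply: same_side d_ge2 ft _; left.
- have [d2|nd2] := eqVneq d 2.
    have [c0 c0l] : count_mem (X 0) ks = 1%N /\ count_mem (X 0) l = 0%N.
      by apply: only_in => //; rewrite addnC (fit_X ft d0).
    have [c1 _] : count_mem (X 1) l = 1%N /\ count_mem (X 1) ks = 0%N.
      exact: only_in (fit_X ft d_ge2).
    have [ks0 pk nk0] := rem_X c0; have [l0 pl nl1] := rem_X c1.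
    have [sk1 sl1 wt1] := fit_row1_perm pk pl ft.
    have j'E : X 1 = (X 0).+1 :> nat by rewrite !XE.
    have nl0 : X 0 \notin l0.
      have /count_memPn : count_mem (X 0) l = 0%N by [].
      by apply: contra => h; rewrite (perm_mem pl) inE h orbT.
    have sk1' : size (X 0 :: ks0) = b by move: sk1; rewrite size_map.
    have := @bracket (X 0) (X 1) 1 1 ks0 l0 j'E (X_o1 d0) nk0 nl0.
    rewrite !mul1r /= => /(_ sk1' sl1) H; rewrite (F_row1_perm pk pl) -[RHS]H.
    have -> : F (row1 o1 (X 1 :: ks0)) (X 0 :: l0) = 0; last by rewrite add0r.
    apply: two_letters; rewrite ?mem_head //.
      rewrite inE negb_or eq_sym X_o1 //=.
      by move: nk; rewrite (perm_mem pk) inE negb_or => /andP[].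
    split=> [||k]; [by rewrite -sk1 | by rewrite -sl1 |].
    by rewrite -wt1 !cnt_row1 /=; clear; lia.
  have lt2 : (2 < d)%N by rewrite ltn_neqAle eq_sym nd2.
  case: (X_in_or ft lt2) => x2; last by apply: same_side lt2 ft _; right.
  have [ks0 [l0 [pk pl ft' ->]]] := swap_letters lt2 nk ft x1 x2.
  rewrite (same_side d_ge2 ft') ?oppr0 //; left; split; last exact: mem_head.
  by move: x0; rewrite (perm_mem pk) !inE => /orP[/eqP/(congr1 val)/=|->]; rewrite ?orbT // !XE.
- have [d2|nd2] := eqVneq d 2; first exact: two_letters.
  have lt2 : (2 < d)%N by rewrite ltn_neqAle eq_sym nd2.
  case: (X_in_or ft lt2) => x2; first by apply: same_side lt2 ft _; left.
  have [ks0 [l0 [pk pl ft' ->]]] := swap_letters d_ge2 nk ft x0 x1.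
  rewrite (same_side lt2 ft') ?oppr0 //; right; split; first exact: mem_head.
  by move: x2; rewrite (perm_mem pl) !inE => /orP[/eqP/(congr1 val)/=|->]; rewrite ?orbT // !XE.
by apply: same_side d_ge2 ft _; right.
Qed.

End OddCharacteristic.

Section CharTwoNecessity.
Hypothesis K2 : 2%N \in [pchar K].

Definition first_ks (t : nat) : seq N := nseq (b - t) o2 ++ [seq X i | i <- iota 0 t].

Definition first_l (t : nat) : seq N :=
  nseq (a - b) o1 ++ nseq t o2 ++ [seq X i | i <- iota t (d - t)].

Definition first_coord (t : nat) : K := F (row1 o1 (first_ks t)) (first_l t).

Lemma sorted_config ks l : o1 \notin ks -> fit (row1 o1 ks) l ->
  (forall i, (i.+1 < d)%N -> X i \in l -> X i.+1 \in ks -> False) ->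
  let t := (b - count_mem o2 ks)%N in perm_eq ks (first_ks t) /\ perm_eq l (first_l t).
Proof.
move=> nk ft sorted t; have [sk sl wt] := ft.
have [u [le_u uE]] : exists u, (u <= d)%N /\ forall i, (i < d)%N -> (X i \in ks) = (i < u)%N.
  pose u := find (fun i => X i \notin ks) (iota 0 d).
  have le_u : (u <= d)%N by rewrite -[d in (_ <= d)%N](size_iota 0) find_size.
  exists u; split=> // i lt_i; have [lt|le] := ltnP i u.
    by have := before_find 0%N lt; rewrite nth_iota // => /negbFE.
  apply/negbTE; elim: i le lt_i => [|i IHi]; first rewrite leqn0.
    move=> /eqP u0 d0; have : has (fun i => X i \notin ks) (iota 0 d).
      by rewrite has_find size_iota -/u u0.
    by move/(nth_find 0%N); rewrite -/u u0 nth_iota.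
  rewrite leq_eqVlt ltnS => /orP[/eqP eu|le] lt_i.
    have : has (fun i => X i \notin ks) (iota 0 d) by rewrite has_find size_iota -/u eu.
    by move/(nth_find 0%N); rewrite -/u eu nth_iota.
  apply/negP => kin; apply: (sorted i) => //.
  by case: (X_in_or ft (ltnW lt_i)) => // x; have := IHi le (ltnW lt_i); rewrite x.
have ckE (k : N) : (1 < k)%N -> count_mem k ks = (k < u.+2)%N.
  move=> lt_k; have n1 : k != o1 by rewrite -val_eqE /= o1E; case: (nat_of_ord k) lt_k.
  have n2 : k != o2 by rewrite -val_eqE /= o2E; case: (nat_of_ord k) lt_k => [|[]].
  have [lw0|/(lw_X n1 n2)[i lt_i kE]] := eqVneq (lw k) 0%N.
    have := wt k; rewrite lw0 cnt_row1 => /eqP; rewrite !addn_eq0 => /andP[/andP[_ /eqP ->] _].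
    have := lwE k; rewrite lw0; case: (nat_of_ord k) lt_k => [|[|k']] //= _.
    by move: le_u; clear; case: ltnP => //; case: ltnP => //; lia.
  have := fit_X ft lt_i; rewrite kE XE // !ltnS -uE // -has_pred1 has_count.
  by clear; case: (count _ ks) => [|[]].
have perm_nat l1 l2 : (forall k : N, count_mem k l1 = count_mem k l2) -> perm_eq l1 l2.
  by move=> e0; apply/allP => k _ /=; rewrite e0.
have pk : perm_eq ks (nseq (count_mem o2 ks) o2 ++ [seq X i | i <- iota 0 u]).
  apply: perm_nat => k; rewrite count_cat count_o2 count_X //.
  case ek: (nat_of_ord k) => [|[|k']] /=.
  - by apply/count_memPn; rewrite (_ : k = o1) //; apply: val_inj; rewrite /= ek o1E.
  - by rewrite mul1n addn0; congr (count_mem _ _); apply: val_inj; rewrite /= ek o2E.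
  by rewrite ckE ek //.
have tu : t = u.
  have := sk; rewrite size_map (perm_size pk) size_cat size_nseq size_map size_iota => eb.
  by rewrite /t -[in LHS]eb addKn.
have cb : count_mem o2 ks = (b - t)%N.
  have := sk; rewrite size_map (perm_size pk) size_cat size_nseq size_map size_iota.
  by rewrite tu => <-; rewrite addnK.
split; first by rewrite /first_ks tu -tu -cb tu.
apply: perm_nat => k; have := wt k; rewrite cnt_row1 -[size ks]/(size ks).
rewrite lwE /first_l !count_cat count_o1 count_o2 count_X ?tu ?subnKC //.
have sb : size ks = b by move: sk; rewrite size_map.
case ek: (nat_of_ord k) => [|[|k']] /=.
- rewrite (_ : k = o1); last by apply: val_inj; rewrite /= ek o1E.
  by rewrite eqxx (count_memPn nk) sb; clear; lia.
- rewrite (_ : k = o2); last by apply: val_inj; rewrite /= ek o2E.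
  rewrite o12 cb tu => e1; have le_t : (u <= b)%N by rewrite -tu leq_subr.
  by move: e1 le_t; clear; lia.
rewrite ckE ek //; have -> : (o1 == k) = false by rewrite -val_eqE /= o1E ek.
by move: le_u; clear; move: (count_mem k l) => x; lia.
Qed.

Lemma first_coordP : closed_form first_coord.
Proof.
move=> ks l; have [N0] := ubnP (\sum_(k <- ks) (k : nat))%N.
elim: N0 ks l => // N0 IH ks l lt_N nk ft.
have [[i [lt_i xl xk]]|none] := EM (exists i, [/\ (i.+1 < d)%N, X i \in l & X i.+1 \in ks]).
  have [ks0 [l0 [pk pl ft' ->]]] := swap_letters lt_i nk ft xl xk.
  have nk0 : o1 \notin X i :: ks0.
    rewrite inE negb_or eq_sym X_o1 ?(ltnW lt_i) //=.
    by move: nk; rewrite (perm_mem pk) inE negb_or => /andP[].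
  rewrite oppr2 // IH //.
    rewrite (seq.permP pk) /= !(negbTE (X_o2 _)) ?(ltnW lt_i) //.
  move: lt_N; rewrite (perm_big _ pk) /= !big_cons !XE ?(ltnW lt_i) //.
have [pk pl] := sorted_config nk ft (fun i lt_i x y => none (ex_intro _ i (And3 lt_i x y))).
exact: F_row1_perm.
Qed.

Lemma fit_first (t r u v w : nat) : (r + v = b)%N -> (u + t + w = e)%N ->
  (b + u = a)%N -> (r + t = b)%N -> (v + w = d)%N ->
  fit (row1 o1 (nseq r o2 ++ [seq X i | i <- iota 0 v]))
    (nseq u o1 ++ nseq t o2 ++ [seq X i | i <- iota v w]).
Proof.
move=> sk sl ca cb cd; split=> [||k].
- by rewrite size_map size_cat size_nseq size_map size_iota.
- by rewrite !size_cat !size_nseq size_map size_iota addnA.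
rewrite cnt_row1 size_cat size_nseq size_map size_iota sk !count_cat count_o1 !count_o2.
rewrite !count_X ?add0n -?cd ?leq_addr // lwE -val_eqE /= o1E eq_sym.
move: sk sl ca cb cd; clear.
by case: (nat_of_ord k) => [|[|k']] /=; lia.
Qed.

Lemma first_step_rec : step_rec first_coord.
Proof.
move=> t le_t lt_t.
have XE2 : X 0 = o2.+1 :> nat by rewrite XE ?o2E // (leq_ltn_trans _ lt_t).
have no2 : o2 != o1 by rewrite eq_sym o12.
pose ks0 := [seq X i | i <- iota 1 t].
pose l0 := nseq (a - b) o1 ++ [seq X i | i <- iota t.+1 (d - t.+1)].
have nk0 : o2 \notin ks0.
  by apply/count_memPn; rewrite count_X ?o2E.
have nl0 : o2 \notin l0.
  apply/count_memPn; rewrite count_cat count_o1 count_X ?o2E ?muln0 //.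
  by rewrite subnKC.
have := @bracket o2 (X 0) (b - t) t.+1 ks0 l0 XE2 no2 nk0 nl0.
have sk : size (nseq (b - t) o2 ++ ks0) = b by rewrite size_cat size_nseq size_map size_iota subnK.
have sl : size (nseq t.+1 o2 ++ l0) = e.
  by rewrite !size_cat !size_nseq size_map size_iota; move: lt_t; clear; lia.
move=> /(_ sk sl) /=; rewrite -[X 0 :: ks0]/[seq X i | i <- iota 0 t.+1].
have -> : F (row1 o1 (nseq (b - t) o2 ++ ks0)) (nseq t o2 ++ X 0 :: l0) = first_coord t.
  rewrite first_coordP; first by rewrite count_cat count_o2 count_X ?o2E // mul1n addn0 subKn.
    by apply/count_memPn; rewrite count_cat count_o2 count_X ?o1E.
  split=> [||k]; first by rewrite size_map.
    by rewrite -sl !size_cat /= !size_cat; clear; lia.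
  rewrite cnt_row1 sk !count_cat /= !count_cat count_o1 !count_o2 -[X 0 == k]val_eqE /= XE2 o2E.
  rewrite !count_X ?subnKC // lwE -val_eqE /= o1E eq_sym.
  move: le_t lt_t le_ba; clear.
  by case: (nat_of_ord k) => [|[|[|k']]] /=; lia.
have -> // : (b - t)%:R * first_coord t.+1 = (b - t)%:R *
  F (row1 o1 (nseq (b - t).-1 o2 ++ [seq X i | i <- iota 0 t.+1])) (o2 :: nseq t o2 ++ l0).
rewrite /first_coord /first_ks /first_l subnS; congr (_ * _); apply: F_row1_perm => //.
by rewrite -[o2 :: _]/(nseq t.+1 o2 ++ l0) /l0 perm_catCA.
Qed.

Lemma first_sum_rec : sum_rec (a - b) (minn b d) first_coord.
Proof.
move=> mu B mu_gt0 le_mu; rewrite leq_min => /andP[le_b le_d].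
pose ks := first_ks B.
pose l := nseq (a - b + mu) o1 ++ nseq (B - mu) o2 ++ [seq X i | i <- iota B (d - B)].
have sk : size ks = b by rewrite size_cat size_nseq size_map size_iota subnK.
have sl : size l = e.
  by rewrite !size_cat !size_nseq size_map size_iota; move: le_d le_mu; clear; lia.
have c2k : count_mem o2 ks = (b - B)%N.
  by rewrite count_cat count_o2 count_X ?o2E ?mul1n ?addn0.
have nk : o1 \notin ks.
  by apply/count_memPn; rewrite count_cat count_o2 count_X ?o1E.
have c1l : count_mem o1 l = (a - b + mu)%N.
  rewrite !count_cat count_o1 count_o2 count_X ?o1E ?mul1n ?addn0 //.
  by rewrite subnKC.
have c2l : count_mem o2 l = (B - mu)%N.
  rewrite !count_cat count_o1 count_o2 count_X ?o2E ?mul1n ?mul0n ?addn0 //.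
  by rewrite subnKC.
have := @first_letter_expand K2 _ first_coordP mu 1 ks l nk sk sl c1l.
rewrite c2k c2l => H; rewrite -coefV_sum //; move: H; rewrite expr1n mul1r subKn // => <-.
- rewrite F_inv ?o2E ?o1E // ?size_map //; apply: (F_wt (k := o1)); rewrite ?size_map //.
  by rewrite cnt_row1 eqxx (count_memPn nk) sk c1l lw_o1; move: le_ba mu_gt0; clear; lia.
- by move: le_mu le_b; clear; lia.
move=> k n1 n2; rewrite /ks /first_ks !count_cat count_o1 !count_o2 !count_X ?subnKC // lwE.
move: n1 n2; rewrite -!val_eqE /= o1E o2E; move: le_d; clear.
by case: (nat_of_ord k) => [|[|k']] //= le_d _ _; lia.
Qed.

Lemma closed_rec_first : closed_rec (a - b) (minn b d) first_coord.
Proof. exact/(sum_recP K2)/first_sum_rec. Qed.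

Lemma others_le_d ks l : o1 \notin ks -> fit (row1 o1 ks) l ->
  (b - count_mem o2 ks <= d)%N.
Proof.
move=> nk [sk sl wt]; have := wt o2; have := wt o1; rewrite !cnt_row1 !eqxx o12 lw_o1 lw_o2.
have cl : (count_mem o1 l + count_mem o2 l <= size l)%N.
  elim: (l) => //= x l' IHl; have : ((x == o1) + (x == o2) <= 1)%N.
    by case: (x =P o1) => [->|_]; [rewrite o12 | case: (x == o2)].
  by move: IHl; clear; lia.
have sb : size ks = b by move: sk; rewrite size_map.
rewrite (count_memPn nk) sb; move: cl; rewrite sl; move: le_ba; clear.
move: (count_mem o1 l) (count_mem o2 l) (count_mem o2 ks) => x y z; lia.
Qed.

Lemma F_zero_first : (forall t, (t <= minn b d)%N -> first_coord t = 0) ->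
  forall s l, size s = b -> size l = e -> F s l = 0.
Proof.
move=> c0; apply: (determination (o := o1)); first exact: F_low.
move=> ks l sk sl; have srow : size (row1 o1 ks) = b by rewrite size_map.
have [ok|nk] := boolP (o1 \in ks).
  by apply: pairing0 => p q; apply: mono_row1_o1.
have [ft|nft] := EM (fit (row1 o1 ks) l); last exact: F_unfit.
rewrite first_coordP // c0 // leq_min leq_subr /=.
exact: others_le_d nk ft.
Qed.

Lemma F_zero_leading j0 : (j0 <= minn b d)%N -> good j0 (a - b) ->
  (forall j, j0 < j -> j <= minn b d -> ~ good j (a - b))%N -> first_coord j0 = 0 ->
  forall s l, size s = b -> size l = e -> F s l = 0.
Proof.
move=> le_j0 gj0 j0_max c0; apply: F_zero_first.
exact: closed_rec_eq0 closed_rec_first le_j0 gj0 j0_max c0.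
Qed.

Lemma F_zero_odd_first : odd a -> (0 < d)%N ->
  forall s l, size s = b -> size l = e -> F s l = 0.
Proof.
move=> odd_a d0; apply: F_zero_first.
have cS B : (B < minn b d)%N -> first_coord B.+1 = 0 /\ B.+1%:R * first_coord B = 0.
  move=> lt_B; have := lt_B; rewrite leq_min => /andP[lt_b lt_d].
  have := closed_rec_first (isT : 1 <= B.+1)%N lt_B; have := first_step_rec (ltnW lt_b) lt_d.
  rewrite !bin1 subn1 /= (natr_odd K2 (b - B)) (natr_odd K2 (B.+1 + _).+1).
  rewrite oddB ?(ltnW lt_b) //= oddD /= oddB // odd_a.
  by case: (odd B); case: (odd b) => /=; rewrite ?(mul0r, mul1r, add0r, addr0) => H1 H2;
    split=> //; move: H1; rewrite H2 ?mul0r ?addr0 ?add0r.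
case=> [|t] le_t; last by case: (cS t le_t).
have m0 : (0 < minn b d)%N by rewrite leq_min b_gt0.
by case: (cS 0%N m0); rewrite mul1r.
Qed.
End CharTwoNecessity.
End Necessity.
End Weighted.
End TwoRowFunctionals.

(** * Weyl modules with two rows *)

Section TwoRowShape.
Variables (K : fieldType) (n a b d : nat) (o : 'I_n).
Hypothesis le_ba : (b <= a)%N.
Local Notation N := 'I_n.
Local Notation mu := (pad 2 (mu2 a b d)).
Local Notation e := (a - b + d)%N.
Local Notation wc := (@wedge_coef K n).

Lemma ncols_mu : ncols mu = (a + d)%N.
Proof.
apply/eqP; rewrite eqn_leq; apply/andP; split; last exact: (leq_bigmax (ord0 : 'I_2)).
apply/bigmax_leqP => i _; rewrite /pad /mu2; case: i => [[|[|i]]] //= _.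
by rewrite (leq_trans le_ba) // leq_addr.
Qed.

Lemma lt_top (j : 'I_(ncols mu)) : (j < mu (ord0 : 'I_2))%N.
Proof. by rewrite -[X in (_ < X)%N]/(a + d)%N -ncols_mu. Qed.

Definition top (j : 'I_(ncols mu)) : box mu :=
  Sub (ord0, j) (lt_top j : ((ord0, j).2 < mu (ord0, j).1)%N).

Lemma enum_I2 : enum 'I_2 = [:: ord0; ord_max].
Proof. by apply: (inj_map val_inj); rewrite val_enum_ord. Qed.

Lemma insub_top j : insub (ord0, j) = Some (top j) :> option (box mu).
Proof.
case: insubP => [x _ vx|/negP[]]; last exact: (lt_top j).
by congr Some; apply: val_inj.
Qed.

Lemma col_single (j : 'I_(ncols mu)) : (b <= j)%N -> col_boxes j = [:: top j].
Proof.
move=> le_j; rewrite /col_boxes enum_I2 /=.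
rewrite insub_top; case: insubP => [y lt_j|_] //=.
by have : (j < b)%N := lt_j; rewrite ltnNge le_j.
Qed.

Lemma col_pair (j : 'I_(ncols mu)) : (j < b)%N ->
  exists2 y : box mu, val y = (ord_max, j) & col_boxes j = [:: top j; y].
Proof.
move=> lt_j; rewrite /col_boxes enum_I2 /=.
rewrite insub_top; case: insubP => [y _ vy|/negP[]] //.
by exists y.
Qed.

Lemma big_columns (R : Type) (idx : R) (op : Monoid.com_law idx) (f : box mu -> R) :
  \big[op/idx]_x f x = \big[op/idx]_j \big[op/idx]_(x <- col_boxes (al := mu) j) f x.
Proof.
rewrite -[LHS]big_enum -(perm_big _ (flatten_col_boxes mu)) /= big_flatten big_map.
by rewrite big_enum.
Qed.

Lemma big_split_columns (R : Type) (idx : R) (op : Monoid.com_law idx) (f : nat -> R) :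
  \big[op/idx]_(j < ncols mu) f j =
  op (\big[op/idx]_(0 <= j < b) f j) (\big[op/idx]_(0 <= j < e) f (b + j)%N).
Proof.
rewrite -(big_mkord predT) ncols_mu (@big_cat_nat _ _ _ b) //; last first.
  by rewrite (leq_trans le_ba) // leq_addr.
congr (op _ _); rewrite -{1}[b]add0n big_addn.
by apply: congr_big => // [|j _]; [congr index_iota; lia | rewrite addnC].
Qed.

Lemma big_two_rows (R : Type) (idx : R) (op : Monoid.com_law idx) (f : 'I_2 -> nat -> R) :
  \big[op/idx]_(x : box mu) f (val x).1 (val x).2 =
  op (\big[op/idx]_(0 <= j < b) op (f ord0 j) (f ord_max j))
     (\big[op/idx]_(0 <= j < e) f ord0 (b + j)%N).
Proof.
rewrite big_columns; pose h j := if (j < b)%N then op (f ord0 j) (f ord_max j) else f ord0 j.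
transitivity (\big[op/idx]_(j < ncols mu) h j).
  apply: eq_bigr => j _; rewrite /h; case: ltnP => [/col_pair[y vy ->]|/col_single ->].
    by rewrite big_cons big_seq1 vy.
  by rewrite big_seq1.
rewrite big_split_columns; congr (op _ _); rewrite !big_mkord.
  by apply: eq_bigr => j _; rewrite /h ltn_ord.
by apply: eq_bigr => j _; rewrite /h ltnNge leq_addr.
Qed.

Definition coordf (f : 'I_(ncols mu) -> seq N) (x : ext K n mu) : K :=
  \sum_S (x S : K) * \prod_j wc (f j) (val (S j)).

Lemma coordf_sum (I : Type) (s : seq I) (P : pred I) f (x : I -> ext K n mu) :
  coordf f (\sum_(i <- s | P i) x i) = \sum_(i <- s | P i) coordf f (x i).
Proof.
rewrite /coordf exchange_big; apply: eq_bigr => S _.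
by rewrite sum_ffunE big_distrl.
Qed.

Lemma coordfZ f c (x : ext K n mu) : coordf f (c *: x) = c * coordf f x.
Proof.
by rewrite /coordf big_distrr; apply: eq_bigr => S _; rewrite ffunE -mulrA.
Qed.

Lemma coordfB f (x y : ext K n mu) : coordf f (x - y) = coordf f x - coordf f y.
Proof.
by rewrite /coordf -sumrB; apply: eq_bigr => S _; rewrite !ffunE mulrBl.
Qed.

Lemma coordf_wedges f v : coordf f (wedges v) =
  \prod_(j : 'I_(ncols mu)) \sum_(T : extmon n (conjp mu j))
     wc (f j) (val T) * col_coef [seq v x | x <- col_boxes j] (val T).
Proof.
rewrite -(sum_dffun_prod (fun (j : 'I_(ncols mu)) (T : extmon n (conjp mu j)) =>
  wc (f j) (val T) * col_coef [seq v x | x <- col_boxes j] (val T))).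
by apply: eq_bigr => S _; rewrite ffunE -big_split; apply: eq_bigr => j _; rewrite mulrC.
Qed.

Definition fill (s : seq (N * N)) (l : seq N) (j : nat) : seq N :=
  if (j < b)%N then [:: (nth (o, o) s j).1; (nth (o, o) s j).2] else [:: nth o l (j - b)].

Definition coord s l : ext K n mu -> K := coordf (fill s l).

Lemma coord_wedges s l v : coord s l (wedges v) = \prod_(j < ncols mu)
  if [seq v x | x <- col_boxes j] is [:: p; q] then minor (nth (o, o) s j) p q
  else v (top j) (nth o l (j - b)).
Proof.
rewrite /coord coordf_wedges; apply: eq_bigr => j _; rewrite /fill.
have sz := size_col_boxes (al := mu) j.
case: ltnP => [/col_pair[y vy ej]|/col_single ej]; move: sz; rewrite ej /=.
  move: (conjp mu j) => m' <-; exact: col_coef_pair2.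
move: (conjp mu j) => m' <-; exact: col_coef_pair1.
Qed.

Lemma coord_row_wedges s l (u : 'I_2 -> N -> K) : size s = b -> size l = e ->
  coord s l (wedges (fun x : box mu => u (val x).1)) = mono s l (u ord0) (u ord_max).
Proof.
move=> ss sl; rewrite coord_wedges.
pose h j := if (j < b)%N then minor (nth (o, o) s j) (u ord0) (u ord_max)
  else u ord0 (nth o l (j - b)).
transitivity (\prod_(j < ncols mu) h j).
  apply: eq_bigr => j _; rewrite /h; case: ltnP => [/col_pair[y vy ->]|/col_single ->] //=.
  by rewrite vy.
rewrite big_split_columns /mono; congr (_ * _).
  rewrite (big_nth (o, o)) ss !big_mkord.
  by apply: eq_bigr => j _; rewrite /h ltn_ord.
rewrite (big_nth o) sl !big_mkord.
by apply: eq_bigr => j _; rewrite /h ltnNge leq_addr addKn.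
Qed.

Lemma ninv_sorted (t : seq N) : sorted ltn [seq val x | x <- t] -> ninv t = 0%N.
Proof.
rewrite (sorted_pairwise ltn_trans); elim: t => //= x t IHt /andP[al /IHt ->].
rewrite addn0; apply/eqP; rewrite -leqn0 leqNgt -has_count; apply/hasPn => y yt.
by rewrite -leqNgt ltnW // (allP al) // map_f.
Qed.

Lemma wedge_coef_enum (S T : {set N}) : wc (enum S) T = (S == T)%:R.
Proof.
rewrite /wedge_coef enum_uniq ninv_sorted ?sorted_enum_set //= expr0.
rewrite (_ : [set x in enum S] = S); first by case: eqP.
by apply/setP => x; rewrite inE mem_enum.
Qed.

Lemma coord_eq0 (x : ext K n mu) :
  (forall s l, size s = b -> size l = e -> coord s l x = 0) -> x = 0.
Proof.
move=> x0; apply/ffunP => S; rewrite ffunE.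
pose w (j : nat) : seq N := if insub j is Some j' then enum (val (S j')) else [::].
pose s := mkseq (fun j => (nth o (w j) 0, nth o (w j) 1)) b.
pose l := mkseq (fun j => nth o (w (b + j)%N) 0) e.
rewrite -[RHS](x0 s l) ?size_mkseq // /coord /coordf.
have fE (j : 'I_(ncols mu)) : fill s l j = enum (val (S j)).
  have wE : w j = enum (val (S j)) by rewrite /w valK.
  have sz : size (enum (val (S j))) = size (col_boxes j).
    by rewrite size_col_boxes -cardE (eqP (valP (S j))).
  move: sz; rewrite /fill.
  case: ltnP => [lt_j|le_j].
    case: (col_pair lt_j) => y _ -> /=; rewrite nth_mkseq // wE /=.
    by case: (enum _) => [|x1 [|x2 []]].
  rewrite col_single // nth_mkseq ?subnKC // ?wE /=; first by case: (enum _) => [|x1 []].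
  by move: (ltn_ord j); rewrite [X in (_ < X)%N]ncols_mu; move: le_j le_ba; lia.
rewrite (bigD1 S) //= big1 ?mulr1 => [|j _]; last by rewrite fE wedge_coef_enum eqxx.
rewrite big1 ?addr0 // => T nT; have [j nj] : exists j, S j != T j.
  apply/existsP; apply: contraR nT; rewrite negb_exists => /forallP all_eq.
  by apply/eqP/ffunP => j; apply/esym/eqP; rewrite -[_ == _]negbK all_eq.
by rewrite (bigD1 j) //= fE wedge_coef_enum (inj_eq val_inj) (negbTE nj) mul0r mulr0.
Qed.

End TwoRowShape.

Section WeightVectors.
Variables (K : fieldType) (n a b d : nat) (o1 o2 : 'I_n).
Hypothesis K_inf : forall s : seq K, exists x, x \notin s.
Hypotheses (o1E : o1 = 0%N :> nat) (o2E : o2 = 1%N :> nat).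
Hypotheses (le_ba : (b <= a)%N) (b_gt0 : (0 < b)%N) (lt_dn : (d.+1 < n)%N).
Local Notation N := 'I_n.
Local Notation vec := (N -> K).
Local Notation mu := (pad 2 (mu2 a b d)).
Local Notation e := (a - b + d)%N.
Local Notation coord := (@coord K n a b d o1).

Definition two_rows (t : vec * vec) : 'I_2 -> vec := fun i => if i == ord0 then t.1 else t.2.

Definition measure_of (m : seq (K * (vec * vec))) : ext K n mu :=
  \sum_(t <- m) t.1 *: wedges (fun y : box mu => two_rows t.2 (val y).1).

Lemma Weyl_measure (x : ext K n mu) : x \in Weyl K n mu -> exists m, x = measure_of m.
Proof.
case/memv_imgP => y _ ->; have [s ->] := pure_span K_inf y.
exists [seq (t.1, (t.2 ord0, t.2 ord_max)) | t <- s].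
rewrite /measure_of big_map linear_sum; apply: eq_bigr => t _; rewrite linearZ /=.
rewrite dprime_pure; congr (_ *: _); apply: eq_wedges => u k; rewrite /two_rows /=.
by case: (val u).1 => [[|[|i]]] // lt; congr (t.2 _ k); apply: val_inj.
Qed.

Lemma coord_measure_act m g s l : size s = b -> size l = e ->
  coord s l (ext_act mu g (measure_of m)) =
  pairing m (fun p q => mono s l (mx_act g p) (mx_act g q)).
Proof.
move=> ss sl; rewrite linear_sum /coord coordf_sum; apply: eq_bigr => t _.
rewrite linearZ /= coordfZ ext_act_wedges -/(coord _ _ _); congr (_ * _).
have -> : wedges (fun y : box mu => mx_act g (two_rows t.2 (val y).1)) =
    wedges (fun y : box mu => two_rows (mx_act g t.2.1, mx_act g t.2.2) (val y).1).
  by apply: eq_wedges => u k; rewrite /two_rows; case: ifP.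
exact: coord_row_wedges.
Qed.

Lemma coord_measure m s l : size s = b -> size l = e ->
  coord s l (measure_of m) = pairing m (mono s l).
Proof.
move=> ss sl; rewrite /coord coordf_sum; apply: eq_bigr => t _.
by rewrite coordfZ -/(coord _ _ _) coord_row_wedges.
Qed.

Definition elementary (j j' : N) (z : K) : 'M[K]_n := 1%:M + z *: delta_mx j j'.

Lemma mx_act_elementary j j' z p : mx_act (elementary j j' z) p =1 sbst j j' z p.
Proof.
move=> k; rewrite /mx_act /sbst.
under eq_bigr => i _ do rewrite !mxE mulrDl.
rewrite big_split /=; congr (_ + _).
  by rewrite (bigD1 k) //= eqxx mul1r big1 ?addr0 // => i ik; rewrite eq_sym (negbTE ik) mul0r.
rewrite (bigD1 j') //= eqxx andbT big1 ?addr0; first by rewrite (mulrC z).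
by move=> i ij; rewrite (negbTE ij) andbF mulr0 mul0r.
Qed.

Definition torus (k : N) (z : K) : 'M[K]_n := diag_mx (\row_i (if i == k then z else 1)).

Lemma mx_act_torus k z p : mx_act (torus k z) p =1 fun i => (if i == k then z else 1) * p i.
Proof.
move=> i; rewrite /mx_act (bigD1 i) //= big1 ?addr0 => [|j ji]; rewrite !mxE.
  by rewrite eqxx mulr1n.
by rewrite [i == j]eq_sym (negbTE ji) mulr0n mul0r.
Qed.

Lemma mono_ext s l (p p' q q' : vec) : p =1 p' -> q =1 q' -> mono s l p q = mono s l p' q'.
Proof.
move=> ep eq; rewrite /mono; congr (_ * _); apply: eq_bigr => x _; rewrite ?ep //.
by rewrite /minor !ep !eq.
Qed.

Lemma mono_torus k z s l p q :
  mono s l (mx_act (torus k z) p) (mx_act (torus k z) q) = z ^+ cnt s l k * mono s l p q.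
Proof.
rewrite (mono_ext _ _ (mx_act_torus k z p) (mx_act_torus k z q)) /mono.
have cE t : z ^+ count_mem k t = \prod_(i <- t) (if i == k then z else 1).
  elim: t => [|i t IHt]; rewrite ?big_nil // big_cons -IHt /=.
  by case: (i == k); rewrite ?mul1r ?exprS.
rewrite /cnt !exprD !cE /unzip1 /unzip2 !big_map big_split /= mulrACA; congr (_ * _).
rewrite -!big_split; apply: eq_bigr => x _; rewrite /minor /=.
by case: (x.1 == k); case: (x.2 == k); ring.
Qed.

Section Vector.
Variable x : ext K n mu.
Hypothesis x_Weyl : x \in Weyl K n mu.
Hypothesis x_wt : forall k z, z != 0 -> ext_act mu (torus k z) x = z ^+ lw a b d k *: x.

Lemma measure_weight m : x = measure_of m -> forall s l k, size s = b -> size l = e ->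
  cnt s l k <> lw a b d k -> pairing m (mono s l) = 0.
Proof.
move=> xE s l k ss sl ne.
have eqz z : z != 0 ->
    z ^+ cnt s l k * pairing m (mono s l) = z ^+ lw a b d k * pairing m (mono s l).
  move=> nz; have := congr1 (coord s l) (x_wt k nz).
  rewrite {1}xE coord_measure_act // (eq_pairing _ (fun p q => mono_torus k z s l p q)).
  by rewrite pairingZ => ->; rewrite /coord coordfZ xE -/(coord _ _ _) coord_measure.
apply/eqP/negPn/negP => nz0; case: ne.
pose P : {poly K} := 'X^(cnt s l k) - 'X^(lw a b d k).
have P0 : P = 0.
  apply: (@poly_eq0_cofinite _ K_inf _ [:: 0]) => z; rewrite inE => nz.
  rewrite hornerD hornerN !hornerXn; apply/eqP; rewrite subr_eq0; apply/eqP.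
  exact: (mulIf nz0 (eqz z nz)).
have /(congr1 (fun Q : {poly K} => Q`_(cnt s l k))) := P0.
rewrite coefB !coefXn eqxx coef0; case: eqP => // _ /eqP.
by rewrite subr0 oner_eq0.
Qed.

Lemma measure_invariant m : x = measure_of m ->
  (forall j j' : N, j' = j.+1 :> nat -> ext_act mu (elementary j j' 1) x = x) ->
  forall j j' : N, j' = j.+1 :> nat -> forall s l, size s = b -> size l = e ->
  pairing m (fun p q => mono s l (sbst j j' 1 p) (sbst j j' 1 q)) = pairing m (mono s l).
Proof.
move=> xE x_inv j j' jE s l ss sl.
rewrite -coord_measure // -xE -(x_inv j j' jE) {1}xE coord_measure_act //.
by apply: eq_pairing => p q; apply: mono_ext => k; rewrite mx_act_elementary.
Qed.

Lemma measure_eq0 m : x = measure_of m ->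
  (forall s l, size s = b -> size l = e -> pairing m (mono s l) = 0) -> x = 0.
Proof.
by move=> xE F0; apply: (coord_eq0 (o := o1) le_ba) => s l ss sl; rewrite xE coord_measure ?F0.
Qed.

Definition leading_coord (t : nat) (y : ext K n mu) : K :=
  coord (row1 o1 (first_ks b o1 o2 t)) (first_l a b d o1 o2 t) y.

Section Primitive.
Hypothesis x_inv : forall j j' : N, j' = j.+1 :> nat -> ext_act mu (elementary j j' 1) x = x.

Lemma primitive_zero_odd : 2%:R != 0 :> K -> (1 < d)%N -> x = 0.
Proof.
move=> K_odd d_ge2; have [m xE] := Weyl_measure x_Weyl.
apply: (measure_eq0 xE); apply: (F_zero_odd o1E o2E) => //.
  exact: measure_weight.
exact: measure_invariant.
Qed.

Hypothesis K2 : 2%N \in [pchar K].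

Lemma primitive_zero_odd_first : odd a -> (0 < d)%N -> x = 0.
Proof.
move=> odd_a d0; have [m xE] := Weyl_measure x_Weyl.
apply: (measure_eq0 xE); apply: (F_zero_odd_first o1E o2E) => //.
  exact: measure_weight.
exact: measure_invariant.
Qed.

Lemma primitive_zero_leading j0 : (j0 <= minn b d)%N -> good j0 (a - b) ->
  (forall j, j0 < j -> j <= minn b d -> ~ good j (a - b))%N ->
  leading_coord j0 x = 0 -> x = 0.
Proof.
move=> le_j0 gj0 j0_max c0; have [m xE] := Weyl_measure x_Weyl.
apply: (measure_eq0 xE); apply: (F_zero_leading o1E o2E) gj0 j0_max _ => //.
- exact: measure_weight.
- exact: measure_invariant.
move: le_j0; rewrite leq_min => /andP[le_b le_d].
rewrite /first_coord -coord_measure -?xE // /row1 ?size_map /first_ks /first_l.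
  by rewrite size_cat size_nseq size_map size_iota subnK.
by rewrite !size_cat !size_nseq size_map size_iota subnKC.
Qed.

End Primitive.

Lemma invariant_of_coords (cc : nat -> K) : 2%N \in [pchar K] ->
  (forall ks l, o1 \notin ks -> fit a b d (row1 o1 ks) l ->
     coord (row1 o1 ks) l x = cc (b - count_mem o2 ks)%N) ->
  step_rec b d cc -> sum_rec (a - b) (minn b d) cc ->
  forall (j j' : N) z, j' = j.+1 :> nat -> ext_act mu (elementary j j' z) x = x.
Proof.
move=> K2 x_cc rec1 rec2 j j' z jE; have [m xE] := Weyl_measure x_Weyl.
have F_cc : closed_form m a b d o1 o2 cc.
  by move=> ks l nk ft; rewrite -(x_cc ks l) // xE coord_measure //; case: ft.
have F_wt := measure_weight xE.
apply/eqP; rewrite -subr_eq0; apply/eqP/(coord_eq0 (o := o1) le_ba) => s l ss sl.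
rewrite /coord coordfB -!/(coord _ _ _).
rewrite xE coord_measure_act // coord_measure //; apply/eqP; rewrite subr_eq0; apply/eqP.
rewrite -(eq_pairing _ (fun p q => mono_ext s l (fun k => esym (mx_act_elementary j j' z p k))
  (fun k => esym (mx_act_elementary j j' z q k)))).
have [j1|nj1] := eqVneq j o1; last first.
  exact: (other_letters_invariant o1E o2E le_ba b_gt0 F_wt K2 F_cc z rec1 jE nj1 ss sl).
have -> : j' = o2 by apply: val_inj; rewrite /= jE j1 o1E o2E.
rewrite j1; exact: (first_letter_invariant o1E o2E le_ba b_gt0 F_wt K2 F_cc z rec2 ss sl).
Qed.

End Vector.
End WeightVectors.

(** * Homomorphisms *)

Section Homomorphisms.
Variables (K : fieldType) (n a b d : nat) (o1 o2 : 'I_n).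
Hypothesis K_inf : forall s : seq K, exists x, x \notin s.
Hypotheses (o1E : o1 = 0%N :> nat) (o2E : o2 = 1%N :> nat).
Hypotheses (le_ba : (b <= a)%N) (b_gt1 : (1 < b)%N) (d_gt1 : (1 < d)%N) (lt_dn : (d.+1 < n)%N).
Local Notation N := 'I_n.
Local Notation la := (pad n (lam a b d)).
Local Notation mu := (pad 2 (mu2 a b d)).
Local Notation e := (a - b + d)%N.
Let b_gt0 : (0 < b)%N. Proof. exact: ltnW. Qed.

Lemma lam_dec (i i' : N) : (i <= i')%N -> (la i' <= la i)%N.
Proof.
rewrite /pad /lam; move: le_ba b_gt1; case: (nat_of_ord i) => [|[|k]];
  case: (nat_of_ord i') => [|[|k']] //= le1 lt1 le2; rewrite ?nth_nseq //.
- by case: ifP => // _; lia.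
- by case: ifP => // _; lia.
by case: ifP => // lt; rewrite (leq_ltn_trans _ lt).
Qed.

Definition unit_rows (i k : N) : K := (k == i)%:R.

Lemma mx_act_unit (g : 'M[K]_n) i : mx_act g (unit_rows i) =1 g^~ i.
Proof.
move=> k; rewrite /mx_act (bigD1 i) //= big1 ?addr0 => [|j ji]; rewrite /unit_rows.
  by rewrite eqxx mulr1.
by rewrite (negbTE ji) mulr0.
Qed.

Lemma pure_scale (I : finType) (al : I -> nat) (c : I -> K) (v : I -> N -> K) :
  pure al (fun i k => c i * v i k) = (\prod_i c i ^+ al i) *: pure al v.
Proof.
apply/ffunP => A; rewrite !ffunE scale_regular -big_split; apply: eq_bigr => i _.
rewrite -(sum_expo A) -prodrXr -big_split; apply: eq_bigr => k _ /=.
by rewrite exprMn.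
Qed.

Lemma pure_torus k z : pure la (fun i l => torus k z l i) = z ^+ lw a b d k *: pure la unit_rows.
Proof.
rewrite (_ : z ^+ _ = \prod_i (if i == k then z else 1) ^+ la i); last first.
  rewrite (bigD1 k) //= eqxx big1 ?mulr1 // => i /negbTE->; exact: expr1n.
rewrite -pure_scale; apply: eq_pure => i l; rewrite /unit_rows !mxE.
by have [->|] := eqVneq l i; rewrite ?mulr1 ?mulr0.
Qed.

Lemma elementary_row_op j j' z i l :
  elementary j j' z l i = row_op z predT j j' unit_rows i l.
Proof.
rewrite !mxE /row_op /unit_rows andbT.
by have [->|_] := eqVneq i j'; rewrite ?andbT // andbF mulr0 addr0.
Qed.

Lemma wedges_row_op (j j' : N) z (v : N -> N -> K) : j' = j.+1 :> nat ->
  dprime K n la (pure la (row_op z predT j j' v)) = dprime K n la (pure la v).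
Proof.
move=> jE; rewrite !dprime_pure; apply/ffunP => S.
by rewrite -!ev_lead_coord (lead_coord_invariant lam_dec).
Qed.

Lemma Weyl_projE (y : dpow K n la) : vsval (Weyl_proj K n la y) = dprime K n la y.
Proof. by rewrite comp_lfunE lfunE /= vsprojK // memv_img ?memvf. Qed.

Lemma torus_unit k (z : K) : z != 0 -> torus k z \in @unitmx K n.
Proof.
move=> nz; rewrite unitmxE det_diag unitfE; apply/prodf_neq0 => i _; rewrite mxE.
by case: ifP; rewrite ?oner_eq0.
Qed.

Lemma elementary_unit (j j' : N) (z : K) : j' = j.+1 :> nat -> elementary j j' z \in unitmx.
Proof.
move=> jE; have zz (c c' : K) : elementary j j' c *m elementary j j' c' = elementary j j' (c + c').
  rewrite /elementary mulmxDl mul1mx mulmxDr mulmx1 -scalemxAl -scalemxAr mul_delta_mx_0.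
    by rewrite !scaler0 addr0 -addrA -scalerDl (addrC c').
  by rewrite -val_eqE /= jE eq_sym neq_ltn ltnSn.
have := zz z (- z); rewrite subrr [in RHS]/elementary scale0r addr0.
by case/mulmx1_unit.
Qed.

Section OneHom.
Variable f : 'Hom(subvs_of (Weyl K n la), subvs_of (Weyl K n mu)).
Hypothesis f_G : f \in HomG K n la mu.

Definition image_vector : ext K n mu := vsval (f (Weyl_proj K n la (pure la unit_rows))).

Lemma image_vector_act (g : 'M[K]_n) : g \in unitmx ->
  vsval (f (Weyl_proj K n la (pure la (fun i k => g k i)))) = ext_act mu g image_vector.
Proof.
move=> gU; apply: (proj1 (HomGP f) f_G g gU); rewrite !Weyl_projE !dprime_pure ext_act_wedges.
by apply: eq_wedges => x k; rewrite mx_act_unit.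
Qed.

Lemma image_vector_Weyl : image_vector \in Weyl K n mu. Proof. exact: subvsP. Qed.

Lemma image_vector_weight k z : z != 0 ->
  ext_act mu (torus k z) image_vector = z ^+ lw a b d k *: image_vector.
Proof.
by move=> nz; rewrite -image_vector_act ?torus_unit // pure_torus !linearZ.
Qed.

Lemma image_vector_invariant (j j' : N) : j' = j.+1 :> nat ->
  ext_act mu (elementary j j' 1) image_vector = image_vector.
Proof.
move=> jE; rewrite -image_vector_act ?elementary_unit //; congr (vsval (f _)).
apply: subvs_inj; rewrite !Weyl_projE -(wedges_row_op 1 unit_rows jE).
by congr (dprime _ _ _ _); apply: eq_pure => i k; rewrite elementary_row_op.
Qed.

Lemma hom_eq0 : image_vector = 0 -> f = 0.
Proof.
move=> x0; have L0 : (f \o Weyl_proj K n la)%VF = 0.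
  apply: (@dpow_hom_eq0 _ _ _ _ _ _
    (fun v => exists2 g : 'M[K]_n, g \in unitmx & v = fun i k => g k i)).
    by move=> h h0; apply: (unit_monomials_indep K_inf) => g gU; apply: h0; exists g.
  move=> v [g gU ->]; apply: subvs_inj; rewrite comp_lfunE image_vector_act // x0.
  by rewrite !linear0.
apply/lfunP => w; rewrite zero_lfunE.
have /memv_imgP[y _ wE] := subvsP w.
have -> : w = Weyl_proj K n la y by apply: subvs_inj; rewrite Weyl_projE.
by rewrite -comp_lfunE L0 zero_lfunE.
Qed.

Lemma hom_zero_odd : 2%:R != 0 :> K -> f = 0.
Proof.
move=> K_odd; apply/hom_eq0/(primitive_zero_odd K_inf o1E o2E) => //.
- exact: image_vector_Weyl.
- exact: image_vector_weight.
exact: image_vector_invariant.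
Qed.

Lemma hom_zero_odd_first : 2%N \in [pchar K] -> odd a -> f = 0.
Proof.
move=> K2 odd_a; apply/hom_eq0/(primitive_zero_odd_first K_inf o1E o2E _ _ _ _ _ _ _ odd_a) => //.
- exact: image_vector_Weyl.
- exact: image_vector_weight.
- exact: image_vector_invariant.
exact: ltnW.
Qed.

Lemma hom_zero_leading j0 : 2%N \in [pchar K] -> (j0 <= minn b d)%N -> good j0 (a - b) ->
  (forall j, j0 < j -> j <= minn b d -> ~ good j (a - b))%N ->
  leading_coord o1 o2 j0 image_vector = 0 -> f = 0.
Proof.
move=> K2 le_j0 gj0 j0_max c0.
apply/hom_eq0/(primitive_zero_leading K_inf o1E o2E _ _ _ _ _ _ _ le_j0 gj0 j0_max c0) => //.
- exact: image_vector_Weyl.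
- exact: image_vector_weight.
exact: image_vector_invariant.
Qed.

End OneHom.

Lemma image_vectorB h f c : image_vector (h - c *: f) = image_vector h - c *: image_vector f.
Proof. by rewrite /image_vector add_lfunE opp_lfunE scale_lfunE linearB linearZ. Qed.

Lemma HomG_line f : 2%N \in [pchar K] -> f \in HomG K n la mu -> f != 0 ->
  HomG K n la mu = <[f]>%VS.
Proof.
move=> K2 f_G nz; have [le_j0 gj0 j0_max] := max_two_compl (minn b d) (a - b).
move: le_j0 gj0 j0_max; set j0 := \max_(j < _ | _) _ => le_j0 gj0 j0_max.
pose c h := leading_coord o1 o2 j0 (image_vector h).
have cf : c f != 0.
  apply: contraNneq nz => c0; apply/eqP/(hom_zero_leading f_G K2 le_j0 gj0 j0_max c0).
apply/eqP; rewrite eqEsubv; apply/andP; split; last by rewrite -memvE.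
apply/subvP => h h_G; apply/vlineP; exists (c h / c f).
apply/eqP; rewrite -subr_eq0; apply/eqP.
have h_G' : h - (c h / c f) *: f \in HomG K n la mu by rewrite memvB ?memvZ.
apply: (hom_zero_leading h_G' K2 le_j0 gj0 j0_max).
rewrite image_vectorB /leading_coord /coord coordfB coordfZ -!/(coord _ _ _).
by rewrite -!/(leading_coord _ _ _ _) -/(c h) -/(c f) divfK ?subrr.
Qed.

Lemma dim_HomG : 2%N \in [pchar K] -> (\dim (HomG K n la mu) <= 1)%N.
Proof.
move=> K2; have [->|nz] := eqVneq (HomG K n la mu) 0%VS; first by rewrite dimv0.
rewrite (HomG_line K2 (memv_pick (HomG K n la mu))) ?vpick0 //.
by rewrite dim_vline; case: (_ != 0).
Qed.

End Homomorphisms.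

Section ShuffleCount.
Variables (d h : nat) (S : {set 'I_d}).
Hypotheses (cardS : #|S| = h).
Local Notation m := (d - h)%N.

Definition block (P : pred nat) (sg : 'S_d) : seq 'I_d := [seq sg i | i : 'I_d <- enum 'I_d & P i].

Lemma le_hd_set : (h <= d)%N.
Proof. by rewrite -cardS -[d in (_ <= d)%N]card_ord max_card. Qed.

Lemma enum_lt : [seq i : 'I_d <- enum 'I_d | (i < m)%N] = take m (enum 'I_d).
Proof.
apply: (inj_map val_inj); rewrite map_take val_enum_ord -(filter_map val (fun i => i < m)%N).
rewrite val_enum_ord take_iota (minn_idPl (leq_subr h d)).
rewrite -[d in iota 0 d](subnK le_hd_set) iotaD filter_cat.
rewrite (all_filterP _) ?(eq_in_filter (a2 := pred0)) ?filter_pred0 ?cats0 //.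
  by move=> i; rewrite mem_iota add0n => /andP[le_i _] /=; rewrite ltnNge le_i.
by apply/allP => i; rewrite mem_iota add0n.
Qed.

Lemma enum_ge : [seq i : 'I_d <- enum 'I_d | (m <= i)%N] = drop m (enum 'I_d).
Proof.
apply: (inj_map val_inj); rewrite map_drop val_enum_ord -(filter_map val (fun i => m <= i)%N).
rewrite val_enum_ord drop_iota add0n.
rewrite -[d in iota 0 d](subnK le_hd_set) iotaD filter_cat add0n.
rewrite (eq_in_filter (a2 := pred0)) ?filter_pred0 => [|i]; last first.
  by rewrite mem_iota add0n => /andP[_ lt_i] /=; rewrite leqNgt lt_i.
rewrite (all_filterP _) ?subKn ?le_hd_set //.
by apply/allP => i; rewrite mem_iota => /andP[].
Qed.

Lemma shuffle_blocks (sg : 'S_d) :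
  is_shuffle m sg && [forall x, (x \in S) == (m <= (sg^-1)%g x)%N] =
  (block (fun i => i < m)%N sg == enum (~: S)) && (block (fun i => m <= i)%N sg == enum S).
Proof.
have mem_block (P : pred nat) x : (x \in block P sg) = P ((sg^-1)%g x).
  apply/mapP/idP => [[i] |Px].
    by rewrite mem_filter => /andP[Pi _] ->; rewrite permK.
  by exists ((sg^-1)%g x); rewrite ?permKV // mem_filter Px mem_enum.
apply/andP/andP => [[/forallP sh /forallP mS]|[/eqP bL /eqP bR]].
  have sortedP (P : pred nat) : (forall i j : 'I_d, P i -> P j -> (i < j)%N -> (sg i < sg j)%N) ->
      enum [set x in block P sg] = block P sg.
    move=> mono_sg; apply: enum_set_sorted; rewrite -map_comp sorted_map.
    apply: (@sub_in_sorted _ (fun i => P (val i)) (relpre val ltn)).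
    - by move=> i j Pi Pj /=; apply: mono_sg.
    - by apply/allP => i; rewrite mem_filter => /andP[].
    rewrite -sorted_map; apply: (subseq_sorted ltn_trans (map_subseq _ (filter_subseq _ _))).
    by rewrite val_enum_ord iota_ltn_sorted.
  have shP (i j : 'I_d) : (i < j)%N -> (j < m)%N || (m <= i)%N -> (sg i < sg j)%N.
    by move=> lt c; have /forallP/(_ j) := sh i; rewrite lt c.
  rewrite -(sortedP (fun i => i < m)%N) => [|i j Pi Pj lt]; last by apply: shP; rewrite ?Pj.
  rewrite -(sortedP (fun i => m <= i)%N) => [|i j Pi Pj lt]; last by apply: shP; rewrite ?Pi ?orbT.
  split; apply/eqP; apply: eq_enum => x; rewrite !inE mem_block.
    by rewrite (eqP (mS x)) ltnNge.
  by rewrite (eqP (mS x)).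
split; last first.
  by apply/forallP => x; rewrite -mem_enum -bR mem_block.
have st (P : pred nat) (U : {set 'I_d}) : block P sg = enum U ->
    forall i j : 'I_d, P i -> P j -> (i < j)%N -> (sg i < sg j)%N.
  move=> bU i j Pi Pj lt; pose L := [seq i : 'I_d <- enum 'I_d | P i].
  have sL (r : rel nat) (f : 'I_d -> nat) : sorted r [seq f i | i <- L] = sorted (relpre f r) L.
    exact: sorted_map.
  have s1 : sorted (relpre (fun i : 'I_d => val (sg i)) ltn) L.
    by rewrite -sL; have := sorted_enum_set U; rewrite -bU -map_comp.
  have s2 : sorted (relpre val ltn) L.
    rewrite -sL; apply: (subseq_sorted ltn_trans (map_subseq _ (filter_subseq _ _))).
    by rewrite val_enum_ord iota_ltn_sorted.
  have tr (f : 'I_d -> nat) : transitive (relpre f ltn) by move=> y x z; apply: ltn_trans.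
  have iL : i \in L by rewrite mem_filter Pi mem_enum.
  have jL : j \in L by rewrite mem_filter Pj mem_enum.
  case: (ltngtP (index i L) (index j L)) => [ij|ji|].
  - exact: (sorted_ltn_index (tr _) s1 _ _ iL jL ij).
  - have := sorted_ltn_index (tr _) s2 _ _ jL iL ji.
    by rewrite /= ltnNge (ltnW lt).
  by move/(congr1 (nth i L)); rewrite !nth_index // => eij; rewrite eij ltnn in lt.
apply/forallP => i; apply/forallP => j; apply/implyP => /andP[lt /orP[lt_j|le_i]].
  by apply: (st _ _ bL) => //; apply: ltn_trans lt_j.
by apply: (st _ _ bR) => //; apply: leq_trans le_i (ltnW lt).
Qed.

Lemma unique_shuffle : exists sg0 : 'S_d, forall sg : 'S_d,
  is_shuffle m sg && [forall x, (x \in S) == (m <= (sg^-1)%g x)%N] = (sg == sg0).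
Proof.
pose t := enum (~: S) ++ enum S.
have st : size t = d by rewrite size_cat -!cardE addnC cardsC card_ord.
have Ut : uniq t.
  rewrite cat_uniq !enum_uniq andbT /=; apply/hasPn => x; rewrite !mem_enum inE => ->.
  by [].
have f_inj : injective (fun i : 'I_d => nth i t i).
  move=> i j; rewrite (set_nth_default i j) ?st // => /eqP; rewrite nth_uniq ?st //.
  by move/eqP/val_inj.
have [sg0 sg0E] : exists sg0 : 'S_d, forall i, sg0 i = nth i t i.
  by exists (perm f_inj) => i; rewrite permE.
have mt : [seq sg0 i | i <- enum 'I_d] = t.
  have [d0|d_gt0] := posnP d.
    by rewrite (size0nil (etrans st d0)) (size0nil (s := enum _)) // size_enum_ord.
  pose x0 := Ordinal d_gt0.
  apply: (@eq_from_nth _ x0) => [|i]; rewrite size_map size_enum_ord // => lt_i.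
  rewrite (nth_map x0) ?size_enum_ord // sg0E (nth_ord_enum x0 (Ordinal lt_i)).
  by apply: set_nth_default; rewrite st.
exists sg0 => sg; rewrite shuffle_blocks.
have blocksE (sg' : 'S_d) : (block (fun i => i < m)%N sg' == enum (~: S)) &&
    (block (fun i => m <= i)%N sg' == enum S) = ([seq sg' i | i <- enum 'I_d] == t).
  rewrite /block enum_lt enum_ge -{3}(cat_take_drop m (enum 'I_d)) map_cat eqseq_cat //.
  rewrite size_map size_take size_enum_ord -cardE.
  have := cardsC S; rewrite cardS card_ord; have := le_hd_set; clear.
  by case: ltnP; lia.
rewrite blocksE -mt; apply/eqP/eqP => [e|-> //].
by apply/permP => i; move/eq_in_map: e; apply; rewrite mem_enum.
Qed.

End ShuffleCount.

Section Existence.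
Variables (K : fieldType) (n a b d : nat) (o1 o2 : 'I_n).
Hypothesis K_inf : forall s : seq K, exists x, x \notin s.
Hypotheses (o1E : o1 = 0%N :> nat) (o2E : o2 = 1%N :> nat).
Hypotheses (le_ba : (b <= a)%N) (b_gt1 : (1 < b)%N) (d_gt1 : (1 < d)%N) (lt_dn : (d.+1 < n)%N).
Local Notation N := 'I_n.
Local Notation la := (pad n (lam a b d)).
Local Notation mu := (pad 2 (mu2 a b d)).
Local Notation e := (a - b + d)%N.
Local Notation coord := (@coord K n a b d o1).
Let b_gt0 : (0 < b)%N. Proof. exact: ltnW. Qed.

Lemma I2_max (i : 'I_2) : (i == ord0) = false -> i = ord_max.
Proof. by case: i => [[|[|]]] // lt _; apply: val_inj. Qed.

Section Tableau.
Variables (T : tableau) (ks l : seq N).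
Hypothesis T_wt : forall k : N, (\sum_(i < 2) tcount T (k, i) = la k)%N.
Hypothesis T_o1 : tcount T (o1, ord_max : 'I_2) = 0%N.
Hypotheses (nk : o1 \notin ks) (ft : fit a b d (row1 o1 ks) l).

Definition box_letter (i : 'I_2) (j : nat) : N :=
  if i == ord0 then if (j < b)%N then o1 else nth o1 l (j - b) else nth o1 ks j.

Lemma coord_filled (w : {ffun box mu -> N * 'I_2}) : fills snd (tcount T) w ->
  coord (row1 o1 ks) l (wedges (fun x : box mu => unit_rows K (w x).1)) =
  \prod_x ((w x).1 == box_letter (val x).1 (val x).2)%:R.
Proof.
move=> /andP[/forallP wrow /forallP wcnt]; have [sk _ _] := ft.
rewrite coord_wedges // big_columns //; apply: eq_bigr => j _.
have [lt_j|le_j] := ltnP j b; last first.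
  rewrite col_single //= big_seq1 /box_letter /= ltnNge le_j.
  by rewrite /unit_rows eq_sym.
have [y vy ->] := col_pair le_ba lt_j; rewrite big_cons big_seq1 /= vy /box_letter /= lt_j.
rewrite (nth_map o1); last by move: sk; rewrite size_map => ->.
have ny : (w y).1 != o1.
  apply/eqP => wy; have := wcnt (o1, ord_max); rewrite T_o1 cards_eq0.
  have := wrow y; rewrite vy /= => /eqP wy2.
  by move/eqP/setP/(_ y); rewrite !inE [w y]surjective_pairing wy wy2 eqxx.
rewrite /minor /unit_rows /= [o1 == (w y).1]eq_sym (negbTE ny) mulr0 subr0.
by rewrite ![(w _).1 == _]eq_sym.
Qed.

Lemma count_letter (k : N) (i : 'I_2) :
  #|[set x : box mu | (box_letter (val x).1 (val x).2, (val x).1) == (k, i)]| =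
  if i == ord0 then ((o1 == k) * b + count_mem k l)%N else count_mem k ks.
Proof.
have [sk sl _] := ft.
pose f (i' : 'I_2) (j : nat) : nat := (box_letter i' j, i') == (k, i).
rewrite -sum1dep_card big_mkcond /=.
rewrite (eq_bigr (fun x : box mu => f (val x).1 (val x).2)); last first.
  by move=> x _; rewrite /f; case: (_ == _).
rewrite big_two_rows // /f /box_letter !big_mkord /=.
have cE (s : seq N) (m : nat) : size s = m ->
    (\sum_(j < m) ((nth o1 s j == k) : nat) = count_mem k s)%N.
  move=> <-; rewrite -sum1_count [RHS]big_mkcond (big_nth o1) big_mkord.
  by apply: eq_bigr => j _ /=; case: (nth o1 s j == k).
have sk' : size ks = b by move: sk; rewrite size_map.
rewrite -(cE ks b) // -(cE l e) //.
case: ifP => [/eqP ->|ni].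
  rewrite (eq_bigr (fun=> (o1 == k) : nat)) => [|j _]; last first.
    by rewrite ltn_ord !xpair_eqE eqxx !andbT andbF addn0.
  rewrite sum_nat_const card_ord mulnC; congr (_ + _)%N.
  by apply: eq_bigr => j _; rewrite ltnNge leq_addr addKn xpair_eqE eqxx andbT.
rewrite (I2_max ni).
rewrite [X in (_ + X)%N]big1 ?addn0 => [|j _]; last by rewrite xpair_eqE andbF.
by apply: eq_bigr => j _; rewrite ltn_ord !xpair_eqE eqxx andbT andbF.
Qed.

Lemma coord_tableau :
  coord (row1 o1 ks) l (\sum_(w : {ffun box mu -> N * 'I_2} | fills snd (tcount T) w)
     wedges (fun x : box mu => unit_rows K (w x).1)) =
  [forall k : N, count_mem k ks == tcount T (k, ord_max : 'I_2)]%:R.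
Proof.
rewrite -[coord _ _ _]/(coordf _ _) coordf_sum.
rewrite (eq_bigr _ (fun w fw => coord_filled fw)).
pose w0 : {ffun box mu -> N * 'I_2} :=
  [ffun x : box mu => (box_letter (val x).1 (val x).2, (val x).1)].
have fw0 : fills snd (tcount T) w0 =
    [forall k : N, count_mem k ks == tcount T (k, ord_max : 'I_2)].
  have [sk sl wt] := ft.
  have cw k i : #|[set x | w0 x == (k, i)]| =
      if i == ord0 then ((o1 == k) * b + count_mem k l)%N else count_mem k ks.
    by rewrite -count_letter; apply: eq_card => x; rewrite !inE ffunE.
  apply/andP/forallP => [[_ /forallP all_eq] k|all_eq]; first by rewrite -(eqP (all_eq _)) cw.
  split; first by apply/forallP => x; rewrite ffunE.
  apply/forallP => -[k i]; rewrite cw; case: ifP => [/eqP ->|ni].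
    have := T_wt k; rewrite big_ord_recl big_ord1 (_ : lift _ _ = ord_max); last exact: val_inj.
    have sk' : size ks = b by move: sk; rewrite size_map.
    rewrite -(eqP (all_eq k)) => t0; have := wt k; rewrite cnt_row1 sk'.
    by rewrite /lw -[nth _ _ _]/(la k) -t0; move: (tcount _ _) => x h; apply/eqP; move: h; lia.
  by rewrite (I2_max ni).
rewrite -fw0 (bigID (pred1 w0)) /= [X in _ + X]big1 ?addr0; last first.
  move=> w /andP[/andP[/forallP wrow _] nw]; apply/eqP/prodf_eq0.
  have [x nx] : exists x, w x != w0 x.
    apply/existsP; apply: contraR nw; rewrite negb_exists => /forallP all_eq.
    by apply/eqP/ffunP => x; apply/eqP; rewrite -[_ == _]negbK all_eq.
  exists x => //; move: nx; rewrite ffunE [w x]surjective_pairing (eqP (wrow x)).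
  by rewrite xpair_eqE eqxx andbT /= => /negbTE ->.
case f0: (fills _ _ w0).
  rewrite (big_pred1 w0) => [|w]; last first.
    by rewrite /=; case: (w =P w0) => [->|_]; rewrite ?f0 ?andbF.
  by rewrite big1 // => x _; rewrite ffunE eqxx.
by rewrite big_pred0 // => w; rewrite /=; case: (w =P w0) => [->|_]; rewrite ?f0 ?andbF.
Qed.

End Tableau.

Lemma count_entries (sg : 'S_d) (P : pred 'I_d) (x : 'I_d) :
  count_mem x.+3 [seq (sg i : nat).+3 | i : 'I_d <- enum 'I_d & P i] = P ((sg^-1)%g x).
Proof.
rewrite count_map count_filter.
rewrite (eq_count (a2 := fun i => (i == (sg^-1)%g x) && P ((sg^-1)%g x))) => [|i /=].
  case: (P _) => /=; last by rewrite (eq_count (a2 := pred0)) ?count_pred0 // => i; rewrite andbF.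
  rewrite (eq_count (a2 := pred1 ((sg^-1)%g x))) => [|i /=]; last by rewrite andbT.
  by rewrite count_uniq_mem ?enum_uniq // mem_enum.
rewrite eqSS !eqSS (inj_eq val_inj) -(inj_eq (@perm_inj _ sg)) permKV.
by case: eqP => // <-; rewrite permK.
Qed.

Lemma count_entries0 (sg : 'S_d) (P : pred 'I_d) k : ~~ (1 < k < d.+2)%N ->
  count_mem k.+1 [seq (sg i : nat).+3 | i : 'I_d <- enum 'I_d & P i] = 0%N.
Proof.
move=> nk; apply/count_memPn/mapP => -[i _] ek; move: nk; rewrite negb_and -leqNgt -leqNgt.
by move: (ltn_ord (sg i)) ek; lia.
Qed.

Section Shuffles.
Variables (h : nat) (sg : 'S_d).
Hypotheses (le_hb : (h <= b)%N) (le_hd : (h <= d)%N).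
Local Notation T := (Ttab a b h sg).

Lemma tcount_bottom (k : N) : tcount T (k, ord_max : 'I_2) = ((k == 1%N :> nat) * (b - h) +
  count_mem k.+1 [seq (sg i : nat).+3 | i : 'I_d <- enum 'I_d & (d - h <= i)%N])%N.
Proof. by rewrite /tcount /= count_cat count_nseq /= eqSS eq_sym. Qed.

Lemma tcount_top (k : N) : tcount T (k, ord0 : 'I_2) =
  ((k == 0%N :> nat) * a + (k == 1%N :> nat) * h +
  count_mem k.+1 [seq (sg i : nat).+3 | i : 'I_d <- enum 'I_d & (i < d - h)%N])%N.
Proof.
by rewrite /tcount /= !count_cat !count_nseq /= !eqSS addnA !(eq_sym _ (k : nat)).
Qed.

Lemma tcount_total (k : N) : (\sum_(i < 2) tcount T (k, i) = la k)%N.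
Proof.
rewrite big_ord_recl big_ord1 (_ : lift _ _ = ord_max); last exact: val_inj.
rewrite tcount_top tcount_bottom -[la k]/(lw a b d k) lwE.
have [/andP[k1 k2]|nk] := boolP (1 < k < d.+2)%N.
  have lt : (k - 2 < d)%N by lia.
  rewrite k2; have -> : k.+1 = (Ordinal lt).+3 by rewrite /=; lia.
  rewrite !count_entries; move: ((sg^-1)%g _) k1 => x; clear; case: (ltnP x) => _.
    by case: (nat_of_ord k) => [|[|k']].
  by case: (nat_of_ord k) => [|[|k']].
rewrite !count_entries0 //; move: nk le_hb; clear.
by case: (nat_of_ord k) => [|[|k']] //=; lia.
Qed.

Lemma tcount_o1 : tcount T (o1, ord_max : 'I_2) = 0%N.
Proof. by rewrite tcount_bottom o1E count_entries0. Qed.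

End Shuffles.

Lemma coord_shuffles h ks l : (h <= minn b d)%N -> o1 \notin ks -> fit a b d (row1 o1 ks) l ->
  coord (row1 o1 ks) l (\sum_(sg : 'S_d | is_shuffle (d - h) sg)
     \sum_(w : {ffun box mu -> N * 'I_2} | fills snd (tcount (Ttab a b h sg)) w)
        wedges (fun x : box mu => unit_rows K (w x).1)) =
  (h == b - count_mem o2 ks)%N%:R.
Proof.
rewrite leq_min => /andP[le_hb le_hd] nk ft; have [sk sl wt] := ft.
have sk' : size ks = b by move: sk; rewrite size_map.
rewrite -[coord _ _ _]/(coordf _ _) coordf_sum.
rewrite (eq_bigr (fun sg => [forall k : N,
   count_mem k ks == tcount (Ttab a b h sg) (k, ord_max : 'I_2)]%:R)) => [|sg _]; last first.
  by rewrite -[coordf _ _]/(coord _ _ _) coord_tableau //; [exact: tcount_total | exact: tcount_o1].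
have le_c : (count_mem o2 ks <= b)%N by rewrite -sk' count_size.
have [eh|nh] := eqVneq h (b - count_mem o2 ks)%N; last first.
  apply: big1 => sg _; case: forallP => // /(_ o2); rewrite tcount_bottom o2E.
  rewrite count_entries0 ?o2E // mul1n addn0 => /eqP e2.
  by rewrite e2 subKn ?eqxx // in nh.
pose S : {set 'I_d} := [set x : 'I_d | X o1 x \in ks].
have c1 (k : N) : k != o1 -> k != o2 -> (count_mem k ks <= 1)%N.
  move=> n1 n2; apply: leq_trans (lw_le1 a b d o1E o2E n1 n2); rewrite -wt cnt_row1.
  by rewrite -addnA addnCA leq_addr.
have n1X (x : 'I_d) : X o1 x != o1 by apply: (X_o1 o1E o2E le_ba b_gt0 lt_dn).
have n2X (x : 'I_d) : X o1 x != o2 by apply: (X_o2 o1E o2E le_ba b_gt0 lt_dn).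
have XE (x : 'I_d) : X o1 x = x.+2 :> nat by apply: (XE o1E o2E le_ba b_gt0 lt_dn).
have cX (x : 'I_d) : count_mem (X o1 x) ks = (x \in S).
  rewrite inE -has_pred1 has_count.
  by case: (count_mem _ _) (c1 _ (n1X x) (n2X x)) => [|[]].
have cardS : #|S| = h.
  pose ks' := [seq k <- ks | k != o2].
  have pk : perm_eq ks' [seq X o1 (val x) | x <- enum S].
    apply: uniq_perm.
    - apply: count_mem_uniq => k; rewrite mem_filter.
      have -> : count_mem k ks' = if k == o2 then 0%N else count_mem k ks.
        rewrite count_filter; case: eqVneq => [->|n2].
          by rewrite (eq_count (a2 := pred0)) ?count_pred0 // => i /=; case: eqP.
        by apply: eq_count => i /=; case: (i =P k) => // ->; rewrite n2.
      case: (eqVneq k o2) => //= n2; rewrite -has_pred1 has_count.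
      have [->|n1] := eqVneq k o1; first by rewrite (count_memPn nk).
      by case: (count_mem k ks) (c1 k n1 n2) => [|[]].
    - rewrite map_inj_in_uniq ?enum_uniq // => x y _ _ /(congr1 val) /=.
      by rewrite !XE => -[] /val_inj.
    move=> k; rewrite mem_filter; apply/andP/mapP => [[n2 kin]|[x]].
      have n1 : k != o1 by apply: contraNneq nk => <-.
      have [|i lt_i kE] := lw_X o1E o2E le_ba b_gt0 lt_dn n1 n2.
        by rewrite -lt0n -wt cnt_row1 !addn_gt0 -!has_count !has_pred1 kin orbT.
      by exists (Ordinal lt_i); rewrite // mem_enum inE /= -kE.
    by rewrite mem_enum inE => xk ->; split; [apply: n2X|].
  rewrite cardE -(size_map (fun x : 'I_d => X o1 x)) -(perm_size pk) size_filter.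
  by rewrite eh -sk' -(count_predC (pred1 o2) ks) addKn.
have [sg0 sg0P] := unique_shuffle cardS.
have condE sg : is_shuffle (d - h) sg ->
    [forall k : N, count_mem k ks == tcount (Ttab a b h sg) (k, ord_max : 'I_2)] = (sg == sg0).
  move=> sh; rewrite -sg0P sh /=; apply/forallP/forallP => [all_eq x|all_eq k].
    have := all_eq (X o1 x); rewrite cX tcount_bottom XE count_entries.
    by move/eqP; case: (x \in S); case: (_ <= _)%N.
  have [/andP[k1 k2]|nk'] := boolP (1 < k < d.+2)%N.
    have lt : (k - 2 < d)%N by move: k1 k2; clear; lia.
    have -> : k = X o1 (Ordinal lt).
      by apply: val_inj; apply: etrans (esym (XE _)); move: k1; rewrite /=; clear; lia.
    by rewrite cX (eqP (all_eq _)) tcount_bottom XE count_entries.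
  rewrite tcount_bottom count_entries0 // addn0.
  case ek: (nat_of_ord k) => [|[|k']] /=.
  - by rewrite (_ : k = o1) ?(count_memPn nk) //; apply: val_inj; rewrite /= ek o1E.
  - by rewrite (_ : k = o2) ?eh ?subKn ?mul1n //; apply: val_inj; rewrite /= ek o2E.
  have := wt k; rewrite lwE cnt_row1 ek /=; move: nk'; rewrite ek /= => /negbTE ->.
  by move/eqP; rewrite !addn_eq0 => /andP[/andP[_ ->]].
rewrite (eq_bigr (fun sg => (sg == sg0)%:R)) => [|sg sh]; last by rewrite condE.
rewrite (bigD1 sg0) /= ?eqxx; last by have := sg0P sg0; rewrite eqxx => /andP[].
by rewrite big1 ?addr0 // => sg /andP[_ /negbTE ->].
Qed.

Section Generator.
Hypothesis K2 : 2%N \in [pchar K].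
Variable H : seq nat.
Hypotheses (H_uniq : uniq H) (H_le : forall h, h \in H -> (h <= minn b d)%N).
Hypotheses (H_neq0 : H != [::]) (even_a : ~~ odd a).
Hypothesis H_rec : closed_rec (K := K) (a - b) (minn b d) (fun t => (t \in H)%:R).
Local Notation FH := (\sum_(h <- H) Fh K n a b d h).

Definition evaluation (v : N -> N -> K) : ext K n mu := \sum_(h <- H)
  \sum_(sg : 'S_d | is_shuffle (d - h) sg)
  \sum_(w : {ffun box mu -> N * 'I_2} | fills snd (tcount (Ttab a b h sg)) w)
    wedges (fun x : box mu => v (w x).1).

Lemma FH_pure v : vsval (FH (pure la v)) = evaluation v.
Proof.
rewrite sum_lfunE linear_sum; apply: eq_big_seq => h hH.
have := H_le hH; rewrite leq_min => /andP[le_hb le_hd].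
rewrite /Fh sum_lfunE linear_sum /=; apply: eq_bigr => sg _.
by rewrite phi_pure // => k; apply: tcount_total.
Qed.

Lemma evaluation_act g v : ext_act mu g (evaluation v) = evaluation (fun i => mx_act g (v i)).
Proof.
rewrite /evaluation linear_sum; apply: eq_bigr => h _.
rewrite linear_sum; apply: eq_bigr => sg _; rewrite linear_sum; apply: eq_bigr => w _.
exact: ext_act_wedges.
Qed.

Lemma eq_evaluation v v' : v =2 v' -> evaluation v = evaluation v'.
Proof.
move=> ev; rewrite /evaluation; do 3![apply: eq_bigr => ? _].
by apply: eq_wedges => x k; rewrite ev.
Qed.

Local Notation x := (evaluation (@unit_rows K n)).

Lemma coord_evaluation ks l : o1 \notin ks -> fit a b d (row1 o1 ks) l ->
  coord (row1 o1 ks) l x = ((b - count_mem o2 ks)%N \in H)%:R.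
Proof.
move=> nk ft; rewrite -[coord _ _ _]/(coordf _ _) coordf_sum.
transitivity (\sum_(h <- H) (h == b - count_mem o2 ks)%N%:R : K).
  by apply: eq_big_seq => h hH; rewrite -(coord_shuffles (H_le hH) nk ft).
rewrite -natr_sum; congr _%:R; rewrite -(count_uniq_mem _ H_uniq).
move: (b - _)%N => c; rewrite -sum1_count.
by rewrite [RHS]big_mkcond; apply: eq_bigr => h _ /=; case: (h == _).
Qed.

Lemma evaluation_row v (V : 'M[K]_n := \matrix_(k, i) v i k) :
  ext_act mu V x = evaluation v.
Proof.
rewrite evaluation_act; apply: eq_evaluation => i k.
by rewrite mx_act_unit mxE.
Qed.

Lemma evaluation_weight k z : z != 0 -> ext_act mu (torus k z) x = z ^+ lw a b d k *: x.
Proof.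
move=> _; have := FH_pure (fun i l => torus k z l i).
rewrite pure_torus !linearZ /= FH_pure => ->; rewrite evaluation_act.
by apply: eq_evaluation => i l; rewrite mx_act_unit.
Qed.

Lemma H_step_rec : step_rec (K := K) b d (fun t => (t \in H)%:R).
Proof.
move=> t le_t lt_t; have [lt_b|] := ltnP t b.
  have lt_m : (t < minn b d)%N by rewrite leq_min lt_b.
  have := H_rec (isT : 1 <= t.+1)%N lt_m; rewrite !bin1 subn1 /= => ->.
  rewrite -mulrDl -natrD (natr_odd K2) oddD oddB //= oddD /= oddB // (negbTE even_a).
  by case: (odd b); case: (odd t); rewrite mul0r.
move=> ge_b; have et : t = b by apply/eqP; rewrite eqn_leq le_t.
rewrite et subnn mul0r add0r.
have lt_m : (b <= minn b d)%N by rewrite leq_min leqnn -et ltnW.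
have := H_rec (b_gt0 : 1 <= b)%N lt_m; rewrite !bin1 subnKC // (natr_odd K2 a.+1) /= even_a mul1r.
rewrite (natr_odd K2) (natr_odd K2 b.+1) /= => <-.
by case: (odd b); rewrite ?mul0r // mulr0.
Qed.

Lemma evaluation_invariant (j j' : N) z : j' = j.+1 :> nat ->
  ext_act mu (elementary j j' z) x = x.
Proof.
apply: (invariant_of_coords K_inf o1E o2E le_ba b_gt0 _ evaluation_weight K2
  (cc := fun t => (t \in H)%:R) coord_evaluation H_step_rec); last exact/(sum_recP K2).
by rewrite -FH_pure subvsP.
Qed.

Lemma evaluation_row_op (j j' : N) z v : j' = j.+1 :> nat ->
  evaluation (row_op z predT j j' v) = evaluation v.
Proof.
move=> jE; rewrite -(evaluation_row v) -[in RHS](evaluation_invariant z jE) !evaluation_act.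
apply: eq_evaluation => i k.
have rowE i' : \sum_k' v k' k * unit_rows K i' k' = v i' k.
  rewrite (bigD1 i') //= /unit_rows eqxx mulr1 big1 ?addr0 // => k' /negbTE ->.
  exact: mulr0.
transitivity (\sum_k' v k' k * row_op z predT j j' (@unit_rows K n) i k'); last first.
  by apply: eq_bigr => k' _; rewrite mxE mx_act_unit elementary_row_op.
rewrite /row_op !andbT; case: (i == j'); last by rewrite rowE.
rewrite -[in LHS](rowE i) -[in LHS](rowE j) big_distrr -big_split.
by apply: eq_bigr => k' _ /=; ring.
Qed.

Lemma evaluation_neq0 : x != 0.
Proof.
have [h hH] : exists h, h \in H.
  by case: (H) H_neq0 => // h H' _; exists h; apply: mem_head.
have := H_le hH; rewrite leq_min => /andP[le_hb le_hd].
have ft : fit a b d (row1 o1 (first_ks b o1 o2 h)) (first_l a b d o1 o2 h).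
  by apply: (fit_first o1E o2E le_ba b_gt0 lt_dn); rewrite ?subnK ?subnKC ?[(h + _)%N]addnC //;
    move: le_hb le_hd le_ba; clear; lia.
have cX k : count_mem k (first_ks b o1 o2 h) = ((k == 1 :> nat) * (b - h) + (1 < k < h.+2))%N.
  by rewrite count_cat (count_o2 o2E) (count_X o1E o2E le_ba b_gt0 lt_dn).
have nk : o1 \notin first_ks b o1 o2 h by apply/count_memPn; rewrite cX o1E.
have := coord_evaluation nk ft; rewrite cX o2E mul1n addn0 subKn // hH => c1.
apply: contra_eq_neq c1 => ->; rewrite -[0](scale0r 0) -[coord _ _ _]/(coordf _ _) coordfZ.
by rewrite mul0r eq_sym oner_eq0.
Qed.

Lemma FH_generator : exists f : 'Hom(subvs_of (Weyl K n la), subvs_of (Weyl K n mu)),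
  [/\ f \in HomG K n la mu, FH = (f \o Weyl_proj K n la)%VF & f != 0].
Proof.
have [Phi PhiE] : exists Phi : 'Hom(ext K n la, ext K n mu),
    (linfun vsval \o FH)%VF = (Phi \o dprime K n la)%VF.
  apply: (factor_dprime K_inf (lam_dec o1E o2E le_ba b_gt1 d_gt1 lt_dn)) => j j' z v jE.
  by rewrite !comp_lfunE !lfunE /= !FH_pure evaluation_row_op.
pose f : 'Hom(subvs_of (Weyl K n la), subvs_of (Weyl K n mu)) :=
  (linfun (vsproj (Weyl K n mu)) \o Phi \o linfun vsval)%VF.
have fv v : f v = vsproj (Weyl K n mu) (Phi (vsval v)) by rewrite /f !comp_lfunE !lfunE.
have fE y : f (Weyl_proj K n la y) = FH y.
  rewrite fv Weyl_projE -(comp_lfunE Phi (dprime K n la)) -PhiE.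
  by rewrite comp_lfunE lfunE /= vsvalK.
have FHE : FH = (f \o Weyl_proj K n la)%VF by apply/lfunP => y; rewrite comp_lfunE fE.
exists f; split=> //; last first.
  apply: contra_neq evaluation_neq0 => f0; rewrite -FH_pure FHE f0.
  by rewrite comp_lfunE zero_lfunE linear0.
apply/HomGP => g gU v w vw.
have /memv_imgP[y _ vE] := subvsP v; have [s sE] := pure_span K_inf y.
have -> : v = Weyl_proj K n la y by apply: subvs_inj; rewrite Weyl_projE.
pose y' := \sum_(t <- s) t.1 *: pure la (fun i => mx_act g (t.2 i)).
have -> : w = Weyl_proj K n la y'.
  apply: subvs_inj; rewrite Weyl_projE vw vE sE !linear_sum; apply: eq_bigr => t _.
  by rewrite !linearZ /= !dprime_pure ext_act_wedges.
rewrite !fE sE !linear_sum /=; apply: eq_bigr => t _; rewrite !linearZ /=.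
by rewrite !FH_pure evaluation_act.
Qed.

End Generator.
End Existence.

From mathcomp Require Import classical_sets cardinality.

Theorem theorem3p9 (K : fieldType) (p n r a b d : nat)
    (K_infinite : infinite_set [set: K]%classic)
    (K_char : p \in [pchar K])
    (r_gt0 : (0 < r)%N) (le_r_n : (r <= n)%N)
    (la_part : is_part n r (lam a b d))
    (mu_part : is_part 2 r (mu2 a b d))
    (b_ge2 : (2 <= b)%N) (d_ge2 : (2 <= d)%N) :
  let Hom_S := HomG K n (pad n (lam a b d)) (pad 2 (mu2 a b d)) in
  (p = 2%N ->
     [/\ (\dim Hom_S <= 1)%N,
         (Hom_S != 0%VS <-> ~~ odd a),
         (~~ odd a -> ~~ odd b ->
            induces_generator (\sum_(h <- H1 a b d) Fh K n a b d h)) &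
         (~~ odd a -> odd b ->
            induces_generator (\sum_(h <- H2 a b d) Fh K n a b d h))]) /\
  ((2 < p)%N -> Hom_S = 0%VS).
Proof.
have K_inf (s : seq K) : exists x, x \notin s.
  apply: contrapT => none; apply: K_infinite.
  apply: (sub_finite_set (B := [set` s]%classic)); last exact: finite_seq.
  by move=> x _ /=; apply: contrapT => /negP ns; apply: none; exists x.
have [le_ba rE] : (b <= a)%N /\ r = (a + b + d)%N.
  move/and3P: la_part => [/= /andP[le_ba _] /eqP <- _]; split=> //.
  by rewrite sumn_nseq mul1n addnA.
have lt_dn : (d.+1 < n)%N by apply: leq_trans le_r_n; rewrite rE; lia.
have lt1n : (1 < n)%N by apply: leq_ltn_trans lt_dn.
pose o1 : 'I_n := Ordinal (ltnW lt1n).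
pose o2 : 'I_n := Ordinal lt1n.
have o1E : o1 = 0%N :> nat by [].
have o2E : o2 = 1%N :> nat by [].
move=> Hom_S; split=> [p2|p_gt2]; last first.
  have K_odd : 2%:R != 0 :> K.
    rewrite -(dvdn_pcharf K_char); apply/negP => /(dvdn_leq (isT : 0 < 2)%N).
    by rewrite leqNgt p_gt2.
  apply/eqP; rewrite -subv0; apply/subvP => f f_G.
  by rewrite memv0 (hom_zero_odd K_inf o1E o2E le_ba b_ge2 d_ge2 lt_dn f_G K_odd).
have K2 : 2%N \in [pchar K] by rewrite -p2.
have dim1 := dim_HomG K_inf o1E o2E le_ba b_ge2 d_ge2 lt_dn K2.
have gen (H : seq nat) : uniq H -> (forall h, h \in H -> (h <= minn b d)%N) -> H != [::] ->
    ~~ odd a -> closed_rec (K := K) (a - b) (minn b d) (fun t => (t \in H)%:R) ->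
    Hom_S != 0%VS /\ induces_generator (\sum_(h <- H) Fh K n a b d h).
  move=> UH leH H0 even_a Hrec.
  have [f [f_G FE nz]] :=
    FH_generator K_inf o1E o2E le_ba b_ge2 d_ge2 lt_dn K2 UH leH H0 even_a Hrec.
  split; first by apply: contraNneq nz => H_0; rewrite -memv0 -H_0.
  by exists f; split=> //; apply: (HomG_line K_inf o1E o2E).
have gen1 : ~~ odd a -> ~~ odd b ->
    Hom_S != 0%VS /\ induces_generator (\sum_(h <- H1 a b d) Fh K n a b d h).
  move=> even_a even_b; have m_gt1 : (1 < minn b d)%N by rewrite leq_min b_ge2.
  have [le_i0 gi0 i0_max] := max_two_compl (H1_l b d) (a - b)./2.
  move: le_i0 gi0 i0_max; rewrite -/(H1_i0 a b d) => le_i0 gi0 i0_max.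
  have memH t : (t \in H1 a b d) = odd t && (t <= minn b d)%N && odd 'C(t./2, H1_i0 a b d).
    apply/mapP/idP => [[h]|/andP[/andP[odd_t le_t] ct]].
      rewrite mem_filter mem_iota contains2E => /andP[ct lt_h] ->.
      rewrite /= odd_double uphalf_double ct andbT /=.
      by move: lt_h; rewrite /H1_l; move: m_gt1; clear; lia.
    exists t./2; last by rewrite -[LHS]odd_double_half odd_t.
    rewrite mem_filter mem_iota contains2E ct /H1_l add0n ltnS /=.
    by move: odd_t le_t; clear; lia.
  apply: gen => //.
  - by rewrite map_inj_uniq ?filter_uniq ?iota_uniq // => h h' [] /double_inj.
  - by move=> h; rewrite memH => /andP[/andP[]].
  - apply/eqP => H0; have := memH (H1_i0 a b d).*2.+1; rewrite H0 in_nil /= odd_double.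
    rewrite uphalf_double binn andbT /=; move: le_i0 m_gt1; rewrite /H1_l; clear; lia.
  have gE : (a - b)%N = (a - b)./2.*2.
    by rewrite -[LHS]odd_double_half oddB // (negbTE even_a) (negbTE even_b).
  have mE : minn b d = (minn b d).-1.+1 by rewrite prednK // ltnW.
  have rec : closed_rec (K := K) (a - b) (minn b d)
      (fun t => (odd t && odd 'C(t./2, H1_i0 a b d))%:R).
    rewrite gE mE; apply/(closed_rec_parity K2)/parity_rec_odd.
    exact: contains_parity_rec gi0 i0_max.
  move=> q B le_q le_B; rewrite !memH le_B (leq_trans (leq_subr _ _) le_B) !andbT.
  exact: rec.
have gen2 : ~~ odd a ->
    Hom_S != 0%VS /\ induces_generator (\sum_(h <- H2 a b d) Fh K n a b d h).
  move=> even_a; have [le_j0 gj0 j0_max] := max_two_compl (minn b d) (a - b).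
  move: le_j0 gj0 j0_max; rewrite -/(H2_j0 a b d) => le_j0 gj0 j0_max.
  have memH t : (t \in H2 a b d) = odd 'C(t, H2_j0 a b d) && (t <= minn b d)%N.
    by rewrite mem_filter mem_iota contains2E add0n ltnS.
  apply: gen => //.
  - by rewrite filter_uniq ?iota_uniq.
  - by move=> h; rewrite memH => /andP[].
  - apply/eqP => H0; have := memH (H2_j0 a b d); rewrite H0 in_nil binn le_j0.
    by [].
  have rec := closed_rec_parity K2 (contains_parity_rec gj0 j0_max).
  move=> q B le_q le_B; rewrite !memH le_B (leq_trans (leq_subr _ _) le_B) !andbT.
  exact: rec.
split=> //; last 2 first.
- by move=> even_a even_b; case: (gen1 even_a even_b).
- by move=> even_a _; case: (gen2 even_a).
split=> [nz|even_a]; last by case: (gen2 even_a).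
apply: contra nz => odd_a; rewrite -subv0; apply/subvP => f f_G; rewrite memv0.
by rewrite (hom_zero_odd_first K_inf o1E o2E le_ba b_ge2 d_ge2 lt_dn f_G K2 odd_a).
Qed.
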